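(* Let $p\in(1,\infty)$, $r\in(0,\infty)$ and $m\in\mathbb{N}$ with $m\ge 2$. Then there exist potentials $q^-=q^-_{m,p,r}\in\mathcal{L}^p$ and $q^+=q^+_{m,p,r}\in\mathcal{L}^p$ such that $$\|q^-\|_p=\|q^+\|_p=r$$ and $$\mathscr{E}_m^-=\mathscr{E}_m(q^-),\qquad \mathscr{E}_m^+=\mathscr{E}_m(q^+).$$
   Context: Let $\Omega=[0,1]$ and $\mathcal{L}^p:=L^p(\Omega,\mathbb{R})$ with its usual norm $\|\cdot\|_p$. For $q\in\mathcal{L}^p$ consider the Dirichlet eigenvalue problem $$-\psi''+q\psi=\lambda\psi,\quad x\in\Omega,\qquad \psi(0)=\psi(1)=0,$$ whose eigenvalues form an increasing sequence $\lambda_1(q)<\lambda_2(q)<\cdots$ with $\lambda_m(q)\to+\infty$. Put $\mathscr{E}_m(q):=\sum_{i=1}^m\lambda_i(q)$ and $B_{p,r}:=\{q\in\mathcal{L}^p:\|q\|_p\le r\}$. Then $\mathscr{E}_m^-$ and $\mathscr{E}_m^+$ denote the minimum and the maximum of $\mathscr{E}_m$ over $B_{p,r}$ (that they are attained is part of the assertion: a priori they are the infimum and the supremum). *)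

(* Defs.v *)
From HB Require Import structures.
From mathcomp Require Import all_boot all_order all_algebra.
From mathcomp Require Import all_classical all_reals all_analysis.

Set Implicit Arguments.
Unset Strict Implicit.
Unset Printing Implicit Defensive.

Import Order.TTheory GRing.Theory Num.Theory.
Import numFieldNormedType.Exports.

Local Open Scope classical_set_scope.
Local Open Scope ring_scope.

Section DirichletEigenvalues.
Variable R : realType.
Implicit Types (p r lam : R) (m : nat) (q f g psi : R -> R).

(* Lebesgue measure of [0, 1], carried by the whole line: functions are defined
   on R, but their values outside [0, 1] are irrelevant. *)
Definition mu01 : {measure set (measurableTypeR R) -> \bar R} :=
  mrestr (@lebesgue_measure R) (@measurable_itv R `[0, 1]).

Definition Lp01 p : set (R -> R) := [set q | q \in Lfun mu01 p%:E].

Definition Lp01_norm p q : \bar R := 'N[mu01]_p%:E [EFin \o q]%E.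

(* f is absolutely continuous on [0, 1] with derivative g: g is in L^1(0, 1) and
   f is an indefinite integral of g (equivalently, f is in W^{1,1}(0, 1), is its
   own continuous representative, and has weak derivative g). *)
Definition ac_derivative01 f g : Prop :=
  lebesgue_measure.-integrable `[0, 1] (EFin \o g) /\
  forall x, x \in `[0, 1] ->
    f x = f 0 + \int[lebesgue_measure]_(t in `[0, x]) g t.

(* As q is only in L^p, the equation is understood in the usual (Caratheodory)
   sense: psi and psi' are absolutely continuous and the equation holds almost
   everywhere.  The operator is self-adjoint, so that real eigenvalues and
   real-valued eigenfunctions suffice. *)
Definition dirichlet_eigenfunction q lam psi : Prop :=
  [/\ exists psi' psi'' : R -> R,
        [/\ ac_derivative01 psi psi', ac_derivative01 psi' psi'' &
            {ae lebesgue_measure, forall x, x \in `[0, 1] ->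
               - psi'' x + q x * psi x = lam * psi x}],
      psi 0 = 0, psi 1 = 0 &
      exists2 x, x \in `[0, 1] & psi x != 0].

Definition dirichlet_spectrum q : set R :=
  [set lam | exists psi, dirichlet_eigenfunction q lam psi].

Definition eigenvalue_enumeration q (l : R^nat) : Prop :=
  [/\ increasing_seq l, range l = dirichlet_spectrum q & l @ \oo --> +oo].

(* The enumeration is unique, being strictly increasing ([increasing_seq] is
   strict) with prescribed range.  Indices start at 0: the m-th eigenvalue of
   the literature, m >= 1, is [dirichlet_eigenvalue q m.-1]. *)
Definition dirichlet_eigenvalue q : R^nat :=
  xget (fun=> 0) [set l | eigenvalue_enumeration q l].

Definition eigenvalue_sum m q : R := \sum_(i < m) dirichlet_eigenvalue q i.

Definition Lp01_ball p r : set (R -> R) :=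
  [set q | Lp01 p q /\ (Lp01_norm p q <= r%:E)%E].

(* Infimum and supremum are taken in the extended reals, so that an equality
   with a real number entails that they are finite. *)
Definition eigenvalue_sum_inf m p r : \bar R :=
  ereal_inf [set (eigenvalue_sum m q)%:E | q in Lp01_ball p r].

Definition eigenvalue_sum_sup m p r : \bar R :=
  ereal_sup [set (eigenvalue_sum m q)%:E | q in Lp01_ball p r].

End DirichletEigenvalues.

(* Main.v *)
Require Import Defs.
From HB Require Import structures.
From mathcomp Require Import all_boot all_order all_algebra.
From mathcomp Require Import all_classical all_reals all_analysis.
From mathcomp Require Import measurable_realfun ring lra.

(** Write E_m(q) for the sum of the first m Dirichlet eigenvalues.  Everything
    rests on the variational formula of Ky Fan: E_m(q) is the minimum, over the
    L^2-orthonormal frames f_1, ..., f_m of H^1_0, of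

      sum_i int f_i'^2 + int q rho_f,   where rho_f = sum_i f_i^2

    ([eigenvalue_sum_frame], [eigenvalue_sum_le_frame]).  So E_m is a minimum of
    functions that are affine in q: it is concave, and E_m(q + c) = E_m(q) + m c.

    Minimum ([exists_minimizer]).  Exchange the two minimizations.  For a fixed
    density rho >= 0 the potential of the ball minimizing int q rho is explicit:
    it is the equality case of Hoelder's inequality, of norm r
    ([linear_minimizer]).  Along a minimizing sequence of potentials the optimal
    frames have bounded energy, so their densities converge uniformly to some rho
    along a subsequence; the explicit potential attached to rho then is a
    minimizer.

    Maximum ([exists_maximizer]).  If the norm of q is less than r, translating q
    upwards stays in the ball and raises E_m; hence near-maximizers have norm near
    r.  By concavity the midpoint of two near-maximizers is again one, so it also
    has norm near r, and the uniform strict convexity of the p-th power makes a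
    maximizing sequence Cauchy in L^1 ([maximizing_cauchy]).  The limit is in the
    ball, and the affine bound given by its own optimal frame shows that it is a
    maximizer; by translation again, its norm is r.

    The variational formula comes with the existence of the enumeration of the
    spectrum.  Minimizing the Rayleigh quotient successively on orthogonal
    complements yields an orthonormal sequence of weak eigenvectors with values
    tending to infinity ([exists_spectral_basis], [basis_unbounded]), to which
    the Ky Fan inequality applies ([ky_fan]).  By the lemma of du Bois-Reymond
    the weak eigenvectors are the Caratheodory solutions
    ([weak_eigenvector_dirichlet], [dirichlet_weak_eigenvector]), and uniqueness
    for the initial value problem makes the eigenvalues simple
    ([eigenvalues_simple]), so that the sequence is strictly increasing. *)

Set Implicit Arguments.
Unset Strict Implicit.
Unset Printing Implicit Defensive.

Import Order.TTheory GRing.Theory Num.Theory.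
Import numFieldNormedType.Exports.

Local Open Scope classical_set_scope.
Local Open Scope ring_scope.

(** * Symmetric bilinear forms on a subspace *)

Section SymmetricForms.
Context {R : realType} {E : lmodType R}.
Implicit Types (V : set E) (f : E -> E -> R).

(** The forms of interest are integrals, hence bilinear only where the integrands
    are integrable: linearity and symmetry are relative to a subspace. *)
Definition subspace V := V 0 /\ forall c u v, V u -> V v -> V (c *: u + v).

Definition symform V f :=
  (forall u v, V u -> V v -> f u v = f v u) /\
  (forall c u v w, V u -> V v -> V w -> f (c *: u + v) w = c * f u w + f v w).

Variable (V : set E).
Hypothesis V_sub : subspace V.

Let V0 : V 0. Proof. by case: V_sub. Qed.

Lemma subspaceZ c u : V u -> V (c *: u).
Proof. by move=> Vu; rewrite -[_ *: _]addr0; apply: V_sub.2. Qed.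

Lemma subspaceD u v : V u -> V v -> V (u + v).
Proof. by move=> Vu Vv; rewrite -[u]scale1r; apply: V_sub.2. Qed.

Lemma subspaceB u v : V u -> V v -> V (u - v).
Proof. by move=> Vu Vv; rewrite -scaleN1r; apply: subspaceD => //; exact: subspaceZ. Qed.

Lemma subspace_sum (I : Type) (s : seq I) (c : I -> R) (e : I -> E) :
  (forall i, V (e i)) -> V (\sum_(i <- s) c i *: e i).
Proof.
by move=> Ve; elim: s => [|i s ih]; rewrite ?big_nil// big_cons; exact: V_sub.2.
Qed.

Section form.
Variable f : E -> E -> R.
Hypothesis f_form : symform V f.

Lemma formC u v : V u -> V v -> f u v = f v u.
Proof. exact: f_form.1. Qed.

Lemma form0l w : V w -> f 0 w = 0.
Proof.
move=> Vw; have := f_form.2 1 0 0 w V0 V0 Vw.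
by rewrite scaler0 addr0 mul1r => /eqP; rewrite -subr_eq subrr => /eqP <-.
Qed.

Lemma formZl c u w : V u -> V w -> f (c *: u) w = c * f u w.
Proof.
by move=> Vu Vw; rewrite -[_ *: _]addr0 f_form.2// form0l// addr0.
Qed.

Lemma formDl u v w : V u -> V v -> V w -> f (u + v) w = f u w + f v w.
Proof. by move=> Vu Vv Vw; rewrite -[u in LHS]scale1r f_form.2// mul1r. Qed.

Lemma formBl u v w : V u -> V v -> V w -> f (u - v) w = f u w - f v w.
Proof.
move=> Vu Vv Vw; rewrite -scaleN1r formDl ?formZl ?mulN1r//.
exact: subspaceZ.
Qed.

Lemma form_suml (I : Type) (s : seq I) (c : I -> R) (e : I -> E) w :
  (forall i, V (e i)) -> V w ->
  f (\sum_(i <- s) c i *: e i) w = \sum_(i <- s) c i * f (e i) w.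
Proof.
move=> Ve Vw; elim: s => [|i s ih]; rewrite ?big_nil ?form0l// !big_cons.
by rewrite f_form.2 ?ih//; exact: subspace_sum.
Qed.

Lemma form_sqrD u v : V u -> V v ->
  f (u + v) (u + v) = f u u + 2 * f u v + f v v.
Proof.
move=> Vu Vv; have Vuv := subspaceD Vu Vv.
rewrite formDl// [f u (u + v)]formC// [f v (u + v)]formC// !formDl//.
by rewrite (formC Vv Vu); ring.
Qed.

Lemma form_sqrZ c u : V u -> f (c *: u) (c *: u) = c ^+ 2 * f u u.
Proof.
move=> Vu; have Vc := subspaceZ c Vu.
by rewrite formZl// formC// formZl// mulrA.
Qed.

Lemma formZZ c d u v : V u -> V v -> f (c *: u) (d *: v) = c * d * f u v.
Proof.
move=> Vu Vv; have Vc := subspaceZ c Vu; have Vd := subspaceZ d Vv.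
by rewrite formZl// (formC Vu Vd) formZl// (formC Vv Vu) mulrA.
Qed.

Lemma form_sqrDZ u c v : V u -> V v ->
  f (u + c *: v) (u + c *: v) = f u u + 2 * c * f u v + c ^+ 2 * f v v.
Proof.
move=> Vu Vv; have Vc := subspaceZ c Vv.
rewrite form_sqrD// form_sqrZ// [f u (c *: v)]formC// formZl// [f v u]formC//.
by ring.
Qed.

Lemma form_sqrB u v : V u -> V v ->
  f (u - v) (u - v) = f u u - 2 * f u v + f v v.
Proof.
by move=> Vu Vv; rewrite -scaleN1r form_sqrDZ//; ring.
Qed.

Lemma form_parallelogram u v : V u -> V v ->
  f (u - v) (u - v) = 2 * f u u + 2 * f v v - f (u + v) (u + v).
Proof. by move=> Vu Vv; rewrite form_sqrB// form_sqrD//; ring. Qed.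

End form.

Lemma symformB f g c : symform V f -> symform V g ->
  symform V (fun u v => f u v - c * g u v).
Proof.
move=> ff gf; split=> [u v Vu Vv|k u v w Vu Vv Vw].
  by rewrite (formC ff)// (formC gf).
by rewrite ff.2// gf.2//; ring.
Qed.

End SymmetricForms.

(** The first-order condition at a minimum. *)
Lemma quadratic_ge0_eq0 {R : realFieldType} (x y : R) :
  (forall t : R, 0 <= 2 * t * x + t ^+ 2 * y) -> x = 0.
Proof.
move=> h; apply/eqP/negPn/negP => x0.
have x2 : 0 < x ^+ 2 by rewrite exprn_even_gt0.
have z0 : 0 < `|y| + 1 by rewrite ltr_wpDl.
(* the step is short enough for the linear term to win over the quadratic one *)
have := h (- x / (`|y| + 1)).
have -> : 2 * (- x / (`|y| + 1)) * x + (- x / (`|y| + 1)) ^+ 2 * y =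
  (x ^+ 2 / (`|y| + 1) ^+ 2) * (y - 2 * (`|y| + 1)).
  by field; rewrite gt_eqF.
rewrite pmulr_rge0 ?divr_gt0// ?exprn_gt0//.
have := ler_norm y; have := normr_ge0 y; lra.
Qed.

(** * Energy spaces: the abstract spectral theorem *)

Lemma le0_of_le_inv {R : archiRealFieldType} (x K : R) :
  (forall n : nat, x <= K * harmonic n) -> x <= 0.
Proof.
move=> h; rewrite leNgt; apply/negP => x0.
rewrite /harmonic in h *; pose N := Num.truncn (K / x); have := h N; rewrite leNgt => /negP; apply.
rewrite ltr_pdivrMr// mulrC -ltr_pdivrMr//.
exact: truncnS_gt.
Qed.

Section SpectralTheory.
Context {R : realType} {E : lmodType R}.
Implicit Types (e : nat -> E).

(** The model is H^1_0(0, 1) with the L^2 product [a] and the Dirichlet form [D].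
    The last three fields are Rellich compactness, completeness for the energy
    seminorm, and infinite dimension.  The forms are only semidefinite, so that
    functions need not be identified almost everywhere; and the rates 1/(n+1)
    spare extracting subsequences of subsequences. *)
Record energy_space (V : set E) (a D : E -> E -> R) : Prop := {
  energy_subspace : subspace V ;
  energy_inner : symform V a ;
  inner_ge0 : forall u, V u -> 0 <= a u u ;
  inner_le_energy : forall u, V u -> a u u <= D u u ;
  energy_compact : forall (K : R) (u : nat -> E),
    (forall n, V (u n) /\ D (u n) (u n) <= K) ->
    exists2 k : nat -> nat, (forall n, (n <= k n)%N) &
      forall i j, a (u (k i) - u (k j)) (u (k i) - u (k j)) <=
                  harmonic i + harmonic j ;
  energy_complete : forall (K : R) (u : nat -> E),
    (forall n, V (u n)) ->
    (forall i j, D (u i - u j) (u i - u j) <=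
                 K * (harmonic i + harmonic j)) ->
    exists2 v, V v & forall n, D (u n - v) (u n - v) <= K * harmonic n ;
  energy_infinite : exists h : nat -> nat -> E, forall n,
    [/\ forall i, V (h n i), forall i, (i <= n)%N -> a (h n i) (h n i) = 1
      & forall i j, i != j -> a (h n i) (h n j) = 0] }.

(** Garding's inequality and its converse: [b] controls the energy up to the
    inner product, as does the form of a Schroedinger operator. *)
Record semibounded (V : set E) (a D b : E -> E -> R) (C B : R) : Prop := {
  semi_form : symform V b ;
  energy_le_semi : forall u, V u -> D u u <= 2 * b u u + C * a u u ;
  semi_le_energy : forall u, V u -> b u u <= B * D u u }.

Variables (V : set E) (a D : E -> E -> R).
Hypothesis VaD : energy_space V a D.
Let Vs := energy_subspace VaD.
Let af := energy_inner VaD.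

Definition orthonormal n e := (forall i, (i < n)%N -> V (e i)) /\
  forall i j, (i < n)%N -> (j < n)%N -> a (e i) (e j) = (i == j)%:R.

(** For an orthonormal [e], the orthogonal projection onto the complement of
    [e 0], ..., [e n.-1]. *)
Definition residual n e u := u - \sum_(i < n) a u (e i) *: e i.

Section Residual.
Variables (n : nat) (e : nat -> E).
Hypothesis on : orthonormal n e.

Let Ve (i : 'I_n) : V (e i). Proof. exact: on.1. Qed.

Let Vsum (c : 'I_n -> R) : V (\sum_(i < n) c i *: e i).
Proof. exact: (subspace_sum Vs _ c Ve). Qed.

Lemma residual_in u : V u -> V (residual n e u).
Proof. by move=> Vu; apply: subspaceB. Qed.

Lemma inner_comb (c : 'I_n -> R) (j : 'I_n) :
  a (\sum_(i < n) c i *: e i) (e j) = c j.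
Proof.
rewrite (form_suml Vs af)// (bigD1 j)//= on.2// eqxx mulr1 big1 ?addr0// => i ij.
by rewrite on.2// (inj_eq val_inj) (negbTE ij) mulr0.
Qed.

Lemma residual_orth u j : V u -> (j < n)%N -> a (residual n e u) (e j) = 0.
Proof.
move=> Vu jn; have Vej := on.1 _ jn.
by rewrite (formBl Vs af)// (inner_comb _ (Ordinal jn)) subrr.
Qed.

(** If the [e i] are eigenvectors of [f], the mixed terms collapse and [f] splits
    along the decomposition; the eigenvalue 1 and [f = a] give Pythagoras. *)
Lemma semi_residual (f : E -> E -> R) (l : nat -> R) u :
  symform V f -> (forall i v, (i < n)%N -> V v -> f (e i) v = l i * a (e i) v) ->
  V u ->
  f (residual n e u) (residual n e u) =
  f u u - \sum_(i < n) l i * a u (e i) ^+ 2.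
Proof.
move=> ff fe Vu; rewrite (form_sqrB Vs ff)//.
set s := \sum_(i < n) _ *: _; have Vsu : V s by exact: Vsum.
have fsv v : V v -> f s v = \sum_(i < n) l i * a u (e i) * a (e i) v.
  move=> Vv; rewrite (form_suml Vs ff)//; apply: eq_bigr => i _.
  by rewrite fe//; ring.
have -> : f u s = \sum_(i < n) l i * a u (e i) ^+ 2.
  rewrite (formC ff)// fsv//; apply: eq_bigr => i _.
  by rewrite (formC af (Ve i) Vu); ring.
have -> : f s s = \sum_(i < n) l i * a u (e i) ^+ 2.
  rewrite fsv//; apply: eq_bigr => i _.
  by rewrite (formC af (Ve i) Vsu) inner_comb; ring.
ring.
Qed.

Lemma inner_residual u : V u ->
  a (residual n e u) (residual n e u) = a u u - \sum_(i < n) a u (e i) ^+ 2.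
Proof.
move=> Vu; rewrite (semi_residual (l := cst 1))//.
  by under eq_bigr do rewrite mul1r.
by move=> i v _ _; rewrite mul1r.
Qed.

Lemma bessel u : V u -> \sum_(i < n) a u (e i) ^+ 2 <= a u u.
Proof.
move=> Vu; rewrite -subr_ge0 -inner_residual//.
exact: (inner_ge0 VaD (residual_in Vu)).
Qed.

End Residual.

(** A dimension count without linear algebra: if the [n] vectors [e i] spanned
    [n.+1] orthonormal vectors, summing Parseval's identities over the latter and
    exchanging the sums would give [n.+1 <= n] by Bessel's inequality. *)
Lemma exists_unit_orth n e : orthonormal n e -> exists u, [/\ V u, a u u = 1 &
  forall i, (i < n)%N -> a u (e i) = 0].
Proof.
move=> on; have [h /(_ n) [Vh h1 hh]] := energy_infinite VaD.
have onh : orthonormal n.+1 (h n).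
  split=> [i _|i j]; first exact: Vh.
  by rewrite !ltnS => ilt jlt; case: eqVneq => [<-|/hh//]; rewrite h1.
suff [k kn hk] : exists2 k, (k < n.+1)%N &
    0 < a (residual n e (h n k)) (residual n e (h n k)).
  set w := residual n e (h n k) in hk *.
  have Vw : V w by exact: residual_in.
  exists ((Num.sqrt (a w w))^-1 *: w); split; first exact: subspaceZ.
    rewrite (form_sqrZ Vs af)// exprVn sqr_sqrtr ?mulVf ?gt_eqF//.
    exact: ltW.
  move=> i ilt; rewrite (formZl Vs af) ?residual_orth ?mulr0//.
  exact: on.1.
apply: contrapT => /forall2NP hk.
have hk0 (k : 'I_n.+1) : a (h n k) (h n k) <= \sum_(i < n) a (h n k) (e i) ^+ 2.
  have [//|] := hk k.
  by move=> /negP; rewrite -leNgt inner_residual// subr_le0.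
have : \sum_(k < n.+1) a (h n k) (h n k) <= n%:R.
  apply: le_trans (ler_sum _ (fun k _ => hk0 k)) _.
  rewrite exchange_big/=.
  rewrite (_ : n%:R = \sum_(i < n) (1 : R)); last by rewrite sumr_const card_ord.
  apply: ler_sum => i _; have Vei : V (e i) by exact: on.1.
  have <- : a (e i) (e i) = 1 by rewrite on.2 ?eqxx.
  apply: le_trans (bessel onh Vei).
  by apply: ler_sum => k _; rewrite (formC af (Vh k) Vei).
under eq_bigr => k _ do rewrite h1 ?leq_ord//.
by rewrite sumr_const card_ord ler_nat ltnn.
Qed.

End SpectralTheory.

Section Eigenvectors.
Context {R : realType} {E : lmodType R}.
Implicit Types (e : nat -> E).
Variables (V : set E) (a D b : E -> E -> R) (C B : R).
Hypothesis VaD : energy_space V a D.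
Hypothesis bC : semibounded V a D b C B.
Let Vs := energy_subspace VaD.
Let af := energy_inner VaD.
Let bf := semi_form bC.

Definition weak_eigenvector l u := V u /\ forall v, V v -> b u v = l * a u v.

Definition orthogonal_to n e u := V u /\ forall i, (i < n)%N -> a u (e i) = 0.

Lemma orthogonal_sub n e : (forall i, (i < n)%N -> V (e i)) ->
  subspace (orthogonal_to n e).
Proof.
move=> Ve; split; first by split=> [|i ni]; [exact: Vs.1|rewrite (form0l Vs af)//; exact: Ve].
move=> c u v [Vu uo] [Vv vo]; split=> [|i ni]; first exact: Vs.2.
by rewrite af.2 ?uo ?vo// ?mulr0 ?addr0//; exact: Ve.
Qed.

Definition eigenvalue_above n e l :=
  forall v, orthogonal_to n e v -> l * a v v <= b v v.

Definition next_eigenvector n e u := [/\ orthogonal_to n e u, a u u = 1,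
  weak_eigenvector (b u u) u & eigenvalue_above n e (b u u)].

Lemma semi_ge_inner u : V u -> (1 - C) * a u u <= 2 * b u u.
Proof.
move=> Vu; have := energy_le_semi bC Vu; have := inner_le_energy VaD Vu; lra.
Qed.

Lemma cauchy_schwarz1 u v : V u -> V v -> a v v = 1 -> a u v ^+ 2 <= a u u.
Proof.
move=> Vu Vv v1.
have := inner_ge0 VaD (subspaceD Vs Vu (subspaceZ Vs (- a u v) Vv)).
by rewrite (form_sqrDZ Vs af)// v1; nra.
Qed.

(** The first variation at a minimizer vanishes in the directions orthogonal to
    [e]; in the directions [e i] both sides vanish because [e i] is itself an
    eigenvector, so the constraints produce no Lagrange multipliers. *)
Lemma minimizer_eigenvector n e l u : orthonormal V a n e ->
  (forall i, (i < n)%N -> weak_eigenvector (b (e i) (e i)) (e i)) ->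
  orthogonal_to n e u -> b u u = l * a u u -> eigenvalue_above n e l ->
  weak_eigenvector l u.
Proof.
move=> on eig uo ul lmin; have [Vu uoe] := uo; split=> // v Vv.
have So := orthogonal_sub on.1.
suff orth w : orthogonal_to n e w -> b u w = l * a u w.
  have := orth (residual a n e v); set s := \sum_(i < n) a v (e i) *: e i.
  have Vsm : V s by apply: (subspace_sum Vs) => i; exact: on.1.
  have -> : residual a n e v = v - s by [].
  have Vr : V (v - s) by exact: subspaceB.
  (* the component of the test vector along the [e i] does not contribute *)
  have same f : symform V f -> (forall i, (i < n)%N -> f u (e i) = 0) ->
      f u (v - s) = f u v.
    move=> ff fe; rewrite (formC ff)// (formBl Vs ff)// (form_suml Vs ff)//; last first.
      by move=> i; exact: on.1.
    rewrite big1 ?subr0 ?(formC ff Vv Vu)// => i _; have Vei := on.1 i (ltn_ord i).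
    by rewrite (formC ff Vei Vu) fe ?mulr0.
  rewrite (same b)// ?(same a)//.
    apply; split=> //.
    by move=> i ni; rewrite (residual_orth VaD on).
  move=> i ni; have [Vei eigi] := eig i ni.
  by rewrite (formC bf Vu Vei) eigi// (formC af Vei Vu) uoe ?mulr0.
move=> wo; have [Vw _] := wo; apply/eqP; rewrite -subr_eq0; apply/eqP.
apply: (@quadratic_ge0_eq0 _ _ (b w w - l * a w w)) => t.
have := lmin _ (subspaceD So uo (subspaceZ So t wo)).
by rewrite (form_sqrDZ Vs bf)// (form_sqrDZ Vs af)// ul; lra.
Qed.

(** The direct method.  A minimizing sequence of the Rayleigh quotient has bounded
    energy, so a subsequence is Cauchy for [a]; the parallelogram identity for [b],
    together with the lower bound [l * a] at the sums, makes it Cauchy for [D].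
    The limit is a minimizer, since [b - l * a] is nonnegative on the orthogonal
    complement and tends to 0 along the sequence. *)
Lemma exists_next_eigenvector n e : orthonormal V a n e ->
  (forall i, (i < n)%N -> weak_eigenvector (b (e i) (e i)) (e i)) ->
  exists u, next_eigenvector n e u.
Proof.
move=> on eig; pose S := orthogonal_to n e.
have Ss : subspace S := orthogonal_sub on.1.
have SV u : S u -> V u by case.
pose L := [set b u u | u in [set u | S u /\ a u u = 1]].
have L0 : L !=set0.
  by have [u [Vu u1 uo]] := exists_unit_orth VaD on; exists (b u u); exists u.
have Llb : has_lbound L.
  exists ((1 - C) / 2) => _ [u [[Vu _] u1] <-].
  by have := semi_ge_inner Vu; rewrite u1; lra.
pose l := inf L.
have lmin : eigenvalue_above n e l.
  move=> v [Vv vo]; have := inner_ge0 VaD Vv.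
  rewrite le_eqVlt => /predU1P[v0|v0].
    by have := semi_ge_inner Vv; rewrite -v0; lra.
  pose c := (Num.sqrt (a v v))^-1.
  have c2 : c ^+ 2 = (a v v)^-1 by rewrite exprVn sqr_sqrtr// ltW.
  rewrite -ler_pdivlMr// mulrC -c2 -(form_sqrZ Vs bf)//.
  apply: ge_inf => //; exists (c *: v) => //; split.
    by apply: subspaceZ.
  by rewrite (form_sqrZ Vs af)// c2 mulVf// gt_eqF.
have minseq k : exists u, [/\ S u, a u u = 1 & b u u <= l + harmonic k].
  have [_ [u [Su u1] <-] ul] : exists2 x, L x & x < l + harmonic k.
    by apply: inf_adherent => //; exact: harmonic_gt0.
  by exists u; split=> //; exact: ltW.
have [u hu] := choice minseq.
have inv1 k : harmonic k <= 1 :> R by rewrite /harmonic invf_le1// ler1n.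
have [k kge ka] : exists2 k : nat -> nat, (forall n, (n <= k n)%N) &
      forall i j, a (u (k i) - u (k j)) (u (k i) - u (k j)) <=
                  harmonic i + harmonic j.
  apply: (energy_compact VaD (K := 2 * (l + 1) + C)) => i.
  have [[Vu _] u1 ul] := hu i; split=> //.
  by have := energy_le_semi bC Vu; rewrite u1; have := inv1 i; lra.
pose w i := u (k i).
have Sw i : S (w i) by case: (hu (k i)).
have Vw i : V (w i) by exact: SV.
have w1 i : a (w i) (w i) = 1 by case: (hu (k i)).
have bw i : b (w i) (w i) <= l + harmonic i.
  have [_ _ h] := hu (k i); apply: (le_trans h).
  by rewrite lerD2l /harmonic lef_pV2 ?posrE// ler_nat ltnS.
(* parallelogram for [b]: 2 b_i + 2 b_j - l (4 - a(w_i - w_j)), then Garding *)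
pose K := 4 + 2 * `|l| + `|C|.
have K0 : 0 <= K by rewrite !addr_ge0// mulr_ge0.
have [v Vv vlim] : exists2 v, V v &
    forall n, D (w n - v) (w n - v) <= K * harmonic n.
  apply: (energy_complete VaD) => // i j.
  have Sij := subspaceB Ss (Sw i) (Sw j).
  apply: (le_trans (energy_le_semi bC (SV _ Sij))).
  rewrite (form_parallelogram Vs bf)//.
  have := lmin _ (subspaceD Ss (Sw i) (Sw j)).
  have := form_parallelogram Vs af (Vw i) (Vw j).
  have := bw i; have := bw j; have := ka i j; have := inner_ge0 VaD (SV _ Sij).
  rewrite -/(w _) -/(w _) !w1.
  move: (a (w i - w j) _) (a (w i + w j) _) (b (w i + w j) _) (b (w i) _) (b (w j) _).
  move=> x y z bi bj x0 xle hj hi xy yz.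
  have : l * x <= `|l| * (harmonic i + harmonic j).
    by apply: (le_trans (ler_wpM2r x0 (ler_norm l))); exact: ler_wpM2l.
  have : C * x <= `|C| * (harmonic i + harmonic j).
    by apply: (le_trans (ler_wpM2r x0 (ler_norm C))); exact: ler_wpM2l.
  by have yE : y = 4 - x by [lra]; move: yz; rewrite yE /K; lra.
have Vwv i : V (w i - v) by exact: subspaceB.
have awv i : a (w i - v) (w i - v) <= K * harmonic i.
  exact: le_trans (inner_le_energy VaD (Vwv i)) (vlim i).
have So_v : S v.
  split=> // j jn; have Vej := on.1 j jn; apply/eqP; rewrite -sqrf_eq0.
  rewrite eq_le sqr_ge0 andbT; apply: (@le0_of_le_inv _ _ K) => i.
  apply: le_trans (awv i).
  apply: le_trans (cauchy_schwarz1 (Vwv i) Vej _); last by rewrite on.2 ?eqxx.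
  by rewrite (formBl Vs af)// (Sw i).2// sub0r sqrrN.
(* a positive lower bound is enough, as the limit is rescaled at the end *)
have v_half : 1 / 2 <= a v v.
  rewrite -subr_le0; apply: (@le0_of_le_inv _ _ K) => i.
  have := awv i; have := w1 i.
  have := form_parallelogram Vs af (Vwv i) Vv; rewrite subrK.
  have := inner_ge0 VaD (subspaceB Vs (Vwv i) Vv); lra.
have bv : b v v = l * a v v.
  apply/eqP; rewrite eq_le lmin// andbT -subr_le0.
  apply: (@le0_of_le_inv _ _ (2 + 2 * (`|B| + `|l|) * K)) => i.
  pose c u v := b u v - l * a u v.
  have cf : symform V c by apply: symformB.
  have Swv := subspaceB Ss (Sw i) So_v.
  have := form_parallelogram Vs cf (Vw i) (Vwv i).
  rewrite subKr.
  have : 0 <= c (w i + (w i - v)) (w i + (w i - v)).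
    by rewrite subr_ge0; apply: lmin; exact: (subspaceD Ss (Sw i) Swv).
  have : c (w i) (w i) <= harmonic i by rewrite /c w1; have := bw i; lra.
  have : c (w i - v) (w i - v) <= (`|B| + `|l|) * (K * harmonic i).
    rewrite /c; have := semi_le_energy bC (Vwv i); have := awv i; have := vlim i.
    have := inner_ge0 VaD (Vwv i).
    move: (a _ _) (b _ _) (D _ _) (inner_le_energy VaD (Vwv i)) => x y z xz x0 zK xK yz.
    have z0 : 0 <= z by exact: le_trans xz.
    have : B * z <= `|B| * (K * harmonic i).
      by apply: (le_trans (ler_wpM2r z0 (ler_norm B))); exact: ler_wpM2l.
    have : - l * x <= `|l| * (K * harmonic i).
      apply: (@le_trans _ _ (`|l| * x)); last exact: ler_wpM2l.
      by rewrite ler_wpM2r// -normrN ler_norm.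
    lra.
  rewrite /c; lra.
have v0 : 0 < a v v by apply: lt_le_trans v_half; lra.
pose c := (Num.sqrt (a v v))^-1.
have c2 : c ^+ 2 = (a v v)^-1 by rewrite exprVn sqr_sqrtr// ltW.
have Sc : S (c *: v) by exact: subspaceZ.
have c1 : a (c *: v) (c *: v) = 1 by rewrite (form_sqrZ Vs af)// c2 mulVf// gt_eqF.
have bc : b (c *: v) (c *: v) = l.
  by rewrite (form_sqrZ Vs bf)// bv mulrCA c2 mulVf ?mulr1// gt_eqF.
exists (c *: v); split; rewrite ?bc//.
by apply: minimizer_eigenvector Sc _ lmin => //; rewrite c1 bc mulr1.
Qed.

End Eigenvectors.

Section SpectralBasis.
Context {R : realType} {E : lmodType R}.
Implicit Types (e : nat -> E).
Variables (V : set E) (a D b : E -> E -> R) (C B : R).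
Hypothesis VaD : energy_space V a D.
Hypothesis bC : semibounded V a D b C B.
Let Vs := energy_subspace VaD.
Let af := energy_inner VaD.
Let bf := semi_form bC.

Definition spectral_basis e := forall n, next_eigenvector V a b n e (e n).

Section Basis.
Variable e : nat -> E.

Lemma next_eigenvectors_orthonormal n :
  (forall k, (k < n)%N -> next_eigenvector V a b k e (e k)) ->
  orthonormal V a n e.
Proof.
move=> he; split=> [i ni|i j ni nj]; first by case: (he i ni) => -[].
have [[Vi oi] i1 _ _] := he i ni; have [[Vj oj] j1 _ _] := he j nj.
have [ij|ij|->] := ltngtP i j; last by rewrite j1.
- by rewrite (formC af Vi Vj) oj.
- by rewrite oi.
Qed.

Hypothesis se : spectral_basis e.

Lemma basis_orthonormal n : orthonormal V a n e.
Proof. by apply: next_eigenvectors_orthonormal. Qed.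

Lemma basis_in n : V (e n).
Proof. by case: (se n) => -[]. Qed.

Lemma basis_eigen n v : V v -> b (e n) v = b (e n) (e n) * a (e n) v.
Proof. by case: (se n) => _ _ [_ h] _; apply: h. Qed.

Lemma inner_basis i j : a (e i) (e j) = (i == j)%:R.
Proof. by apply: (basis_orthonormal (maxn i j).+1).2; rewrite ltnS ?leq_maxl ?leq_maxr. Qed.

Let l n := b (e n) (e n).

Lemma basis_nondecreasing i j : (i <= j)%N -> l i <= l j.
Proof.
move=> ij; have [[Vj oj] j1 _ _] := se j; have [_ _ _ lmin] := se i.
have := lmin (e j); rewrite j1 mulr1; apply; split=> // k ki.
by apply: oj; exact: leq_trans ki ij.
Qed.

(** Otherwise compactness would give an [a]-Cauchy subsequence of an orthonormal
    sequence, whose terms are at squared distance 2. *)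
Lemma basis_unbounded K : exists n, K < l n.
Proof.
apply: contrapT => /forallNP h.
have lK n : l n <= K by rewrite leNgt; apply/negP/h.
have [k kge ka] : exists2 k : nat -> nat, (forall n, (n <= k n)%N) &
      forall i j, a (e (k i) - e (k j)) (e (k i) - e (k j)) <=
                  harmonic i + harmonic j.
  apply: (energy_compact VaD (K := 2 * K + C)) => i.
  have Vi := basis_in i; split=> //.
  have := energy_le_semi bC Vi; rewrite inner_basis eqxx/= => h1.
  by have := lK i; rewrite /l; lra.
(* the second index lies beyond [k 1], hence is sent to a different vector *)
have := ka 1%N (k 1%N).+1.
have Vk := basis_in (k 1%N); have Vk' := basis_in (k (k 1%N).+1).
rewrite (form_sqrB Vs af)// !inner_basis !eqxx.
rewrite (_ : (k 1%N == k (k 1%N).+1) = false); last first.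
  by apply/eqP => kk; have := kge (k 1%N).+1; rewrite -kk ltnn.
have : harmonic (k 1%N).+1 <= 2^-1 :> R.
  by rewrite /harmonic lef_pV2 ?posrE// ler_nat.
have -> : harmonic 1 = 2^-1 :> R by [].
by move: (harmonic (k 1%N).+1) => x /=; lra.
Qed.

(** Eigenvectors of different eigenvalues are orthogonal, so an eigenvector with a
    value outside the sequence is orthogonal to the whole basis, and its value
    exceeds every [l n]. *)
Lemma eigenvector_value u k : weak_eigenvector V a b k u -> 0 < a u u ->
  exists n, k = l n.
Proof.
move=> [Vu ku] u0; apply: contrapT => /forallNP h.
have uo n : a u (e n) = 0.
  have Vn := basis_in n; have := ku _ Vn; rewrite (formC bf Vu Vn) basis_eigen//.
  rewrite (formC af Vn Vu) => /eqP; rewrite -subr_eq0 -mulrBl mulf_eq0 subr_eq0.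
  by case/orP => /eqP// ln; case: (h n).
have [n kn] := basis_unbounded k; have [_ _ _ lmin] := se n.
have : l n * a u u <= b u u by apply: lmin; split.
by rewrite ku// ler_pM2r// leNgt kn.
Qed.

(** The Ky Fan inequality.  Splitting [f i] along [e 0], ..., [e m.-1] bounds
    [b (f i) (f i)] below by [l m + sum_j (l j - l m) * a (f i) (e j) ^+ 2].  As
    [l j - l m <= 0], Bessel's inequality for the frame [f] at [e j] finishes. *)
Lemma ky_fan m (f : nat -> E) : orthonormal V a m f ->
  \sum_(i < m) l i <= \sum_(i < m) b (f i) (f i).
Proof.
move=> onf; have one := basis_orthonormal m.
have Vf (i : 'I_m) : V (f i) by exact: onf.1.
have fi (i : 'I_m) : l m + \sum_(j < m) (l j - l m) * a (f i) (e j) ^+ 2 <= b (f i) (f i).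
  have Vr := residual_in VaD one (Vf i).
  have [_ _ _ lmin] := se m.
  have := lmin (residual a m e (f i)).
  rewrite (inner_residual VaD one)// onf.2// eqxx mulrBr.
  rewrite (semi_residual (l := l) VaD one bf)//; last first.
    by move=> j v _ Vv; exact: basis_eigen.
  move=> H; under eq_bigr do rewrite mulrBl.
  rewrite sumrB -mulr_sumr.
  suff : l m * 1 - l m * \sum_(j < m) a (f i) (e j) ^+ 2 <=
      b (f i) (f i) - \sum_(j < m) l j * a (f i) (e j) ^+ 2 by lra.
  by apply: H; split=> // j jm; rewrite (residual_orth VaD one).
apply: le_trans (ler_sum _ (fun i _ => fi i)).
rewrite big_split/= exchange_big/= -big_split/=.
apply: ler_sum => j _; rewrite -mulr_sumr.
have lj : l j <= l m by apply: basis_nondecreasing; exact: ltnW.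
have sj : \sum_(i < m) a (f i) (e j) ^+ 2 <= 1.
  have Vj := basis_in j; have <- : a (e j) (e j) = 1 by rewrite inner_basis eqxx.
  apply: le_trans (bessel VaD onf Vj).
  by apply: ler_sum => i _; rewrite (formC af (Vf i) Vj).
nra.
Qed.

End Basis.

Lemma exists_spectral_basis : exists e, spectral_basis e.
Proof.
(* recursion on the list of the eigenvectors already chosen *)
pose next s := xget (0 : E) (next_eigenvector V a b (size s) (nth 0 s)).
pose fix L n := if n is k.+1 then rcons (L k) (next (L k)) else [::].
have sL n : size (L n) = n by elim: n => //= n ih; rewrite size_rcons ih.
pose e n := next (L n).
have Le n i : (i < n)%N -> nth 0 (L n) i = e i.
  elim: n => //= n ih; rewrite nth_rcons sL ltnS leq_eqVlt => /predU1P[->|ni].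
    by rewrite ltnn eqxx.
  by rewrite ni ih.
exists e; elim/ltn_ind => n ih.
have on := next_eigenvectors_orthonormal ih.
have [|u hu] := exists_next_eigenvector VaD bC on.
  by move=> i ni; case: (ih i ni).
have same v : next_eigenvector V a b n e v <->
    next_eigenvector V a b (size (L n)) (nth 0 (L n)) v.
  have so w : orthogonal_to V a n e w <-> orthogonal_to V a n (nth 0 (L n)) w.
    by split=> -[Vw ow]; split=> // i ni; have := ow i ni; rewrite Le.
  rewrite sL; split=> -[ov v1 vb lmin]; split=> //.
  - exact/so.
  - by move=> w ow; apply: lmin; apply/so.
  - exact/so.
  - by move=> w ow; apply: lmin; apply/so.
by apply/same; apply: (@xgetPex _ 0 (next_eigenvector _ _ _ _ _)); exists u; apply/same.
Qed.

End SpectralBasis.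

(** * Integrals and primitives on the unit interval *)

Section UnitInterval.
Context {R : realType}.
Implicit Types (f g h : R -> R) (x y c : R).
Local Notation mu := (@lebesgue_measure R).

Local Notation I01 := (`[(0 : R), (1 : R)]%classic).

Definition integrable01 f : Prop := mu.-integrable `[0, 1] (EFin \o f).
Definition int01 f : R := \int[mu]_(x in `[0, 1]) f x.
Definition primitive f x : R := \int[mu]_(t in `[0, x]) f t.
Definition square_integrable01 f : Prop :=
  measurable_fun I01 f /\ integrable01 (fun x => f x ^+ 2).

Let mI : measurable (`[0, 1] : set (measurableTypeR R)).
Proof. exact: measurable_itv. Qed.

Lemma mem01 x : (`[0, 1]%classic x) = (0 <= x <= 1) :> Prop.
Proof. by rewrite /= in_itv. Qed.

Lemma mu01_1 : mu `[0, 1] = 1%E.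
Proof. by rewrite lebesgue_measure_itv/= lte_fin ltr01 -EFinB subr0. Qed.

Lemma integrable01_meas f : integrable01 f -> measurable_fun I01 f.
Proof. by move=> /measurable_int /measurable_EFinP. Qed.

Lemma integrable01_le f g : measurable_fun I01 f ->
  (forall x, 0 <= x <= 1 -> `|f x| <= g x) -> integrable01 g -> integrable01 f.
Proof.
move=> mf fg; apply: le_integrable => //; first exact/measurable_EFinP.
move=> x /=; rewrite in_itv/= => x01; rewrite lee_fin (le_trans (fg _ x01))//.
exact: ler_norm.
Qed.

Lemma eq_integrable01 f g : (forall x, 0 <= x <= 1 -> f x = g x) ->
  integrable01 f -> integrable01 g.
Proof.
move=> fg; apply: eq_integrable => // x; rewrite inE/= in_itv/= => /fg fgx.
by rewrite fgx.
Qed.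

Lemma eq_int01 f g : (forall x, 0 <= x <= 1 -> f x = g x) -> int01 f = int01 g.
Proof. by move=> fg; apply: eq_Rintegral => x; rewrite inE/= in_itv/= => /fg. Qed.

Lemma integrable01_cst c : integrable01 (fun=> c).
Proof.
apply: measurable_bounded_integrable => //; first by rewrite [X in (X < _)%E]mu01_1 ltry.
by exists `|c|; split; [exact: num_real|move=> x xc y _; exact: ltW].
Qed.

Lemma integrable01D f g : integrable01 f -> integrable01 g ->
  integrable01 (fun x => f x + g x).
Proof. by move=> fi gi; exact: (integrableD mI fi gi). Qed.

Lemma integrable01Z c f : integrable01 f -> integrable01 (fun x => c * f x).
Proof. by move=> fi; exact: (integrableZl mI c fi). Qed.

Lemma integrable01B f g : integrable01 f -> integrable01 g ->
  integrable01 (fun x => f x - g x).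
Proof. by move=> fi gi; exact: (integrableB mI fi gi). Qed.

Lemma integrable01_norm f : integrable01 f -> integrable01 (fun x => `|f x|).
Proof. by move=> fi; exact: (integrable_norm fi). Qed.

Lemma integrable01_sum n (F : nat -> R -> R) :
  (forall i, (i < n)%N -> integrable01 (F i)) ->
  integrable01 (fun x => \sum_(i < n) F i x).
Proof.
elim: n => [_|n ih Fi].
  by apply: (eq_integrable01 _ (integrable01_cst 0)) => x _; rewrite big_ord0.
apply: (@eq_integrable01 (fun x => \sum_(i < n) F i x + F n x)).
  by move=> x _; rewrite big_ord_recr.
apply: integrable01D; last exact: Fi.
by apply: ih => i ni; apply: Fi; exact: ltnW.
Qed.

Lemma integrable01M f h c : integrable01 f -> measurable_fun I01 h ->
  (forall x, 0 <= x <= 1 -> `|h x| <= c) -> integrable01 (fun x => f x * h x).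
Proof.
move=> fi mh hc; apply: (@integrable01_le _ (fun x => c * `|f x|)).
- by apply: measurable_funM => //; exact: integrable01_meas.
- move=> x x01; rewrite normrM mulrC ler_wpM2r//; exact: hc.
- by apply: integrable01Z; exact: integrable01_norm.
Qed.

Lemma integrable01_bounded h c : measurable_fun I01 h ->
  (forall x, 0 <= x <= 1 -> `|h x| <= c) -> integrable01 h.
Proof. by move=> mh hc; exact: (integrable01_le mh hc (integrable01_cst c)). Qed.

Lemma int01D f g : integrable01 f -> integrable01 g ->
  int01 (fun x => f x + g x) = int01 f + int01 g.
Proof. exact: RintegralD. Qed.

Lemma int01B f g : integrable01 f -> integrable01 g ->
  int01 (fun x => f x - g x) = int01 f - int01 g.
Proof. exact: RintegralB. Qed.

Lemma int01Z c f : integrable01 f -> int01 (fun x => c * f x) = c * int01 f.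
Proof. exact: RintegralZl. Qed.

Lemma int01_sum n (F : nat -> R -> R) :
  (forall i, (i < n)%N -> integrable01 (F i)) ->
  int01 (fun x => \sum_(i < n) F i x) = \sum_(i < n) int01 (F i).
Proof.
elim: n => [_|n ih Fi].
  rewrite big_ord0 (@eq_int01 _ (fun=> 0 * 0)); last by move=> x _; rewrite big_ord0 mulr0.
  by rewrite int01Z ?mul0r//; exact: integrable01_cst.
rewrite (@eq_int01 _ (fun x => \sum_(i < n) F i x + F n x)); last first.
  by move=> x _; rewrite big_ord_recr.
have Fi' i : (i < n)%N -> integrable01 (F i) by move=> ni; apply: Fi; exact: ltnW.
rewrite int01D ?ih ?big_ord_recr//; [exact: integrable01_sum|exact: Fi].
Qed.

Lemma int01_cst c : int01 (fun=> c) = c.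
Proof. by rewrite /int01 Rintegral_cst// [X in fine X]mu01_1/= mulr1. Qed.

Lemma int01_ge0 f : (forall x, 0 <= x <= 1 -> 0 <= f x) -> 0 <= int01 f.
Proof. by move=> f0; apply: Rintegral_ge0 => x; rewrite mem01 => /f0. Qed.

Lemma int01_le f g : integrable01 f -> integrable01 g ->
  (forall x, 0 <= x <= 1 -> f x <= g x) -> int01 f <= int01 g.
Proof. by move=> fi gi fg; apply: le_Rintegral => // x; rewrite mem01 => /fg. Qed.

Lemma int01_norm f : integrable01 f -> `|int01 f| <= int01 (fun x => `|f x|).
Proof. exact: le_normr_Rintegral. Qed.

Let sub_itv (a b : itv_bound R) : (BLeft 0 <= a)%O -> (b <= BRight 1)%O ->
  [set` Interval a b] `<=` `[0, 1]%classic.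
Proof. by move=> a0 b1; apply: subset_itv. Qed.

Lemma integrable_sub (J : set R) f : measurable (J : set (measurableTypeR R)) ->
  J `<=` `[0, 1]%classic -> integrable01 f -> mu.-integrable J (EFin \o f).
Proof. by move=> mJ J01; apply: integrableS. Qed.

Lemma primitive0 f : primitive f 0 = 0.
Proof. by rewrite /primitive set_itv1 Rintegral_set1. Qed.

Lemma primitiveB f x y : integrable01 f -> 0 <= x -> x <= y -> y <= 1 ->
  primitive f y - primitive f x = \int[mu]_(t in `]x, y]) f t.
Proof.
move=> fi x0 xy y1; apply: Rintegral_itvB; rewrite ?bnd_simp//.
by apply: integrable_sub fi => //; apply: sub_itv; rewrite ?bnd_simp.
Qed.

Lemma eq_primitive f g x : 0 <= x <= 1 ->
  (forall t, 0 <= t <= 1 -> f t = g t) -> primitive f x = primitive g x.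
Proof.
move=> /andP[x0 x1] fg; apply: eq_Rintegral => t.
rewrite inE/= in_itv/= => /andP[t0 tx]; apply: fg.
by rewrite t0 (le_trans tx).
Qed.

Lemma primitive_lin c f g x : integrable01 f -> integrable01 g -> 0 <= x <= 1 ->
  primitive (fun t => c * f t + g t) x = c * primitive f x + primitive g x.
Proof.
move=> fi gi /andP[x0 x1].
have s : `[0, x] `<=` `[0, 1]%classic by apply: sub_itv; rewrite ?bnd_simp.
rewrite /primitive RintegralD//; last 2 first.
- by apply: (integrable_sub _ s (integrable01Z c fi)) => //; exact: measurable_itv.
- by apply: (integrable_sub _ s gi) => //; exact: measurable_itv.
by rewrite RintegralZl//; apply: (integrable_sub _ s fi) => //; exact: measurable_itv.
Qed.

Lemma le_int_sub f (J : set R) : measurable (J : set (measurableTypeR R)) ->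
  J `<=` `[0, 1]%classic -> integrable01 f ->
  (forall x, 0 <= x <= 1 -> 0 <= f x) -> \int[mu]_(t in J) f t <= int01 f.
Proof.
move=> mJ J01 fi f0; rewrite -lee_fin /int01 /Rintegral !fineK; last 2 first.
- exact: integrable_fin_num.
- by apply: integrable_fin_num => //; exact: integrable_sub fi.
apply: ge0_subset_integral => //; exact: measurable_int fi.
Qed.

Lemma primitive_bound f x : integrable01 f -> 0 <= x <= 1 ->
  `|primitive f x| <= int01 (fun t => `|f t|).
Proof.
move=> fi /andP[x0 x1].
have s : `[0, x] `<=` `[0, 1]%classic by apply: sub_itv; rewrite ?bnd_simp.
apply: le_trans (le_normr_Rintegral _ _) _ => //; first exact: integrable_sub fi.
by apply: le_int_sub => //; exact: integrable01_norm.
Qed.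

Lemma primitive_continuous f : integrable01 f ->
  {within `[0, 1], continuous (primitive f)}.
Proof. by move=> fi; exact: parameterized_integral_continuous. Qed.

Lemma primitive_meas f : integrable01 f -> measurable_fun I01 (primitive f).
Proof.
by move=> fi; apply: subspace_continuous_measurable_fun => //; exact: primitive_continuous.
Qed.

Lemma integrable01_primitive f : integrable01 f -> integrable01 (primitive f).
Proof.
move=> fi; apply: integrable01_bounded (primitive_meas fi) _ => x x01.
exact: primitive_bound.
Qed.

Lemma sqr_integrable01 f : square_integrable01 f -> integrable01 f.
Proof.
move=> [mf fi]; apply: (integrable01_le mf (g := fun x => 1 + f x ^+ 2)).
  by move=> x _; rewrite -[f x ^+ 2]real_normK ?num_real//; nra.
by apply: integrable01D => //; exact: integrable01_cst.
Qed.

Lemma integrable01_mul f g : square_integrable01 f -> square_integrable01 g ->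
  integrable01 (fun x => f x * g x).
Proof.
move=> [mf fi] [mg gi]; apply: (integrable01_le (g := fun x => f x ^+ 2 + g x ^+ 2)).
- exact: measurable_funM.
- by move=> x _; rewrite ler_norml; nra.
- exact: integrable01D.
Qed.

Lemma sqr_integrable_lin c f g : square_integrable01 f -> square_integrable01 g ->
  square_integrable01 (fun x => c * f x + g x).
Proof.
move=> fs gs; have [mf fi] := fs; have [mg gi] := gs; split.
  by apply: measurable_funD => //; apply: measurable_funM.
apply: (@eq_integrable01 (fun x => c ^+ 2 * f x ^+ 2 + ((2 * c) * (f x * g x) + g x ^+ 2))).
  by move=> x _; ring.
apply: integrable01D; first exact: integrable01Z.
by apply: integrable01D => //; apply: integrable01Z; exact: integrable01_mul.
Qed.

Lemma sqr_integrable_bounded h c : measurable_fun I01 h ->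
  (forall x, 0 <= x <= 1 -> `|h x| <= c) -> square_integrable01 h.
Proof.
move=> mh hc; split=> //; apply: (@integrable01_bounded _ (c ^+ 2)).
  by apply: measurable_funX.
by move=> x x01; rewrite normrX lerXn2r ?nnegrE ?hc// (le_trans _ (hc _ x01)).
Qed.

(** Cauchy-Schwarz on [[x, y]], from the nonnegativity of the variance of [f]. *)
Lemma primitive_hoelder f x y : square_integrable01 f -> 0 <= x -> x <= y -> y <= 1 ->
  (primitive f y - primitive f x) ^+ 2 <= (y - x) * int01 (fun t => f t ^+ 2).
Proof.
move=> fs x0 xy y1; have [mf f2] := fs; have fi := sqr_integrable01 fs.
rewrite primitiveB//.
have [<-|yx] := eqVneq x y.
  by rewrite subrr mul0r set_itv_ge ?bnd_simp ?ltxx// Rintegral_set0 expr0n.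
have xy' : 0 < y - x by rewrite subr_gt0 lt_neqAle yx.
set J := `]x, y]%classic.
have mJ : measurable (J : set (measurableTypeR R)) by exact: measurable_itv.
have s : J `<=` `[0, 1]%classic by apply: sub_itv; rewrite ?bnd_simp.
set S := \int[mu]_(t in J) f t.
have muJ : mu J = (y - x)%:E.
  by rewrite lebesgue_measure_itv/= lte_fin -subr_gt0 xy' -EFinB.
(* [c] is the mean of [f] on the interval *)
pose c := S / (y - x).
have gi : integrable01 (fun t => (f t - c) ^+ 2).
  have cs : square_integrable01 (fun=> - c).
    exact: (@sqr_integrable_bounded _ `|- c|).
  by apply: eq_integrable01 (sqr_integrable_lin 1 fs cs).2 => t _; rewrite mul1r.
have : 0 <= \int[mu]_(t in J) ((f t - c) ^+ 2) by apply: Rintegral_ge0 => t _; exact: sqr_ge0.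
rewrite (@eq_Rintegral _ _ _ mu J (fun t => f t ^+ 2 + ((- 2 * c) * f t + c ^+ 2))); last first.
  by move=> t _; ring.
have ci : mu.-integrable J (EFin \o (fun=> c ^+ 2)).
  by apply: integrable_sub (integrable01_cst _).
rewrite RintegralD//; [|exact: integrable_sub f2|]; last first.
  apply: (integrable_sub mJ s (f := (fun t => (- 2 * c) * f t + c ^+ 2))).
  by apply: integrable01D; [exact: integrable01Z|exact: integrable01_cst].
rewrite RintegralD//; [|exact: (integrable_sub mJ s (integrable01Z _ fi))].
rewrite RintegralZl//; [|exact: integrable_sub fi].
rewrite Rintegral_cst// [X in fine X]muJ/= -/S => h.
have cE : c * (y - x) = S by rewrite /c divfK// gt_eqF.
have : \int[mu]_(t in J) f t ^+ 2 <= int01 (fun t => f t ^+ 2).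
  by apply: le_int_sub => // t _; exact: sqr_ge0.
move: (int01 _) (\int[mu]_(t in J) f t ^+ 2) h => P Q h QP.
have h2 : 0 <= Q - c ^+ 2 * (y - x) by nra.
have -> : S ^+ 2 = (y - x) * (c ^+ 2 * (y - x)) by rewrite -cE; ring.
by rewrite ler_pM2l//; lra.
Qed.

End UnitInterval.

(** * Integration by parts for absolutely continuous functions *)

Section ByParts.
Context {R : realType}.
Implicit Types (f g : R -> R).
Local Notation mu := (@lebesgue_measure R).
Local Notation I01 := (`[(0 : R), (1 : R)]%classic).

Let mI : measurable (I01 : set (measurableTypeR R)).
Proof. exact: measurable_itv. Qed.

Section kernel.
Variables f g : R -> R.
Hypotheses (fi : integrable01 f) (gi : integrable01 g).

Let f' := f \_ I01.
Let g' := g \_ I01.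

Let mf' : measurable_fun [set: R] f'.
Proof. by apply/(measurable_restrictT _ mI); exact: (integrable01_meas fi). Qed.

Let mg' : measurable_fun [set: R] g'.
Proof. by apply/(measurable_restrictT _ mI); exact: (integrable01_meas gi). Qed.

Let A : set (measurableTypeR R * measurableTypeR R) := [set z | z.1 <= z.2].

Let mA : measurable A.
Proof.
by rewrite -[A]setTI; exact: (measurable_fun_le measurableT measurable_fst measurable_snd).
Qed.

(* [f t * g x] on the triangle [t <= x]; Fubini compares its two iterated integrals *)
Let F (z : R * R) : R := f' z.1 * g' z.2 * \1_A z.

Let mF : measurable_fun [set: R * R] F.
Proof.
apply: measurable_funM; last exact: measurable_indic.
apply: measurable_funM; first exact: (measurableT_comp mf' measurable_fst).
exact: (measurableT_comp mg' measurable_snd).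
Qed.

Let fi' : mu.-integrable setT (EFin \o f').
Proof. by rewrite /f' -restrict_EFin; apply/(integrable_mkcond _ mI). Qed.

Let gi' : mu.-integrable setT (EFin \o g').
Proof. by rewrite /g' -restrict_EFin; apply/(integrable_mkcond _ mI). Qed.

Let Fi : (mu \x mu)%E.-integrable setT (EFin \o F).
Proof.
apply/(integrable12ltyP); first exact/measurable_EFinP.
have gfin : (\int[mu]_y `|g' y|%:E)%E \is a fin_num.
  by apply: integrable_fin_num => //; exact: (integrable_abse gi').
pose c := fine (\int[mu]_y `|g' y|%:E)%E.
have cE : (\int[mu]_y `|g' y|%:E)%E = c%:E by rewrite fineK.
have c0 : 0 <= c by rewrite fine_ge0// integral_ge0.
have mnf : measurable_fun [set: R] (fun x => `|f' x|%:E).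
  by apply/measurable_EFinP; exact: measurableT_comp.
have mng : measurable_fun [set: R] (fun x => `|g' x|%:E).
  by apply/measurable_EFinP; exact: measurableT_comp.
apply: (@le_lt_trans _ _ (\int[mu]_x (c%:E * `|f' x|%:E))%E); last first.
  rewrite integralZl//; last exact: (integrable_abse fi').
  by apply: lte_mul_pinfty => //; case/integrableP : fi'.
apply: ge0_le_integral => //.
- by move=> x _; exact: integral_ge0.
- apply: (@measurable_fun_fubini_tonelli_F _ _ _ _ _ mu (abse \o (EFin \o F))) => //.
    by apply: measurableT_comp => //; exact/measurable_EFinP.
  by move=> z; exact: abse_ge0.
- exact: measurable_funeM.
- move=> x _; rewrite -cE muleC -integralZl//; last exact: (integrable_abse gi').
  apply: ge0_le_integral => //.
  + apply: measurableT_comp => //; apply/measurable_EFinP.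
    exact: (measurableT_comp mF (pair1_measurable x)).
  + exact: measurable_funeM.
  + move=> y _; rewrite /= lee_fin !normrM ler_piMr ?mulr_ge0//.
    by rewrite indicE; case: (_ \in _); rewrite ?normr1 ?normr0.
Qed.

Let F1 x : (\int[mu]_t (F (t, x))%:E)%E =
  ((EFin \o (fun x => g x * primitive f x)) \_ I01) x.
Proof.
rewrite patchE; case: ifPn => [|] xI.
  move: xI; rewrite inE/= in_itv/= => /andP[x0 x1].
  have s : `[0, x] `<=` I01 by apply: subset_itv; rewrite ?bnd_simp.
  rewrite /primitive /= EFinM /Rintegral fineK; last first.
    by apply: integrable_fin_num => //; apply: integrable_sub fi => //; exact: measurable_itv.
  rewrite -integralZl//; last by apply: integrable_sub fi => //; exact: measurable_itv.
  rewrite [RHS]integral_mkcond; apply: eq_integral => t _.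
  rewrite patchE /F /f' /g' !patchE/= indicE.
  rewrite [x \in _]mem_set ?mem01 ?x0//.
  have [tx|xt] := boolP (t \in `[0, x]%classic).
    have /set_mem/= := tx; rewrite in_itv/= => /andP[t0 t1].
    rewrite mem_set; last exact/s/set_mem.
    by rewrite mem_set// mulr1 mulrC EFinM.
  case: ifPn => [|_]; last by rewrite !mul0r.
  rewrite inE/= in_itv/= => /andP[t0 t1].
  rewrite memNset ?mulr0//= => tx; move/negP : xt; apply.
  by rewrite inE/= in_itv/= t0.
apply: integral0_eq => t _; rewrite /F /g' /= patchE (negbTE xI).
by rewrite mulr0 mul0r.
Qed.

Let F2 t : (\int[mu]_x (F (t, x))%:E)%E =
  ((EFin \o (fun t => f t * (primitive g 1 - primitive g t))) \_ I01) t.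
Proof.
rewrite patchE; case: ifPn => [|] tI.
  move: tI; rewrite inE/= in_itv/= => /andP[t0 t1].
  have s : `]t, 1] `<=` I01 by apply: subset_itv; rewrite ?bnd_simp.
  have s' : `[t, 1] `<=` I01 by apply: subset_itv; rewrite ?bnd_simp.
  rewrite /= primitiveB// Rintegral_itv_obnd_cbnd; last first.
    by apply: integrable_sub gi => //; exact: measurable_itv.
  rewrite /= EFinM /Rintegral fineK; last first.
    by apply: integrable_fin_num => //; apply: integrable_sub gi => //; exact: measurable_itv.
  rewrite -integralZl//; last by apply: integrable_sub gi => //; exact: measurable_itv.
  rewrite [RHS]integral_mkcond; apply: eq_integral => x _.
  rewrite patchE /F /f' /g' !patchE/= indicE.
  rewrite [t \in _]mem_set ?mem01 ?t0//.
  have [tx|xt] := boolP (x \in `[t, 1]%classic).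
    have /set_mem/= := tx; rewrite in_itv/= => /andP[x0 x1].
    rewrite mem_set; last exact/s'/set_mem.
    by rewrite mem_set// mulr1 EFinM.
  case: ifPn => [|_]; last by rewrite mulr0 mul0r.
  rewrite inE/= in_itv/= => /andP[x0 x1].
  rewrite memNset ?mulr0//= => tx; move/negP : xt; apply.
  by rewrite inE/= in_itv/= tx.
apply: integral0_eq => x _; rewrite /F /f' /= patchE (negbTE tI).
by rewrite !mul0r.
Qed.

(** Fubini on the triangle [t <= x] of the unit square: integrating in [t] first
    gives the primitive of [f], integrating in [x] first gives
    [primitive g 1 - primitive g t]. *)
Lemma int01_by_parts :
  int01 (fun x => primitive f x * g x) =
  primitive f 1 * primitive g 1 - int01 (fun x => f x * primitive g x).
Proof.
have := Fubini Fi.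
under eq_integral do rewrite F2.
under [RHS]eq_integral do rewrite F1.
rewrite -!integral_mkcond => /(congr1 fine).
rewrite -/(Rintegral _ _ _) -/(Rintegral _ _ _) => FF.
rewrite (@eq_int01 _ _ (fun x => g x * primitive f x)); last first.
  by move=> x _; rewrite mulrC.
rewrite -[LHS]FF -/(int01 _).
rewrite (@eq_int01 _ _ (fun x => primitive g 1 * f x - f x * primitive g x)); last first.
  by move=> x _; rewrite mulrBr [f x * primitive g 1]mulrC.
rewrite int01B; last 2 first.
- exact: integrable01Z.
- apply: integrable01M (primitive_meas gi) _ => // x x01.
  exact: primitive_bound.
by rewrite int01Z// mulrC.
Qed.

End kernel.
End ByParts.

(** * Convergence in mean, almost everywhere, and uniformly *)

Lemma cvg_EFin_seq {R : realType} (u : nat -> R) (l : R) :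
  u @ \oo --> l -> (fun n => (u n)%:E) @ \oo --> l%:E.
Proof. by move=> ul; apply: (cvg_comp _ _ ul). Qed.

Section CauchyInMean.
Context d (T : measurableType d) (R : realType).
Variables (mu : {measure set T -> \bar R}) (D : set T) (mD : measurable D).

Lemma fatou_ae (F : nat -> T -> R) (G : T -> R) (c : nat -> R) (l : R) :
  (forall n, measurable_fun D (F n)) -> measurable_fun D G ->
  (forall n x, D x -> 0 <= F n x) -> (forall x, D x -> 0 <= G x) ->
  {ae mu, forall x, D x -> F n x @[n --> \oo] --> G x} ->
  (forall n, (\int[mu]_(x in D) (F n x)%:E <= (c n)%:E)%E) ->
  c @ \oo --> l ->
  (\int[mu]_(x in D) (G x)%:E <= l%:E)%E.
Proof.
move=> mF mG F0 G0 FG Fc cl.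
have mF' n : measurable_fun D (EFin \o F n) by exact/measurable_EFinP.
have mL : measurable_fun D (fun x => limn_einf (fun n => (F n x)%:E)).
  rewrite /limn_einf; apply: measurableT_comp => //.
  by apply: measurable_fun_limn_esup => n; apply: measurableT_comp => //; exact: mF'.
rewrite (@ge0_ae_eq_integral _ _ _ mu D _ (fun x => limn_einf (fun n => (F n x)%:E)))//; last 3 first.
- exact/measurable_EFinP.
- move=> x Dx; rewrite limn_einf_lim; apply: lime_ge.
    apply/cvg_ex; eexists; apply/ereal_nondecreasing_cvgn => a b ab.
    apply: ereal_inf_le_tmp => // _ [n /= bn <-].
    by exists n => //=; rewrite (leq_trans ab).
  apply: nearW => n; apply: le_ereal_inf_tmp => _ [m /= nm <-].
  by rewrite lee_fin F0.
- apply: filterS FG => x /[apply] Fx.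
  by have [-> _] := cvg_limn_einf_sup (cvg_EFin_seq Fx).
apply: le_trans (fatou _ mD _ _) _ => //.
have [<- _] := cvg_limn_einf_sup (cvg_EFin_seq cl).
rewrite !limn_einf_lim; apply: lee_lim.
- apply/cvg_ex; eexists; apply/ereal_nondecreasing_cvgn => a b ab.
  apply: ereal_inf_le_tmp => // _ [n /= bn <-].
  by exists n => //=; rewrite (leq_trans ab).
- apply/cvg_ex; eexists; apply/ereal_nondecreasing_cvgn => a b ab.
  apply: ereal_inf_le_tmp => // _ [n /= bn <-].
  by exists n => //=; rewrite (leq_trans ab).
- apply: nearW => n; apply: le_ereal_inf_tmp => _ [m /= nm <-].
  by apply: le_trans (Fc m); apply: ereal_inf_lbound; exists m.
Qed.

(** The Riesz-Fischer argument: along a subsequence whose increments have integrals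
    at most [2 ^- n.+1], the sum of the increments is integrable, hence finite
    almost everywhere, and the telescoping series converges there. *)
Lemma cauchy_ae_cvg (f : nat -> T -> R) :
  (forall n, measurable_fun D (f n)) ->
  (forall e : R, 0 < e -> exists N, forall j k, (N <= j)%N -> (N <= k)%N ->
    (\int[mu]_(x in D) `|f j x - f k x|%:E <= e%:E)%E) ->
  exists (g : T -> R) (kappa : nat -> nat), [/\ measurable_fun D g,
    forall n, (n <= kappa n)%N &
    {ae mu, forall x, D x -> f (kappa n) x @[n --> \oo] --> g x}].
Proof.
move=> mf cf.
have eps0 i : 0 < 1 / (2 ^ i.+1)%:R :> R by rewrite divr_gt0// ltr0n expn_gt0.
have [N hN] := choice (fun i => cf _ (eps0 i)).
(* partial sums of [N], so that [N n <= kappa m] whenever [n <= m] *)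
pose kappa n := (n + \sum_(i < n.+1) N i)%N.
have kN n m : (n <= m)%N -> (N n <= kappa m)%N.
  move=> nm; apply: leq_trans (leq_addl _ _).
  by rewrite (bigD1 (Ordinal (nm : n < m.+1)%N))//= leq_addr.
pose Dl n x := `|f (kappa n.+1) x - f (kappa n) x|.
have Dl0 n x : (0 <= (Dl n x)%:E)%E by rewrite lee_fin /Dl.
have mDl n : measurable_fun D (fun x => (Dl n x)%:E).
  apply/measurable_EFinP; apply: measurableT_comp => //.
  by apply: measurable_funB; exact: mf.
pose S x := (\sum_(n <oo) (Dl n x)%:E)%E.
have S0 x : (0 <= S x)%E by apply: nneseries_ge0.
have Si : mu.-integrable D S.
  apply/integrableP; split.
    by apply: ge0_emeasurable_sum.
  under eq_integral do rewrite gee0_abs//.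
  rewrite integral_nneseries//.
  apply: (@le_lt_trans _ _ 1%:E); last exact: ltry.
  apply: le_trans (epsilon_trick0 xpredT ler01).
  apply: lee_nneseries => [i _ _|i _].
    by apply: integral_ge0.
  by apply: hN; apply: kN.
pose g x := fine (limn_esup (fun n => (f (kappa n) x)%:E)).
exists g, kappa; split.
- apply: measurableT_comp => //; apply: measurable_fun_limn_esup => n.
  by apply/measurable_EFinP; exact: mf.
- by move=> n; exact: leq_addr.
- have := integrable_ae mD Si; apply: filterS => x /[apply] Sx.
  suff : cvgn (fun n => f (kappa n) x).
    move=> /cvg_ex[l fl]; rewrite /g.
    by have [_ ->] := cvg_limn_einf_sup (cvg_EFin_seq fl).
  pose u n := f (kappa n) x.
  have : cvgn (series (telescope u)).
    apply: normed_cvg; apply: nondecreasing_is_cvgn.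
      apply/nondecreasing_seqP => n; rewrite /normed_series_of !seriesEnat/= big_nat_recr//=.
      by rewrite lerDl.
    exists (fine (S x)) => _ [n _ <-].
    rewrite -lee_fin fineK// /normed_series_of seriesEnat/= -sumEFin.
    by apply: nneseries_lim_ge => k _ _.
  move=> /cvg_ex[l ul]; apply/cvg_ex; exists (l + u 0%N).
  have -> : (fun n => f (kappa n) x) = (fun n => series (telescope u) n + u 0%N).
    by apply/funext => n; rewrite telescopeK subrK.
  by apply: cvgD => //; exact: cvg_cst.
Qed.

End CauchyInMean.

Section ArzelaAscoli.
Context {R : realType}.

(** By Tychonoff's theorem the sequence has a cluster point for pointwise
    convergence, that is, on finite sets of points. *)
Lemma bounded_cluster (u : nat -> R -> R) (M : R) :
  (forall n x, 0 <= x <= 1 -> `|u n x| <= M) ->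
  exists f : R -> R, forall (s : seq R) (e : R) (N : nat), 0 < e ->
    all (fun x => 0 <= x <= 1) s ->
    exists2 m, (N <= m)%N & forall x, x \in s -> `|u m x - f x| < e.
Proof.
move=> uM.
(* values outside the interval are unconstrained, so they are set to 0 *)
pose v n x := if 0 <= x <= 1 then u n x else 0.
have vM n x : `|v n x| <= `|M|.
  rewrite /v; case: ifPn => [/uM/le_trans|_]; last by rewrite normr0.
  by apply; exact: ler_norm.
pose K (x : R) : set R := `[- `|M|, `|M|]%classic.
have cK : compact [set f : prod_topology (fun=> R : topologicalType) |
    forall x, K x (f x)].
  by apply: tychonoff => x; exact: segment_compact.
pose F : set_system (prod_topology (fun _ : R => R : topologicalType)) := v @ \oo.
have FF : ProperFilter F by exact: fmap_proper_filter.
have [f [_ fcl]] : [set f : prod_topology (fun=> R : topologicalType) |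
    forall x, K x (f x)] `&` cluster F !=set0.
  apply: cK; exists 0%N => // n _ x; rewrite /K/= in_itv/=.
  by have := vM n x; rewrite ler_norml.
exists f => s e N e0 s01.
pose B := [set h : prod_topology (fun _ : R => R : topologicalType) |
  forall x, x \in s -> `|h x - f x| < e].
have nB : nbhs (f : prod_topology (fun _ : R => R : topologicalType)) B.
  rewrite /B; elim: s {s01 B} => [|y s ih].
    by apply: (@filterE _ (nbhs (f : prod_topology (fun _ : R => R : topologicalType)))) => h x; rewrite in_nil.
  have := @proj_continuous R (fun=> R : topologicalType) y f.
  move=> /(_ (ball (f y) e)) /(_ (nbhsx_ballx _ _ e0)) ny.
  apply: (@filterS _ (nbhs (f : prod_topology (fun _ : R => R : topologicalType))) _ _ _ _ (filterI ih ny)) => h [hs hy] x.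
  rewrite in_cons => /predU1P[->|/hs//].
  by rewrite distrC; exact: hy.
have FA : F [set h | exists2 m, (N <= m)%N & h = v m].
  by exists N => // m /= Nm; exists m.
have [h [[m Nm ->] hB]] := fcl _ _ FA nB.
exists m => // x xs; have := hB x xs; rewrite /v.
by have /allP/(_ _ xs) -> := s01.
Qed.

(** The cluster point inherits the modulus [w]; closeness on a grid finer than [d]
    therefore spreads to the whole interval, at the price of two oscillations. *)
Lemma arzela_ascoli (u : nat -> R -> R) (M : R) (w : R -> R) :
  (forall n x, 0 <= x <= 1 -> `|u n x| <= M) ->
  (forall n x y, 0 <= x <= 1 -> 0 <= y <= 1 -> `|u n x - u n y| <= w `|x - y|) ->
  (forall e, 0 < e -> exists2 d, 0 < d & forall t, 0 <= t <= d -> w t <= e) ->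
  exists (f : R -> R) (kappa : nat -> nat), [/\ forall n, (n <= kappa n)%N,
    forall n x, 0 <= x <= 1 -> `|u (kappa n) x - f x| <= harmonic n &
    forall x y, 0 <= x <= 1 -> 0 <= y <= 1 -> `|f x - f y| <= w `|x - y|].
Proof.
move=> uM uw w0; have [f fu] := bounded_cluster uM.
have fw x y : 0 <= x <= 1 -> 0 <= y <= 1 -> `|f x - f y| <= w `|x - y|.
  move=> x01 y01; apply/ler_addgt0Pr => e e0.
  have e20 : 0 < e / 2 by rewrite divr_gt0.
  have [|m _ hm] := fu [:: x; y] _ 0%N e20; first by rewrite /= x01 y01.
  have := uw m x y x01 y01.
  have := hm x; rewrite mem_head => /(_ isT).
  have := hm y; rewrite in_cons mem_head orbT => /(_ isT).
  rewrite !ltr_norml !ler_norml => /andP[? ?] /andP[? ?] /andP[? ?].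
  by apply/andP; split; lra.
suff H n : exists k, (n <= k)%N /\ forall x, 0 <= x <= 1 -> `|u k x - f x| <= harmonic n.
  have [kappa hk] := choice H.
  by exists f, kappa; split=> // n; case: (hk n).
have h3 : 0 < harmonic n / 3 :> R by rewrite divr_gt0// harmonic_gt0.
have [d d0 wd] := w0 _ h3.
pose k := (Num.truncn d^-1).+1.
have k0 : 0 < k%:R :> R by rewrite ltr0n.
have kd : k%:R^-1 <= d :> R.
  by rewrite -[d]invrK lef_pV2 ?posrE ?invr_gt0// ltW// truncnS_gt.
pose s : seq R := [seq i%:R / k%:R | i <- iota 0 k.+1].
have s01 : all (fun x : R => 0 <= x <= 1) s.
  apply/allP => x /mapP[i]; rewrite mem_iota add0n ltnS => /andP[_ ik] ->.
  by rewrite divr_ge0//= ler_pdivrMr// mul1r ler_nat.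
have [m nm hm] := fu s _ n h3 s01.
exists m; split=> // x /[dup] x01 /andP[x0 x1].
have kx : 0 <= k%:R * x by rewrite mulr_ge0.
pose i := Num.truncn (k%:R * x).
have /andP[ix xi] : i%:R <= k%:R * x < i.+1%:R by exact: truncn_itv.
pose y : R := i%:R / k%:R.
have ys : y \in s.
  apply/mapP; exists i => //; rewrite mem_iota add0n ltnS leq0n/=.
  rewrite -(ler_nat R) (le_trans ix)// -[leRHS]mulr1 ler_wpM2l// ltW//.
have y01 : 0 <= y <= 1 by exact: (allP s01).
have yx : 0 <= `|x - y| <= d.
  rewrite normr_ge0/=; apply: le_trans kd.
  have -> : x - y = (k%:R * x - i%:R) / k%:R by rewrite /y mulrBl mulrAC mulfV ?mul1r// gt_eqF.
  rewrite normrM normfV (ger0_norm (ltW k0)) ger0_norm ?subr_ge0//.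
  by rewrite ler_pdivrMr// mulVf ?gt_eqF// lerBlDl -natr1 in xi *; exact: ltW.
have := uw m x y x01 y01; have := fw x y x01 y01; have := hm y ys.
have := wd _ yx; move: (harmonic n) (w _) => e wt.
rewrite !ltr_norml !ler_norml => ? /andP[? ?] /andP[? ?] /andP[? ?].
by apply/andP; split; lra.
Qed.

End ArzelaAscoli.

(** * The energy space H^1_0 of the unit interval *)

Section H10.
Context {R : realType}.
Local Notation mu := (@lebesgue_measure R).
Local Notation I01 := (`[(0 : R), (1 : R)]%classic).
Local Notation E := (R -> R^o).
Implicit Types (f g h : E) (q : R -> R).

(** A function of H^1_0(0, 1) is represented by its derivative [g]: it is
    [primitive g], which vanishes at 0, and also at 1 when [g] has mean 0.  The
    completeness of H^1_0 thus is that of L^2. *)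
Definition H10 : set E := [set g | square_integrable01 g /\ int01 g = 0].
Definition inner01 g h := int01 (fun x => primitive g x * primitive h x).
Definition energy01 g h := int01 (fun x => g x * h x).
Definition schroedinger q g h :=
  energy01 g h + int01 (fun x => q x * (primitive g x * primitive h x)).

Lemma H10_sqr g : H10 g -> square_integrable01 g. Proof. by case. Qed.

Lemma H10_int g : H10 g -> integrable01 g.
Proof. by move=> [/sqr_integrable01]. Qed.

Lemma primitive1 g : primitive g 1 = int01 g. Proof. by []. Qed.

Lemma H10_subspace : subspace H10.
Proof.
split.
  split; last by rewrite -[RHS](int01_cst 0).
  by apply: (@sqr_integrable_bounded _ _ 0) => [|x _]; [exact: measurable_cst|rewrite normr0].
move=> c u v [us u0] [vs v0]; split; first exact: sqr_integrable_lin.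
have ui := sqr_integrable01 us; have vi := sqr_integrable01 vs.
rewrite (@eq_int01 _ _ (fun x => c * u x + v x))//.
by rewrite int01D ?int01Z ?u0 ?v0 ?mulr0 ?addr0//; exact: integrable01Z.
Qed.

Lemma primitive_meas_H g : H10 g -> measurable_fun I01 (primitive g).
Proof. by move=> /H10_int; exact: primitive_meas. Qed.

Lemma energy01E g : energy01 g g = int01 (fun x => g x ^+ 2).
Proof. by apply: eq_int01 => x _; rewrite expr2. Qed.

Lemma energy01_ge0 g : 0 <= energy01 g g.
Proof. by rewrite energy01E; apply: int01_ge0 => x _; exact: sqr_ge0. Qed.

Lemma primitive_sqr_le g x : square_integrable01 g -> 0 <= x <= 1 ->
  primitive g x ^+ 2 <= energy01 g g.
Proof.
move=> gs /andP[x0 x1]; have := primitive_hoelder gs (lexx 0) x0 x1.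
rewrite primitive0 !subr0 -energy01E => /le_trans; apply.
by rewrite ler_piMl// energy01_ge0.
Qed.

Lemma primitive_prod_bound g h x : square_integrable01 g -> square_integrable01 h ->
  0 <= x <= 1 -> `|primitive g x * primitive h x| <= energy01 g g + energy01 h h.
Proof.
move=> gs hs x01; have := primitive_sqr_le gs x01; have := primitive_sqr_le hs x01.
move: (primitive g x) (primitive h x) => a b; rewrite ler_norml => ? ?.
by apply/andP; split; nra.
Qed.

Lemma primitive_prod_meas g h : H10 g -> H10 h ->
  measurable_fun I01 (fun x => primitive g x * primitive h x).
Proof. by move=> Hg Hh; apply: measurable_funM; exact: primitive_meas_H. Qed.

Lemma integrable01_pot q g h : integrable01 q -> H10 g -> H10 h ->
  integrable01 (fun x => q x * (primitive g x * primitive h x)).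
Proof.
move=> qi Hg Hh; apply: (integrable01M qi (primitive_prod_meas Hg Hh)) => x.
by apply: primitive_prod_bound; exact: H10_sqr.
Qed.

Lemma integrable01_inner g h : H10 g -> H10 h ->
  integrable01 (fun x => primitive g x * primitive h x).
Proof.
move=> Hg Hh; apply: (integrable01_bounded (primitive_prod_meas Hg Hh)) => x.
by apply: primitive_prod_bound; exact: H10_sqr.
Qed.

Lemma potential_symform q : integrable01 q ->
  symform H10 (fun g h => int01 (fun x => q x * (primitive g x * primitive h x))).
Proof.
move=> qi; split=> [u v _ _|c u v w Hu Hv Hw].
  by apply: eq_int01 => x _; rewrite [primitive u x * _]mulrC.
rewrite (@eq_int01 _ _ (fun x => c * (q x * (primitive u x * primitive w x)) +
    q x * (primitive v x * primitive w x))); last first.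
  move=> x x01; rewrite (_ : primitive (c *: u + v) x = c * primitive u x + primitive v x).
    by ring.
  by apply: primitive_lin => //; exact: H10_int.
by rewrite int01D ?int01Z//; [|apply: integrable01Z|]; exact: integrable01_pot.
Qed.

Lemma inner01_symform : symform H10 inner01.
Proof.
have [C L] := potential_symform (integrable01_cst 1).
have e g h : inner01 g h = int01 (fun x => 1 * (primitive g x * primitive h x)).
  by apply: eq_int01 => x _; rewrite mul1r.
by split=> [u v|c u v w]; rewrite !e; [exact: C|exact: L].
Qed.

Lemma energy01_symform : symform H10 energy01.
Proof.
split=> [u v _ _|c u v w Hu Hv Hw].
  by apply: eq_int01 => x _; rewrite mulrC.
rewrite /energy01 (@eq_int01 _ _ (fun x => c * (u x * w x) + v x * w x)); last first.
  by move=> x _; rewrite mulrA -mulrDl.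
have uw := integrable01_mul (H10_sqr Hu) (H10_sqr Hw).
have vw := integrable01_mul (H10_sqr Hv) (H10_sqr Hw).
by rewrite int01D ?int01Z//; exact: integrable01Z.
Qed.

Lemma schroedinger_symform q : integrable01 q -> symform H10 (schroedinger q).
Proof.
move=> qi; have [C1 L1] := potential_symform qi; have [C2 L2] := energy01_symform.
split=> [u v Hu Hv|c u v w Hu Hv Hw]; rewrite /schroedinger.
  by rewrite C1// C2.
by rewrite L1// L2//; ring.
Qed.

Lemma inner01_ge0 g : 0 <= inner01 g g.
Proof. by apply: int01_ge0 => x _; rewrite -expr2 sqr_ge0. Qed.

Lemma inner01_le_energy g : H10 g -> inner01 g g <= energy01 g g.
Proof.
move=> Hg; rewrite -[leRHS]int01_cst; apply: int01_le.
- exact: integrable01_inner.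
- exact: integrable01_cst.
- by move=> x x01; rewrite -expr2; apply: primitive_sqr_le => //; exact: H10_sqr.
Qed.

(** Interpolation between the L^2 norm and the energy.  On an interval of length [d]
    around [x], [primitive g] differs from its value at [x] by at most
    [sqrt (d * energy01 g g)]; average over that interval. *)
Lemma primitive_interpolation g d x : H10 g -> 0 < d <= 1 -> 0 <= x <= 1 ->
  d * primitive g x ^+ 2 <= 2 * inner01 g g + 2 * d ^+ 2 * energy01 g g.
Proof.
move=> Hg /andP[d0 d1] /andP[x0 x1]; have gs := H10_sqr Hg.
(* the interval [y, y + d] contains [x] and stays inside the unit interval *)
pose y : R := Num.min x (1 - d).
have [y0 yx yd xyd] : [/\ 0 <= y, y <= x, y + d <= 1 & x <= y + d].
  by rewrite /y; case: (leP x (1 - d)) => ?; split; rewrite ?lexx ?subrK ?subr_ge0 ?lerDl ?lexx ?(ltW d0)//; lra.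
pose J := `[y, (y + d)]%classic.
have mJ : measurable (J : set (measurableTypeR R)) by exact: measurable_itv.
have s : J `<=` I01 by apply: subset_itv; rewrite ?bnd_simp.
have muJ : mu J = d%:E.
  by rewrite lebesgue_measure_itv/= lte_fin ltrDl d0 -EFinB addrAC subrr add0r.
have ii := integrable01_inner Hg Hg.
have J1 : \int[mu]_(t in J) (primitive g t * primitive g t) <= inner01 g g.
  by apply: le_int_sub => // t _; rewrite -expr2 sqr_ge0.
have J2 : \int[mu]_(t in J) (primitive g x ^+ 2 / 2 - d * energy01 g g) <=
    \int[mu]_(t in J) (primitive g t * primitive g t).
  apply: le_Rintegral => //.
  - by apply: (integrable_sub mJ s); exact: integrable01_cst.
  - exact: (integrable_sub mJ s).
  - move=> t; rewrite /J/= in_itv/= => /andP[yt td].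
    have t0 : 0 <= t by exact: le_trans yt.
    have t1 : t <= 1 by exact: le_trans yd.
    have : (primitive g x - primitive g t) ^+ 2 <= d * energy01 g g.
      have E0 := energy01_ge0 g.
      have [xt|/ltW tx] := leP x t.
        rewrite -[_ - _]opprB sqrrN; apply: le_trans (primitive_hoelder gs x0 xt t1) _.
        by rewrite -energy01E ler_wpM2r//; lra.
      apply: le_trans (primitive_hoelder gs t0 tx x1) _.
      by rewrite -energy01E ler_wpM2r//; lra.
    by move: (primitive g x) (primitive g t) (d * _) (sqr_ge0 (primitive g x - 2 * primitive g t)) => a b c; nra.
have := le_trans J2 J1; rewrite Rintegral_cst// [X in fine X]muJ/=; nra.
Qed.

(** Let the length [d] tend to 0 in the interpolation inequality. *)
Lemma inner01_eq0 g x : H10 g -> inner01 g g <= 0 -> 0 <= x <= 1 -> primitive g x = 0.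
Proof.
move=> Hg a0 x01; apply/eqP; rewrite -sqrf_eq0 eq_le sqr_ge0 andbT.
apply: (@le0_of_le_inv _ _ (2 * energy01 g g)) => n.
have := @primitive_interpolation g (harmonic n) x Hg _ x01.
have h0 : 0 < harmonic n :> R by exact: harmonic_gt0.
have -> : harmonic n <= 1 :> R by rewrite /harmonic invf_le1// ler1n.
rewrite h0 => /(_ isT) H; rewrite -(ler_pM2l h0); apply: (le_trans H).
by rewrite expr2 -[leRHS]add0r mulrCA !mulrA lerD// ?pmulr_rle0//; lra.
Qed.

(** The potential term is at most [N] times the squared supremum of
    [primitive g]; interpolating at the length [d] below absorbs half of the
    energy. *)
Lemma semibounded_schroedinger q N : integrable01 q -> int01 (fun x => `|q x|) <= N ->
  semibounded H10 inner01 energy01 (schroedinger q) (16 * N * (N + 1)) (1 + N).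
Proof.
move=> qi qN; have N0 : 0 <= N by apply: le_trans qN; apply: int01_ge0.
have pot_le (c : R) g : H10 g -> (forall x, 0 <= x <= 1 -> primitive g x ^+ 2 <= c) ->
    `|int01 (fun x => q x * (primitive g x * primitive g x))| <= c * N.
  move=> Hg gc; have c0 : 0 <= c.
    by apply: le_trans (gc 0 _); rewrite ?sqr_ge0// lexx ler01.
  apply: le_trans (int01_norm (integrable01_pot qi Hg Hg)) _.
  apply: (@le_trans _ _ (c * int01 (fun x => `|q x|))); last exact: ler_wpM2l.
  have qn := integrable01_norm qi.
  rewrite -int01Z//; apply: int01_le.
  - exact: integrable01_norm (integrable01_pot qi Hg Hg).
  - exact: integrable01Z.
  - move=> x x01; rewrite normrM mulrC ler_wpM2r// -expr2 normrX real_normK ?num_real//.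
    exact: gc.
split; first exact: schroedinger_symform.
- move=> g Hg; pose d := (4 * (N + 1))^-1.
  have d0 : 0 < d by rewrite invr_gt0; lra.
  have d1 : d <= 1 by rewrite invf_le1; lra.
  have dN : 4 * (N + 1) * d = 1 by rewrite mulfV//; lra.
  have : `|int01 (fun x => q x * (primitive g x * primitive g x))| <=
      (d^-1 * (2 * inner01 g g + 2 * d ^+ 2 * energy01 g g)) * N.
    apply: pot_le => // x x01; rewrite mulrC ler_pdivlMr// mulrC.
    by apply: primitive_interpolation => //; rewrite d0.
  rewrite /schroedinger; have := energy01_ge0 g; have := inner01_ge0 g.
  rewrite invrK; move: (int01 _) (inner01 g g) (energy01 g g) => P a D a0 D0.
  rewrite ler_norml => /andP[+ _].
  have -> : 4 * (N + 1) * (2 * a + 2 * d ^+ 2 * D) * N =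
      8 * N * (N + 1) * a + 2 * d * N * D * (4 * (N + 1) * d) by ring.
  rewrite dN mulr1 => PP.
  have : 4 * N * d <= 1 by nra.
  nra.
- move=> g Hg.
  have : `|int01 (fun x => q x * (primitive g x * primitive g x))| <= energy01 g g * N.
    by apply: pot_le => // x x01; apply: primitive_sqr_le => //; exact: H10_sqr.
  by rewrite /schroedinger ler_norml => /andP[_]; lra.
Qed.

Lemma primitive_modulus g x y : square_integrable01 g -> 0 <= x <= 1 -> 0 <= y <= 1 ->
  (primitive g x - primitive g y) ^+ 2 <= `|x - y| * energy01 g g.
Proof.
move=> gs /andP[x0 x1] /andP[y0 y1]; rewrite energy01E.
have [xy|/ltW yx] := leP x y.
  rewrite ler0_norm ?subr_le0// opprB -[_ - _]opprB sqrrN.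
  exact: primitive_hoelder.
by rewrite ger0_norm ?subr_ge0//; exact: primitive_hoelder.
Qed.

Lemma sqrt_modulus (L e : R) : 0 <= L -> 0 < e ->
  exists2 d, 0 < d & forall t, 0 <= t <= d -> Num.sqrt (t * L) <= e.
Proof.
move=> L0 e0; exists (e ^+ 2 / (L + 1)); first by rewrite divr_gt0 ?exprn_gt0//; lra.
move=> t /andP[t0 td]; have tL0 : 0 <= t * L by rewrite mulr_ge0.
rewrite -(@ler_pXn2r _ 2) ?nnegrE ?sqrtr_ge0 ?(ltW e0)// sqr_sqrtr//.
have L1 : 0 < L + 1 by lra.
by move: td; rewrite ler_pdivlMr//; nra.
Qed.

End H10.

Section H10Space.
Context {R : realType}.
Local Notation mu := (@lebesgue_measure R).
Local Notation I01 := (`[(0 : R), (1 : R)]%classic).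
Local Notation E := (R -> R^o).
Local Notation H10 := (@H10 R).
Implicit Types (f g h : E) (q : R -> R).

Let mI : measurable (I01 : set (measurableTypeR R)).
Proof. exact: measurable_itv. Qed.

(** Functions of bounded energy are equicontinuous, with modulus a multiple of the
    square root: Arzela and Ascoli apply. *)
Lemma H10_compact (K : R) (u : nat -> E) :
  (forall n, H10 (u n) /\ energy01 (u n) (u n) <= K) ->
  exists2 k : nat -> nat, (forall n, (n <= k n)%N) &
    forall i j, inner01 (u (k i) - u (k j)) (u (k i) - u (k j)) <=
                harmonic i + harmonic j.
Proof.
move=> hu; have K0 : 0 <= K by have [_] := hu 0%N; apply: le_trans; exact: energy01_ge0.
have us n : square_integrable01 (u n) by apply: H10_sqr; case: (hu n).
have uK n : energy01 (u n) (u n) <= K by case: (hu n).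
have [||w0|f [k [kge kf _]]] := @arzela_ascoli R (fun n => primitive (u n)) (Num.sqrt K)
    (fun t => Num.sqrt (t * K)).
- move=> n x x01; rewrite -sqrtr_sqr ler_wsqrtr//.
  exact: le_trans (primitive_sqr_le (us n) x01) (uK n).
- move=> n x y x01 y01; rewrite -sqrtr_sqr ler_wsqrtr//.
  apply: le_trans (primitive_modulus (us n) x01 y01) _.
  exact: ler_wpM2l.
- exact: sqrt_modulus.
(* doubling the index halves the uniform distances, whose sum then is at most 1
   and dominates its square *)
exists (fun n => k n.*2.+1) => [n|i j].
  by apply: leq_trans (kge _); rewrite ltnW// ltnS -addnn leq_addr.
have hh n : harmonic n.*2.+1 = harmonic n / 2 :> R.
  by rewrite /harmonic/= (_ : n.*2.+2 = (n.+1 * 2)%N) ?natrM ?invfM// muln2.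
have Vij : H10 (u (k i.*2.+1) - u (k j.*2.+1)).
  by apply: (subspaceB H10_subspace); [case: (hu (k i.*2.+1))|case: (hu (k j.*2.+1))].
rewrite -[leRHS]int01_cst; apply: int01_le.
- exact: integrable01_inner.
- exact: integrable01_cst.
move=> x x01.
have -> : primitive (u (k i.*2.+1) - u (k j.*2.+1)) x =
    primitive (u (k i.*2.+1)) x - primitive (u (k j.*2.+1)) x.
  rewrite -[in LHS]scaleN1r addrC (primitive_lin (-1))//; last 2 first.
  - exact: sqr_integrable01.
  - exact: sqr_integrable01.
  by rewrite mulN1r addrC.
have := kf i.*2.+1 x x01; have := kf j.*2.+1 x x01; rewrite !hh.
have : harmonic i <= 1 :> R by rewrite /harmonic invf_le1// ler1n.
have : harmonic j <= 1 :> R by rewrite /harmonic invf_le1// ler1n.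
move: (@harmonic_gt0 R i) (@harmonic_gt0 R j).
move: (harmonic i) (harmonic j) (primitive _ x) (primitive _ x) (f x) => ei ej a b c.
move=> i0 j0 j1 i1; rewrite !ler_norml => /andP[? ?] /andP[? ?].
have : `|a - b| <= (ei + ej) / 2 by rewrite ler_norml; apply/andP; split; lra.
rewrite -expr2 -[(a - b) ^+ 2]real_normK ?num_real//.
by move: `|_| (normr_ge0 (a - b)) => d d0 dl; nra.
Qed.

Lemma int01_norm_le_sqr f (t : R) : square_integrable01 f -> 0 < t ->
  int01 (fun x => `|f x|) <= t + (4 * t)^-1 * int01 (fun x => f x ^+ 2).
Proof.
move=> fs t0; have [mf f2] := fs; have fi := sqr_integrable01 fs.
have ti : integrable01 (fun x => (4 * t)^-1 * f x ^+ 2) by exact: integrable01Z.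
rewrite -int01Z// -{1}(int01_cst t) -int01D//; last exact: integrable01_cst.
apply: int01_le.
- exact: integrable01_norm.
- by apply: integrable01D => //; exact: integrable01_cst.
- move=> x _; rewrite -[f x ^+ 2]real_normK ?num_real//; move: `|f x| => y.
  rewrite -subr_ge0.
  have -> : t + (4 * t)^-1 * y ^+ 2 - y = (4 * t)^-1 * (y - 2 * t) ^+ 2.
    by field; rewrite gt_eqF.
  by rewrite mulr_ge0 ?sqr_ge0// invr_ge0; lra.
Qed.

Lemma integrable01_ge0_lty f (c : R) : measurable_fun I01 f ->
  (forall x, 0 <= x <= 1 -> 0 <= f x) ->
  (\int[mu]_(x in I01) (f x)%:E <= c%:E)%E -> integrable01 f /\ int01 f <= c.
Proof.
move=> mf f0 fc.
have fi : integrable01 f.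
  apply/integrableP; split; first exact/measurable_EFinP.
  apply: le_lt_trans (ltry c); apply: le_trans fc.
  under eq_integral => x xI.
    rewrite /= ger0_norm; last by apply: f0; rewrite -mem01; exact/set_mem.
  over.
  by [].
split=> //; rewrite -lee_fin /int01 /Rintegral fineK//.
by apply: integrable_fin_num.
Qed.

Lemma EFin_int01 f : integrable01 f -> (\int[mu]_(x in I01) (f x)%:E)%E = (int01 f)%:E.
Proof. by move=> fi; rewrite /int01 /Rintegral fineK//; exact: integrable_fin_num. Qed.

(** An energy-Cauchy sequence is Cauchy in mean, so that a subsequence of the
    derivatives converges almost everywhere; Fatou's lemma turns this into
    convergence in L^2, which preserves the mean 0. *)
Lemma H10_complete (K : R) (u : nat -> E) :
  (forall n, H10 (u n)) ->
  (forall i j, energy01 (u i - u j) (u i - u j) <= K * (harmonic i + harmonic j)) ->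
  exists2 v, H10 v & forall n, energy01 (u n - v) (u n - v) <= K * harmonic n.
Proof.
move=> hu cu.
have K0 : 0 <= K.
  have := le_trans (energy01_ge0 _) (cu 0%N 0%N).
  by rewrite pmulr_lge0// addr_gt0// harmonic_gt0.
have us n : square_integrable01 (u n) by exact: H10_sqr.
have um n : measurable_fun I01 (u n) by case: (us n).
have usub i j : square_integrable01 (fun x => u i x - u j x).
  have := sqr_integrable_lin (-1) (us j) (us i).
  by under eq_fun do rewrite mulN1r addrC.
have cu' i j : int01 (fun x => (u i x - u j x) ^+ 2) <= K * (harmonic i + harmonic j).
  by have := cu i j; rewrite energy01E.
have [e e0|v [kappa [mv kge kv]]] := @cauchy_ae_cvg _ _ R mu _ mI u um.
  have e2 : 0 < e / 2 by rewrite divr_gt0.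
  pose N := Num.truncn (K / (e / 2) ^+ 2); exists N => j k Nj Nk.
  rewrite EFin_int01 ?lee_fin; last first.
    by apply: integrable01_norm; exact: sqr_integrable01.
  apply: le_trans (int01_norm_le_sqr (usub j k) e2) _.
  have hle n : (N <= n)%N -> K * harmonic n <= (e / 2) ^+ 2.
    move=> Nn; rewrite /harmonic ler_pdivrMr// mulrC -ler_pdivrMr ?exprn_gt0//.
    by apply: ltW; apply: lt_le_trans (truncnS_gt _) _; rewrite ler_nat.
  have := cu' j k; have := hle _ Nj; have := hle _ Nk; rewrite mulrDr.
  move: (int01 _) (K * _) (K * _) => P a b ha hb hP.
  have -> : 4 * (e / 2) = 2 * e by field.
  have : (2 * e)^-1 * P <= (2 * e)^-1 * (e ^+ 2 / 2).
    by rewrite ler_wpM2l ?invr_ge0; lra.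
  have -> : (2 * e)^-1 * (e ^+ 2 / 2) = e / 4 by field; rewrite gt_eqF.
  lra.
have lim n : integrable01 (fun x => (u n x - v x) ^+ 2) /\
    int01 (fun x => (u n x - v x) ^+ 2) <= K * harmonic n.
  apply: integrable01_ge0_lty.
  - by apply: measurable_funX; exact: (measurable_funB (um n) mv).
  - by move=> x _; exact: sqr_ge0.
  apply: (@fatou_ae _ _ _ mu _ mI (fun j x => (u n x - u (kappa j) x) ^+ 2) _
    (fun j => K * (harmonic n + harmonic j))).
  - by move=> j; apply: measurable_funX; exact: (measurable_funB (um n) (um (kappa j))).
  - by apply: measurable_funX; exact: (measurable_funB (um n) mv).
  - by move=> j x _; exact: sqr_ge0.
  - by move=> x _; exact: sqr_ge0.
  - apply: filterS kv => x /[apply] ux.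
    under eq_fun do rewrite expr2.
    by rewrite expr2; apply: cvgM; (apply: cvgB => //; exact: cvg_cst).
  - move=> j; rewrite EFin_int01 ?lee_fin; last by case: (usub n (kappa j)).
    apply: le_trans (cu' n (kappa j)) _; rewrite ler_wpM2l// lerD2l /harmonic.
    by rewrite lef_pV2 ?posrE// ler_nat ltnS.
  - suff : (fun j => K * (harmonic n + harmonic j)) @ \oo --> K * (harmonic n + 0).
      by rewrite addr0.
    apply: cvgM; first exact: cvg_cst.
    by apply: cvgD; [exact: cvg_cst|exact: cvg_harmonic].
have vs : square_integrable01 v.
  have wi : square_integrable01 (fun x => u 0%N x - v x).
    by split; [exact: (measurable_funB (um 0%N) mv)|case: (lim 0%N)].
  have := sqr_integrable_lin (-1) wi (us 0%N).
  by under eq_fun do rewrite mulN1r opprB subrK.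
have vi := sqr_integrable01 vs.
have uvs n : square_integrable01 (fun x => u n x - v x).
  by split; [exact: (measurable_funB (um n) mv)|case: (lim n)].
exists v => [|n]; last by rewrite energy01E; case: (lim n).
split=> //; apply/eqP; rewrite -sqrf_eq0 eq_le sqr_ge0 andbT.
apply: (@le0_of_le_inv _ _ K) => n; apply: le_trans (lim n).2.
have := primitive_sqr_le (uvs n) (_ : 0 <= 1 <= 1); rewrite ler01 lexx => /(_ isT).
rewrite energy01E primitive1 int01B//; last exact: H10_int.
by rewrite (hu n).2 sub0r sqrrN.
Qed.

(** The derivative of a triangular bump on [[c, c + d + d]].  Bumps on disjoint
    intervals are orthogonal, whence the infinite dimension. *)
Definition tent c d : E := fun x => \1_(`]c, (c + d)]%classic) x - \1_(`](c + d), (c + d + d)]%classic) x.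

Lemma int01_indic (a b : R) : 0 <= a -> a <= b -> b <= 1 ->
  int01 \1_(`]a, b]%classic) = b - a.
Proof.
move=> a0 ab b1; rewrite /int01 /Rintegral integral_indic//.
rewrite setIidl; last by apply: subset_itv; rewrite ?bnd_simp.
rewrite [X in fine X](lebesgue_measure_itv `]a, b])/= lte_fin.
have [ab'|] := ltP a b; first by rewrite -EFinB.
by move=> ba; have -> : a = b by [apply/eqP; rewrite eq_le ab]; rewrite subrr.
Qed.

Lemma integrable01_indic (a b : R) : integrable01 \1_(`]a, b]%classic).
Proof.
apply: (@integrable01_bounded _ _ 1) => [|x _].
  by apply: measurable_indic; exact: measurable_itv.
by rewrite indicE; case: (_ \in _); rewrite ?normr1 ?normr0 ?ler01.
Qed.

Section tent.
Variables c d : R.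
Hypotheses (c0 : 0 <= c) (d0 : 0 < d) (cd1 : c + d + d <= 1).

Lemma tent_H10 : H10 (tent c d).
Proof.
move: (c0) (d0) (cd1) => c0' d0' cd1'.
split.
  apply: (@sqr_integrable_bounded _ _ 2) => [|x _].
    by apply: measurable_funB; apply: measurable_indic; exact: measurable_itv.
  rewrite /tent !indicE; case: (_ \in _); case: (_ \in _) => /=;
    by rewrite ler_norml; apply/andP; split; lra.
rewrite int01B; [|exact: integrable01_indic|exact: integrable01_indic].
by rewrite !int01_indic//; lra.
Qed.

Lemma tent_out x : x <= c \/ c + d + d < x -> tent c d x = 0.
Proof.
move: (c0) (d0) (cd1) => c0' d0' cd1'.
move=> xc; rewrite /tent !indicE !memNset ?subrr//= in_itv/= => /andP[]; case: xc; lra.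
Qed.

Lemma primitive_tent_out x : 0 <= x <= 1 -> x <= c \/ c + d + d <= x ->
  primitive (tent c d) x = 0.
Proof.
move: (c0) (d0) (cd1) => c0' d0' cd1'.
move=> /andP[x0 x1] [xc|cx].
  rewrite /primitive (@eq_Rintegral _ _ _ _ _ (fun=> 0)).
    by rewrite Rintegral_cst ?mul0r.
  move=> t; rewrite inE/= in_itv/= => /andP[_ tx].
  by rewrite tent_out//; left; exact: le_trans xc.
have := primitiveB (H10_int tent_H10) x0 x1 (lexx 1).
rewrite primitive1 tent_H10.2 sub0r => /eqP; rewrite eqr_oppLR => /eqP ->.
rewrite (@eq_Rintegral _ _ _ _ _ (fun=> 0)).
  by rewrite Rintegral_cst ?mul0r ?oppr0.
move=> t; rewrite inE/= in_itv/= => /andP[xt _].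
by rewrite tent_out//; right; exact: le_lt_trans xt.
Qed.

Lemma primitive_tent_top : primitive (tent c d) (c + d) = d.
Proof.
move: (c0) (d0) (cd1) => c0' d0' cd1'.
have cd : 0 <= c + d by lra.
have cd2 : c + d <= 1 by lra.
transitivity (primitive \1_(`]c, (c + d)]%classic) (c + d)).
  apply: eq_Rintegral => t; rewrite inE/= in_itv/= => /andP[t0 tcd].
  rewrite /tent [X in _ - X]indicE memNset ?subr0//= in_itv/= ltNge tcd//.
have := primitiveB (integrable01_indic c (c + d)) cd cd2 (lexx 1).
rewrite primitive1 int01_indic//; last by lra.
rewrite [X in _ = X](@eq_Rintegral _ _ _ _ _ (fun=> 0)).
  by rewrite Rintegral_cst ?mul0r//; lra.
move=> t; rewrite inE/= in_itv/= => /andP[xt _].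
by rewrite indicE memNset//= in_itv/= leNgt xt andbF.
Qed.

Lemma inner_tent_gt0 : 0 < inner01 (tent c d) (tent c d).
Proof.
move: (c0) (d0) (cd1) => c0' d0' cd1'.
rewrite ltNge; apply/negP => /(inner01_eq0 (x := c + d) tent_H10).
rewrite primitive_tent_top => d00.
have := d00 _; rewrite addr_ge0//; last exact: ltW.
have -> : c + d <= 1 by lra.
by move=> /(_ isT); lra.
Qed.

End tent.

Lemma H10_infinite : exists h : nat -> nat -> E, forall n,
  [/\ forall i, H10 (h n i), forall i, (i <= n)%N -> inner01 (h n i) (h n i) = 1
    & forall i j, i != j -> inner01 (h n i) (h n j) = 0].
Proof.
pose d n : R := harmonic n / 2.
pose c n i : R := i%:R * harmonic n.
pose t n i := tent (c n i) (d n).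
pose k n i : R := (Num.sqrt (inner01 (t n i) (t n i)))^-1.
pose h n i : E := if (i <= n)%N then k n i *: t n i else 0.
exists h => n; have h0 : 0 < harmonic n :> R by exact: harmonic_gt0.
have d0 : 0 < d n by rewrite divr_gt0.
have cd i : c n i + d n + d n = c n i.+1.
  by rewrite /c /d -[i.+1%:R]natr1 mulrDl mul1r; move: (harmonic n) => e; lra.
have c0 i : 0 <= c n i by rewrite mulr_ge0// ltW.
have c1 i : (i <= n)%N -> c n i + d n + d n <= 1.
  by move=> ni; rewrite cd /c /harmonic ler_pdivrMr// mul1r ler_nat ltnS.
have cle i j : (i <= j)%N -> c n i <= c n j.
  by move=> ij; rewrite /c ler_wpM2r ?ler_nat// ltW.
have tH i : (i <= n)%N -> H10 (t n i) by move=> ni; apply: tent_H10 => //; exact: c1.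
have aS := @inner01_symform R.
have tt i j : (i <= n)%N -> (j <= n)%N -> (i < j)%N -> inner01 (t n i) (t n j) = 0.
  move=> ni nj ij; rewrite -[RHS](int01_cst 0); apply: eq_int01 => x x01.
  have [xc|cx] := leP x (c n j).
    by rewrite [X in _ * X]primitive_tent_out ?mulr0//; [exact: c1|left].
  rewrite [X in X * _]primitive_tent_out ?mul0r//; first exact: c1.
  by right; rewrite cd (le_trans _ (ltW cx))// cle.
split=> [i|i ni|i j ij].
- rewrite /h; case: ifPn => [ni|_]; last exact: (H10_subspace).1.
  by apply: (subspaceZ H10_subspace); exact: tH.
- rewrite /h ni (form_sqrZ H10_subspace aS); last exact: tH.
  have a0 : 0 < inner01 (t n i) (t n i) by apply: inner_tent_gt0 => //; exact: c1.
  by rewrite /k exprVn sqr_sqrtr ?ltW// mulVf// gt_eqF.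
- have H0 := (@H10_subspace R).1.
  have hl0 u : H10 u -> inner01 0 u = 0 by exact: (form0l H10_subspace aS).
  rewrite /h; case: ifPn => ni; case: ifPn => nj; last exact: hl0.
  + have [Hi Hj] := (tH i ni, tH j nj).
    have a0 : inner01 (t n i) (t n j) = 0.
      have [ij'|ji|ij'] := ltngtP i j; [exact: tt| |by rewrite ij' eqxx in ij].
      by rewrite (formC aS)//; exact: tt.
    by rewrite (formZZ H10_subspace aS (k n i) (k n j) Hi Hj) a0 mulr0.
  + have Hk := subspaceZ H10_subspace (k n i) (tH i ni).
    by rewrite (formC aS Hk H0); exact: hl0.
  + by apply: hl0; apply: (subspaceZ H10_subspace); exact: tH.
Qed.

Lemma H10_energy_space : energy_space H10 (@inner01 R) (@energy01 R).
Proof.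
split.
- exact: H10_subspace.
- exact: inner01_symform.
- by move=> u _; exact: inner01_ge0.
- exact: inner01_le_energy.
- exact: H10_compact.
- exact: H10_complete.
- exact: H10_infinite.
Qed.

End H10Space.

(** * Weak and Caratheodory solutions of the eigenvalue problem *)

Section EigenvalueProblem.
Context {R : realType}.
Local Notation mu := (@lebesgue_measure R).
Local Notation I01 := (`[(0 : R), (1 : R)]%classic).
Local Notation E := (R -> R^o).
Local Notation H10 := (@H10 R).
Local Notation inner01 := (@inner01 R).
Implicit Types (q f g h : R -> R) (lam : R).

Let mI : measurable (I01 : set (measurableTypeR R)).
Proof. exact: measurable_itv. Qed.

Let aeF : Filter (almost_everywhere mu). Proof. exact: ae_filter_ringOfSetsType. Qed.

Lemma ae_mono (P Q : R -> Prop) : {ae mu, forall x, P x} ->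
  (forall x, P x -> Q x) -> {ae mu, forall x, Q x}.
Proof. by move=> aeP PQ; apply: (@filterS _ _ aeF _ _ _ aeP). Qed.

Lemma ae_mono2 (P Q S : R -> Prop) : {ae mu, forall x, P x} -> {ae mu, forall x, Q x} ->
  (forall x, P x -> Q x -> S x) -> {ae mu, forall x, S x}.
Proof.
move=> aeP aeQ PQ; apply: ae_mono (@filterI _ _ aeF _ _ aeP aeQ) _.
by move=> x []; exact: PQ.
Qed.

Lemma eq_int01_ae f g : integrable01 f -> integrable01 g ->
  {ae mu, forall x, 0 <= x <= 1 -> f x = g x} -> int01 f = int01 g.
Proof.
move=> fi gi fg; rewrite /int01 /Rintegral; congr fine; apply: ae_eq_integral => //.
- exact: measurable_int fi.
- exact: measurable_int gi.
- by apply: ae_mono fg _ => x fgx; rewrite mem01 => /fgx ->.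
Qed.

Lemma eq_primitive_ae f g x : integrable01 f -> integrable01 g ->
  {ae mu, forall x, 0 <= x <= 1 -> f x = g x} -> 0 <= x <= 1 ->
  primitive f x = primitive g x.
Proof.
move=> fi gi fg /andP[x0 x1]; rewrite /primitive /Rintegral; congr fine.
have s : `[0, x] `<=` I01 by apply: subset_itv; rewrite ?bnd_simp.
have mJ : measurable (`[0, x]%classic : set (measurableTypeR R)) by exact: measurable_itv.
apply: ae_eq_integral => //.
- exact: measurable_int (integrable_sub mJ s fi).
- exact: measurable_int (integrable_sub mJ s gi).
- apply: ae_mono fg _ => t fgt; rewrite /= in_itv/= => /andP[t0 tx].
  by rewrite fgt// t0 (le_trans tx).
Qed.

Lemma int01_eq0_ae f : integrable01 f -> (forall x, 0 <= x <= 1 -> 0 <= f x) ->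
  int01 f = 0 -> {ae mu, forall x, 0 <= x <= 1 -> f x = 0}.
Proof.
move=> fi f0 If.
have : ae_eq mu I01 (EFin \o f) (cst 0%E).
  apply/ae_eq_integral_abs => //; first exact: measurable_int fi.
  transitivity (\int[mu]_(x in I01) (f x)%:E)%E; last by rewrite EFin_int01// If.
  apply: eq_integral => x /set_mem; rewrite mem01 => /f0 fx.
  by rewrite /= ger0_norm.
by move=> /ae_mono; apply => x fx x01; have := fx; rewrite mem01 => /(_ x01) [].
Qed.

(** The lemma of du Bois-Reymond: the difference [g - P], corrected by its mean, is
    itself an admissible test function, hence has norm 0. *)
Lemma du_bois_reymond g P : square_integrable01 g -> square_integrable01 P ->
  (forall h, H10 h -> int01 (fun x => g x * h x) = int01 (fun x => P x * h x)) ->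
  {ae mu, forall x, 0 <= x <= 1 -> g x = P x + int01 (fun x => g x - P x)}.
Proof.
move=> gs Ps gP.
have ds : square_integrable01 (fun x => g x - P x).
  have := sqr_integrable_lin (-1) Ps gs.
  by under eq_fun do rewrite mulN1r addrC.
set m := int01 _.
have cs (c : R) : square_integrable01 (fun=> c).
  exact: (@sqr_integrable_bounded _ _ `|c|).
pose k := fun x => (g x - P x) - m.
have ks : square_integrable01 k.
  have := sqr_integrable_lin (-1) (cs m) ds.
  by under eq_fun do rewrite mulN1r addrC.
have di := sqr_integrable01 ds.
have kH : H10 k.
  by split=> //; rewrite int01B ?int01_cst ?subrr//; exact: integrable01_cst.
have gk := integrable01_mul gs ks; have Pk := integrable01_mul Ps ks.
have mk := integrable01_mul (cs m) ks.
have : int01 (fun x => k x ^+ 2) = 0.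
  rewrite (@eq_int01 _ _ (fun x => (g x * k x - P x * k x) - m * k x)); last first.
    by move=> x _; rewrite /k; ring.
  rewrite int01B//; last exact: integrable01B.
  by rewrite int01B// gP// subrr sub0r int01Z ?kH.2 ?mulr0 ?oppr0//; exact: sqr_integrable01.
move=> /(int01_eq0_ae ks.2 (fun x _ => sqr_ge0 _)).
move=> /ae_mono; apply => x kx x01; have /eqP := kx x01.
by rewrite sqrf_eq0 /k subr_eq0 subr_eq => /eqP ->; rewrite addrC.
Qed.

Section potential.
Variable q : R -> R.
Hypothesis qi : integrable01 q.

Let w lam g : R -> R := fun x => (q x - lam) * primitive g x.

Let wi lam g : H10 g -> integrable01 (w lam g).
Proof.
move=> Hg; apply: (@integrable01M _ _ _ (int01 (fun x => `|g x|))).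
- by apply: integrable01B => //; exact: integrable01_cst.
- exact: primitive_meas_H.
- by move=> x; apply: primitive_bound; exact: H10_int.
Qed.

(** The weak equation in terms of the primitive of [(q - lam) * u], the candidate
    for the derivative of the eigenfunction. *)
Lemma weak_formE lam g v : H10 g -> H10 v ->
  schroedinger q g v - lam * inner01 g v =
  energy01 g v + int01 (fun x => w lam g x * primitive v x).
Proof.
move=> Hg Hv; rewrite /schroedinger -addrA; congr (_ + _).
rewrite -int01Z; last exact: integrable01_inner.
rewrite -int01B; last 2 first.
- exact: integrable01_pot.
- by apply: integrable01Z; exact: integrable01_inner.
by apply: eq_int01 => x _; rewrite /w; ring.
Qed.

Lemma primitive_sqr_integrable f : integrable01 f -> square_integrable01 (primitive f).
Proof.
move=> fi; apply: (sqr_integrable_bounded (primitive_meas fi)) => x x01.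
exact: primitive_bound.
Qed.

Lemma int01_primitive_mul f v : integrable01 f -> H10 v ->
  int01 (fun x => primitive f x * v x) = - int01 (fun x => f x * primitive v x).
Proof.
move=> fi Hv; rewrite (int01_by_parts fi (H10_int Hv)).
by rewrite (primitive1 v) Hv.2 mulr0 sub0r.
Qed.

(** Regularity: a weak eigenvector has an absolutely continuous derivative. *)
Lemma weak_eigenvectorP lam g : weak_eigenvector H10 inner01 (schroedinger q) lam g ->
  exists c, {ae mu, forall x, 0 <= x <= 1 -> g x = primitive (w lam g) x + c}.
Proof.
move=> [Hg eig]; exists (int01 (fun x => g x - primitive (w lam g) x)).
have wig := wi lam Hg.
apply: du_bois_reymond => [||h Hh]; first exact: H10_sqr.
  exact: primitive_sqr_integrable.
have /eqP := eig h Hh; rewrite -subr_eq0 weak_formE// addr_eq0 => /eqP.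
by rewrite int01_primitive_mul.
Qed.

Lemma weak_eigenvector_dirichlet lam g :
  weak_eigenvector H10 inner01 (schroedinger q) lam g -> 0 < inner01 g g ->
  dirichlet_eigenfunction q lam (primitive g).
Proof.
move=> eig g0; have [Hg _] := eig; have [c gc] := weak_eigenvectorP eig.
have wig := wi lam Hg; have Pi := integrable01_primitive wig.
have Pci : integrable01 (fun x => primitive (w lam g) x + c).
  by apply: integrable01D => //; exact: integrable01_cst.
split; first 1 last.
- exact: primitive0.
- by rewrite primitive1 Hg.2.
- apply: contrapT => h; have : inner01 g g = 0.
    rewrite -(int01_cst 0); apply: eq_int01 => x x01.
    suff -> : primitive g x = 0 by rewrite mulr0.
    apply/eqP/negPn/negP => gx; apply: h; exists x => //.
  by move/eqP; rewrite gt_eqF.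
exists (fun x => primitive (w lam g) x + c), (w lam g); split.
- split=> // x; rewrite in_itv/= => x01; rewrite primitive0 add0r.
  by apply: eq_primitive_ae => //; exact: H10_int.
- by split=> // x _; rewrite primitive0 add0r addrC.
- by apply: aeW => x _; rewrite /w; ring.
Qed.

Lemma dirichlet_weak_eigenvector lam psi : dirichlet_eigenfunction q lam psi ->
  exists2 g, weak_eigenvector H10 inner01 (schroedinger q) lam g & 0 < inner01 g g.
Proof.
move=> [[g [f [[gi gE] [fi fE] eqn]]] psi0 psi1 [x0 x001 psix0]].
have pg x : 0 <= x <= 1 -> psi x = primitive g x.
  by move=> x01; rewrite gE ?psi0 ?add0r// in_itv.
have pf x : 0 <= x <= 1 -> g x = g 0 + primitive f x.
  by move=> x01; rewrite fE// in_itv.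
have gs : square_integrable01 g.
  apply: (@sqr_integrable_bounded _ _ (`|g 0| + int01 (fun x => `|f x|))).
    exact: integrable01_meas.
  move=> x x01; rewrite pf//; apply: le_trans (ler_normD _ _) _.
  by rewrite lerD2l; exact: primitive_bound.
have Hg : H10 g by split=> //; rewrite -primitive1 -pg ?psi1// ler01 lexx.
have wig := wi lam Hg.
exists g; last first.
  rewrite ltNge; apply/negP => /(inner01_eq0 (x := x0) Hg).
  have x01 : 0 <= x0 <= 1 by rewrite in_itv in x001.
  by move=> /(_ x01); rewrite -pg//; move/eqP: psix0.
split=> // v Hv; apply/eqP; rewrite -subr_eq0 weak_formE//.
have vi := H10_int Hv; have fpi := integrable01_primitive fi.
have fv : integrable01 (fun x => primitive f x * v x).
  apply: integrable01_mul; last exact: H10_sqr.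
  exact: primitive_sqr_integrable.
have pv : integrable01 (fun x => f x * primitive v x).
  apply: (integrable01M fi (primitive_meas vi)) => x x01; exact: primitive_bound.
have wv : integrable01 (fun x => w lam g x * primitive v x).
  apply: (integrable01M wig (primitive_meas vi)) => x x01; exact: primitive_bound.
have -> : energy01 g v = - int01 (fun x => f x * primitive v x).
  rewrite -int01_primitive_mul// /energy01.
  rewrite (@eq_int01 _ _ (fun x => g 0 * v x + primitive f x * v x)); last first.
    by move=> x x01; rewrite [in LHS]pf// mulrDl.
  by rewrite int01D ?int01Z ?Hv.2 ?mulr0 ?add0r//; exact: integrable01Z.
rewrite addrC subr_eq0; apply/eqP; apply: eq_int01_ae => //.
apply: ae_mono eqn _ => x eqx x01; congr (_ * _).
have := eqx; rewrite in_itv/= => /(_ x01).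
by rewrite /w pg//; move: (f x) (primitive g x) => a b; lra.
Qed.

End potential.

(** The only solution of [U'' = r U], [U 0 = U' 0 = 0] is 0.  If [U] vanishes up to
    [k / N], where [N] exceeds the L^1 norm of [r], then its supremum [S] up to
    [k.+1 / N] satisfies [S <= S * int01 |r| / N], so that [S = 0]. *)
Lemma volterra_unique (r U : R -> R) : integrable01 r ->
  (forall x, 0 <= x <= 1 -> U x = primitive (primitive (fun t => r t * U t)) x) ->
  measurable_fun I01 U -> (exists M, forall x, 0 <= x <= 1 -> `|U x| <= M) ->
  forall x, 0 <= x <= 1 -> U x = 0.
Proof.
move=> ri UE mU [M UM].
have Vi : integrable01 (fun t => r t * U t) by exact: (integrable01M ri mU UM).
set V := primitive (fun t => r t * U t) in UE.
have VVi : integrable01 V by exact: integrable01_primitive.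
pose N := (Num.truncn (int01 (fun x => `|r x|))).+1.
have rN : int01 (fun x => `|r x|) < N%:R by exact: truncnS_gt.
have N0 : 0 < N%:R :> R by rewrite ltr0n.
have r0 : 0 <= int01 (fun x => `|r x|) by apply: int01_ge0.
suff step k : (k <= N)%N -> forall x, 0 <= x <= k%:R / N%:R -> U x = 0.
  by move=> x x01; apply: (step N) => //; rewrite mulfV// gt_eqF.
elim: k => [_ x|k ih kN x].
  rewrite mul0r -eq_le => /eqP <-.
  by rewrite UE ?primitive0// lexx ler01.
have {}ih := ih (ltnW kN).
pose a : R := k%:R / N%:R; pose b : R := k.+1%:R / N%:R.
have a0 : 0 <= a by rewrite divr_ge0.
have b1 : b <= 1 by rewrite ler_pdivrMr// mul1r ler_nat.
have ab : b = a + N%:R^-1 by rewrite /b -natr1 mulrDl mul1r.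
have Ni : 0 < N%:R^-1 :> R by rewrite invr_gt0.
pose S := sup [set `|U x| | x in [set x | 0 <= x <= b]].
have hs : has_sup [set `|U x| | x in [set x | 0 <= x <= b]].
  split; first by exists `|U 0|; exists 0 => //=; rewrite lexx; lra.
  by exists M => _ [y /= /andP[y0 yb] <-]; apply: UM; rewrite y0 (le_trans yb).
have US y : 0 <= y <= b -> `|U y| <= S.
  by move=> yb; apply: (sup_upper_bound hs); exists y.
have S0 : 0 <= S.
  by apply: le_trans (US 0 _); rewrite ?normr_ge0// lexx; lra.
have VS t : 0 <= t <= b -> `|V t| <= S * int01 (fun x => `|r x|).
  move=> /andP[t0 tb]; have t1 := le_trans tb b1.
  have s : `[0, t] `<=` I01 by apply: subset_itv; rewrite ?bnd_simp.
  have mJ : measurable (`[0, t]%classic : set (measurableTypeR R)) by exact: measurable_itv.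
  apply: le_trans (le_normr_Rintegral mJ (integrable_sub mJ s Vi)) _.
  have ni := integrable01Z S (integrable01_norm ri).
  apply: (@le_trans _ _ (\int[mu]_(x in `[0, t]) (S * `|r x|))).
    apply: le_Rintegral => //.
    - exact: integrable_sub (integrable01_norm Vi).
    - exact: integrable_sub ni.
    - move=> y /=; rewrite in_itv/= => /andP[y0 yt]; rewrite normrM mulrC ler_wpM2r//.
      by apply: US; rewrite y0 (le_trans yt).
  rewrite -int01Z; last exact: integrable01_norm.
  by apply: le_int_sub => // y _; rewrite mulr_ge0.
have Ub y : 0 <= y <= b -> `|U y| <= S * int01 (fun x => `|r x|) * N%:R^-1.
  move=> /andP[y0 yb]; have y1 := le_trans yb b1.
  have [ya|/ltW ay] := leP y a.
    by rewrite ih ?y0// normr0 !mulr_ge0// ltW.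
  have a1 : a <= 1 by exact: le_trans y1.
  have -> : U y = \int[mu]_(t in `]a, y]) V t.
    by rewrite -primitiveB// -!UE ?y0 ?a0// [U a]ih ?subr0// a0 lexx.
  set J := `]a, y]%classic.
  have s : J `<=` I01 by apply: subset_itv; rewrite ?bnd_simp.
  have mJ : measurable (J : set (measurableTypeR R)) by exact: measurable_itv.
  apply: le_trans (le_normr_Rintegral mJ (integrable_sub mJ s VVi)) _.
  apply: (@le_trans _ _ (\int[mu]_(x in J) (S * int01 (fun x => `|r x|)))).
    apply: le_Rintegral => //.
    - exact: integrable_sub (integrable01_norm VVi).
    - by apply: (integrable_sub mJ s); exact: integrable01_cst.
    - move=> t; rewrite /J/= in_itv/= => /andP[t0 ty]; apply: VS.
      by rewrite (le_trans ty)// andbT (le_trans a0)// ltW.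
  rewrite Rintegral_cst// ler_wpM2l ?mulr_ge0//.
  rewrite [X in fine X](_ : _ = (y - a)%:E)/=; first by lra.
  rewrite lebesgue_measure_itv/= lte_fin -EFinB.
  by case: ltP => // ya; rewrite (_ : y = a) ?subrr//; apply/eqP; rewrite eq_le ya.
have : S <= S * int01 (fun x => `|r x|) * N%:R^-1.
  by apply: ge_sup; [case: hs|move=> _ [y yb <-]; exact: Ub].
rewrite ler_pdivlMr// => SN.
have S_le0 : S <= 0 by nra.
move=> xb; apply/eqP; rewrite -normr_le0; exact: le_trans (US x xb) S_le0.
Qed.

(** Two solutions vanishing at 0 have a nontrivial combination whose derivative
    also vanishes at 0; by uniqueness it is 0.  The constants [cu] and [cv] of the
    regularity lemma are these derivatives at 0. *)
Lemma eigenvalues_simple q lam u v : integrable01 q ->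
  weak_eigenvector H10 inner01 (schroedinger q) lam u ->
  weak_eigenvector H10 inner01 (schroedinger q) lam v ->
  exists c d : R, c ^+ 2 + d ^+ 2 != 0 /\
    inner01 ((c : R) *: (u : E) + d *: (v : E)) (c *: (u : E) + d *: (v : E)) = 0.
Proof.
move=> qi eu ev; have [Hu _] := eu; have [Hv _] := ev.
have [cu uE] := weak_eigenvectorP qi eu; have [cv vE] := weak_eigenvectorP qi ev.
have [c [d [cd0 cdE]]] : exists c d : R, c ^+ 2 + d ^+ 2 != 0 /\ c * cu + d * cv = 0.
  have [cu0|cu0] := eqVneq (cv ^+ 2 + cu ^+ 2) 0; last first.
    by exists cv, (- cu); rewrite sqrrN; split=> //; ring.
  exists 1, 0; rewrite expr1n expr0n addr0 oner_eq0; split=> //.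
  suff -> : cu = 0 by rewrite mulr0 mul0r addr0.
  apply/eqP; rewrite -sqrf_eq0 eq_le sqr_ge0 andbT -cu0 lerDr sqr_ge0//.
exists c, d; split=> //; set g : E := c *: (u : E) + _.
have Hdv : H10 (d *: (v : E)) by exact: (subspaceZ H10_subspace).
have Hg : H10 g by exact: H10_subspace.2.
have ui := H10_int Hu; have vi := H10_int Hv; have gi := H10_int Hg.
have dvi : integrable01 (fun x => d * v x) by exact: integrable01Z.
have gx x : 0 <= x <= 1 -> primitive g x = c * primitive u x + d * primitive v x.
  move=> x01; rewrite -[d * _]addr0 -[0](_ : primitive (fun=> 0) x = 0); last first.
    by rewrite /primitive Rintegral_cst ?mul0r//; exact: measurable_itv.
  rewrite -primitive_lin//; last exact: integrable01_cst.
  rewrite -primitive_lin//; last by apply: integrable01D => //; exact: integrable01_cst.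
  by apply: eq_primitive => // t _; rewrite addr0.
pose r x := q x - lam.
have ri : integrable01 r by apply: integrable01B => //; exact: integrable01_cst.
have bU h : H10 h -> forall x, 0 <= x <= 1 -> `|primitive h x| <= int01 (fun x => `|h x|).
  by move=> Hh x x01; apply: primitive_bound => //; exact: H10_int.
have wi h : H10 h -> integrable01 (fun t => r t * primitive h t).
  by move=> Hh; apply: (integrable01M ri (primitive_meas_H Hh)) => x x01; exact: bU.
suff U0 x : 0 <= x <= 1 -> primitive g x = 0.
  rewrite -(int01_cst 0); apply: eq_int01 => x x01; rewrite U0 ?mul0r//.
apply: (volterra_unique ri) => [y y01||]; last 2 first.
- exact: primitive_meas_H.
- by exists (int01 (fun x => `|g x|)) => y; exact: bU.
apply: eq_primitive_ae => //; first by apply: integrable01_primitive; exact: wi.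
apply: ae_mono2 uE vE _ => t ut vt t01.
have -> : g t = c * u t + d * v t by [].
rewrite ut// vt//.
have -> : primitive (fun t => r t * primitive g t) t =
    c * primitive (fun t => r t * primitive u t) t + d * primitive (fun t => r t * primitive v t) t.
  rewrite -[d * _]addr0 -[0](_ : primitive (fun=> 0) t = 0); last first.
    by rewrite /primitive Rintegral_cst ?mul0r//; exact: measurable_itv.
  have wu := wi _ Hu; have wv := wi _ Hv.
  rewrite -primitive_lin//; last exact: integrable01_cst.
  rewrite -primitive_lin//; last first.
    by apply: integrable01D; [exact: integrable01Z|exact: integrable01_cst].
  by apply: eq_primitive => // s s01; rewrite gx//; ring.
by rewrite !mulrDr addrACA cdE addr0.
Qed.

End EigenvalueProblem.

(** * The Dirichlet spectrum and its eigenvalue sums *)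

Section Spectrum.
Context {R : realType}.
Local Notation E := (R -> R^o).
Local Notation H10 := (@H10 R).
Local Notation inner01 := (@inner01 R).
Local Notation energy01 := (@energy01 R).
Implicit Types (q : R -> R).

(** Strong induction: if the terms before [n] agree, then the [n]-th term of either
    sequence is some term of the other of index at least [n]. *)
Lemma enumeration_unique q (l1 l2 : nat -> R) :
  eigenvalue_enumeration q l1 -> eigenvalue_enumeration q l2 -> l1 =1 l2.
Proof.
have half (k1 k2 : nat -> R) n : increasing_seq k1 -> increasing_seq k2 ->
    range k1 = range k2 -> (forall i, (i < n)%N -> k1 i = k2 i) -> k2 n <= k1 n.
  move=> i1 i2 r12 eqn; have [j _ kj] : range k2 (k1 n) by rewrite -r12; exists n.
  rewrite -kj.
  rewrite i2 leqNgt; apply/negP => jn.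
  have := eqn j jn; rewrite kj => /eqP; rewrite eq_le i1 => /andP[_].
  by rewrite i1 leqNgt jn.
move=> [i1 r1 _] [i2 r2 _]; have r12 : range l1 = range l2 by rewrite r1.
elim/ltn_ind => n ih; apply/eqP; rewrite eq_le !half//.
by move=> i /ih.
Qed.

Section integrable_potential.
Variable q : R -> R.
Hypothesis qi : integrable01 q.

Let sb := semibounded_schroedinger qi (lexx _).

Lemma basis_eigenvalues_enumeration e :
  spectral_basis H10 inner01 (schroedinger q) e ->
  eigenvalue_enumeration q (fun n => schroedinger q (e n) (e n)).
Proof.
move=> se; have VaD := @H10_energy_space R.
have eigen n : weak_eigenvector H10 inner01 (schroedinger q) (schroedinger q (e n) (e n)) (e n).
  by case: (se n).
have one i j := inner_basis VaD se i j.
split.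
- apply/increasing_seqP => n; rewrite lt_neqAle (basis_nondecreasing se)// andbT.
  apply/eqP => eqn; have en1 := eigen n.+1; rewrite -eqn in en1.
  have [c [d [cd0]]] := eigenvalues_simple qi (eigen n) en1.
  have [Hn _] := eigen n; have [Hn1 _] := en1.
  have Hc := subspaceZ (@H10_subspace R) c Hn.
  rewrite (form_sqrDZ (@H10_subspace R) (@inner01_symform R))//.
  rewrite (form_sqrZ (@H10_subspace R) (@inner01_symform R))//.
  rewrite (formZl (@H10_subspace R) (@inner01_symform R))// !one !eqxx.
  rewrite (_ : (n == n.+1) = false); last by rewrite ltn_eqF.
  by rewrite !mulr0 addr0 !mulr1 => /eqP; rewrite (negbTE cd0).
- apply/seteqP; split=> [_ [n _ <-]|lam [psi]].
    exists (primitive (e n)); apply: weak_eigenvector_dirichlet => //.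
    by rewrite one eqxx ltr01.
  move=> /(dirichlet_weak_eigenvector qi)[g eg g0].
  by have [n ->] := eigenvector_value VaD sb se eg g0; exists n.
- apply/cvgryPge => A; have [N AN] := basis_unbounded VaD sb se A.
  exists N => // n /= Nn; apply: le_trans (ltW AN) _.
  exact: (basis_nondecreasing se).
Qed.

Lemma dirichlet_eigenvalueE : exists2 e, spectral_basis H10 inner01 (schroedinger q) e &
  forall n, dirichlet_eigenvalue q n = schroedinger q (e n) (e n).
Proof.
have [e se] := exists_spectral_basis (@H10_energy_space R) sb.
exists e => // n; have en := basis_eigenvalues_enumeration se.
have ex : eigenvalue_enumeration q (dirichlet_eigenvalue q).
  exact: (@xgetPex _ (fun=> 0) [set l | eigenvalue_enumeration q l] (ex_intro _ _ en)).
exact: (enumeration_unique ex en).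
Qed.

Lemma eigenvalue_sum_attained m : exists2 e : nat -> E, orthonormal H10 inner01 m e &
  eigenvalue_sum m q = \sum_(i < m) schroedinger q (e i) (e i).
Proof.
have [e se eE] := dirichlet_eigenvalueE; exists e.
  exact: (basis_orthonormal (@H10_energy_space R)).
by apply: eq_bigr => i _.
Qed.

Lemma eigenvalue_sum_le m (f : nat -> E) : orthonormal H10 inner01 m f ->
  eigenvalue_sum m q <= \sum_(i < m) schroedinger q (f i) (f i).
Proof.
have [e se eE] := dirichlet_eigenvalueE => onf.
rewrite /eigenvalue_sum; under eq_bigr do rewrite eE.
exact: (ky_fan (@H10_energy_space R) sb).
Qed.

End integrable_potential.
End Spectrum.

(** * Uniform strict convexity of the p-th power *)

Section PowerConvexity.
Context {R : realType}.
Implicit Types (p x y a b t e : R).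

Lemma norm_le_powR p x : 1 <= p -> `|x| <= 1 + `|x| `^ p.
Proof.
move=> p1; have [x1|/ltW x1] := leP `|x| 1; first by rewrite (le_trans x1)// lerDl powR_ge0.
by apply: le_trans (le1r_powR x1 p1) _; rewrite lerDr.
Qed.

Definition midpoint_gap p x y := (`|x| `^ p + `|y| `^ p) / 2 - `|(x + y) / 2| `^ p.

Lemma midpoint_gapC p x y : midpoint_gap p x y = midpoint_gap p y x.
Proof. by rewrite /midpoint_gap [x + y]addrC [_ `^ _ + _]addrC. Qed.

Lemma midpoint_gapM p a x y : 0 <= a -> midpoint_gap p (a * x) (a * y) = a `^ p * midpoint_gap p x y.
Proof.
move=> a0; rewrite /midpoint_gap -mulrDr -mulrA !normrM (ger0_norm a0) !powRM//.
by ring.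
Qed.

Lemma midpoint_gapN p x y : midpoint_gap p (- x) (- y) = midpoint_gap p x y.
Proof. by rewrite /midpoint_gap -opprD mulNr !normrN. Qed.

Section exponent.
Variable p : R.
Hypothesis p1 : 1 < p.

Let p0 : 0 < p. Proof. exact: lt_trans p1. Qed.

Let h : R -> R := fun x => x `^ p.
Let mid : R -> R := 2^-1 \*: (cst 1 + id).
(* the gap at (1, t) for [t >= 0], in a form whose derivative is computed by rules *)
Let phi : R -> R := 2^-1 \*: (cst 1 + h) - (h \o mid).
Let dphi t := 2^-1 * (p * t `^ (p - 1)) - (p * (mid t) `^ (p - 1)) * 2^-1.

Let midE t : mid t = (1 + t) / 2.
Proof. by rewrite /mid mulrC. Qed.

Let phi_derive t : 0 < t -> is_derive t 1 phi (dphi t).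
Proof.
move=> t0; have s0 : 0 < mid t by rewrite midE divr_gt0// addr_gt0.
have d1 := @is_derive1_powR R p _ t0; have d2 := @is_derive1_powR R p _ s0.
have d3 : is_derive t 1 mid 2^-1.
  by apply: is_derive_eq; rewrite add0r [LHS]mulr1.
have d4 := is_derive1_comp d2 d3.
apply: is_derive_eq; rewrite add0r.
by rewrite /dphi.
Qed.

Let dphi_lt0 t : 0 < t < 1 -> dphi t < 0.
Proof.
move=> /andP[t0 t1]; rewrite /dphi midE mulrC -mulrBl pmulr_llt0// -mulrBr pmulr_rlt0//.
rewrite subr_lt0 gt0_ltr_powR ?nnegrE ?subr_gt0 ?divr_ge0//; lra.
Qed.

Let phi_decr a b : 0 < a -> a < b -> b <= 1 -> phi b < phi a.
Proof.
move=> a0 ab b1.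
have [x xab| |x] := MVT (f := phi) (df := dphi) ab.
- by apply: phi_derive; move: xab; rewrite in_itv/= => /andP[ax _]; exact: lt_trans ax.
- apply: derivable_within_continuous => y; rewrite in_itv/= => /andP[ay _].
  by have [] := phi_derive (lt_le_trans a0 ay).
rewrite in_itv/= => /andP[ax xb] phiE.
rewrite -subr_lt0 phiE nmulr_rlt0 ?subr_gt0//.
by apply: dphi_lt0; rewrite (lt_trans a0)//= (lt_le_trans xb).
Qed.

Let phi1 : phi 1 = 0.
Proof.
rewrite [LHS](_ : _ = 2^-1 * (1 + 1 `^ p) - (mid 1) `^ p)// midE.
by rewrite powR1 (_ : (1 + 1) / 2 = 1) ?powR1; lra.
Qed.

Let phiE t : 0 <= t -> phi t = midpoint_gap p 1 t.
Proof.
move=> t0; rewrite [LHS](_ : _ = 2^-1 * (1 + t `^ p) - (mid t) `^ p)// midE.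
rewrite /midpoint_gap normr1 powR1 !ger0_norm//; first by lra.
by rewrite divr_ge0// addr_ge0.
Qed.

(** For [t > 0] the gap at (1, t) decreases strictly to 0 at [t = 1]; for [t <= 0]
    it is at least [1/2 - (1/2)^p]. *)
Lemma midpoint_gap_lower e : 0 < e < 1 -> exists2 d, 0 < d &
  forall t, -1 <= t <= 1 - e -> d <= midpoint_gap p 1 t.
Proof.
move=> /andP[e0 e1].
have e1' : 0 < 1 - e by lra.
have e1'' : 1 - e < 1 by lra.
pose d1 := phi (1 - e); pose d2 : R := 2^-1 - 2^-1 `^ p.
have d10 : 0 < d1 by rewrite -phi1; apply: phi_decr.
have h1 : 2^-1 `^ p < 2^-1 :> R.
  rewrite -[X in _ < X](@powRr1 _ 2^-1)// /powR invr_eq0 pnatr_eq0/= ltr_expR.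
  by rewrite ltr_nM2r// ln_lt0// invr_gt0 invf_lt1// ltr1n ltr0n.
have d20 : 0 < d2 by rewrite subr_gt0.
exists (Num.min d1 d2); first by rewrite lt_min d10 d20.
move=> t /andP[t1 te]; rewrite ge_min.
have [t0|t0] := ltP 0 t.
  rewrite -phiE ?(ltW t0)//; apply/orP; left.
  move: te; rewrite le_eqVlt => /predU1P[->//|te].
  by apply/ltW/phi_decr => //; exact: ltW.
apply/orP; right; rewrite /midpoint_gap /d2 normr1 powR1.
have : `|(1 + t) / 2| `^ p <= 2^-1 `^ p.
  apply: ge0_ler_powR; rewrite ?nnegrE ?(ltW p0)//.
  by rewrite ger0_norm ?divr_ge0//; lra.
have := powR_ge0 `|t| p; lra.
Qed.

Lemma midpoint_gap1_ge0 t : -1 <= t <= 1 -> 0 <= midpoint_gap p 1 t.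
Proof.
move=> /andP[t1]; rewrite le_eqVlt => /predU1P[->|t1'].
  by rewrite -phiE ?phi1.
pose e := Num.min (1 - t) 2^-1.
have e01 : 0 < e < 1 by rewrite lt_min gt_min; apply/andP; split; [apply/andP|apply/orP; right]; lra.
have [d d0 hd] := midpoint_gap_lower e01.
apply: le_trans (ltW d0) (hd t _); rewrite t1/=.
by rewrite lerBrDr -lerBrDl ge_min lexx.
Qed.

(** Symmetry and parity reduce a statement about all pairs to the pairs whose first
    entry is positive and largest in absolute value. *)
Lemma midpoint_gap_ind (P : R -> R -> Prop) :
  (forall x y, P x y -> P y x) -> (forall x y, P x y -> P (- x) (- y)) ->
  P 0 0 -> (forall a t, 0 < a -> -1 <= t <= 1 -> P a (a * t)) ->
  forall x y, P x y.
Proof.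
move=> Psym Popp P0 Pat.
have pos x y : 0 < x -> `|y| <= x -> P x y.
  move=> x0 yx; have -> : y = x * (y / x) by rewrite mulrCA divff ?mulr1// gt_eqF.
  apply: Pat => //; rewrite -ler_norml normrM normfV (gtr0_norm x0).
  by rewrite ler_pdivrMr// mul1r.
have big x y : `|y| <= `|x| -> P x y.
  have [x0|x0|->] := ltgtP x 0; last by rewrite normr0 normr_le0 => /eqP ->.
    rewrite (ltr0_norm x0) => yx; rewrite -[x]opprK -[y]opprK; apply: Popp.
    by apply: pos; rewrite ?oppr_gt0// normrN.
  by rewrite (gtr0_norm x0); exact: pos.
by move=> x y; have [/big|/ltW/big/Psym] := leP `|y| `|x|.
Qed.

Lemma midpoint_gap_ge0 x y : 0 <= midpoint_gap p x y.
Proof.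
apply: (midpoint_gap_ind (P := fun x y => 0 <= midpoint_gap p x y)) x y => [x y|x y||a t a0 t1].
- by rewrite midpoint_gapC.
- by rewrite midpoint_gapN.
- by rewrite /midpoint_gap addr0 mul0r !normr0 powR0 ?gt_eqF// addr0 mul0r subrr.
- rewrite -[X in midpoint_gap p X _]mulr1 midpoint_gapM; last exact: ltW.
  by apply: mulr_ge0; [exact: powR_ge0|exact: midpoint_gap1_ge0].
Qed.

(** A substitute for Clarkson's inequalities, valid for all [p > 1]: nearly equal or
    small entries are paid for by the first term; otherwise, by homogeneity, the
    gap is at least a multiple of the larger [p]-th power.  Integrated, it turns a
    small mean gap into closeness in L^1. *)
Lemma dist_le_midpoint_gap e : 0 < e -> exists2 C, 0 <= C & forall x y,
  `|x - y| <= e * (1 + `|x| `^ p + `|y| `^ p) + C * midpoint_gap p x y.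
Proof.
move=> e0; pose e' := Num.min (e / 2) 2^-1.
have e2 : 0 < e / 2 by rewrite divr_gt0.
have e'01 : 0 < e' < 1 by rewrite lt_min gt_min e2/= invr_gt0 invf_lt1 ?ltr1n ?ltr0n ?orbT.
have [d d0 hd] := midpoint_gap_lower e'01.
have ep0 : 0 < (e / 2) `^ p by rewrite powR_gt0.
pose C := e / ((e / 2) `^ p * d).
have C0 : 0 <= C by rewrite divr_ge0 ?mulr_ge0 ?ltW.
exists C => //.
apply: midpoint_gap_ind => [x y|x y||a t a0 t1].
- by rewrite distrC midpoint_gapC [_ + _ + `|y| `^ p]addrAC.
- by rewrite -opprD !normrN midpoint_gapN.
- rewrite subrr normr0; apply: addr_ge0.
    apply: mulr_ge0; first exact: ltW.
    by apply: addr_ge0; rewrite ?powR_ge0//; apply: addr_ge0; rewrite ?powR_ge0.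
  by apply: mulr_ge0 => //; exact: midpoint_gap_ge0.
have [t1l t1r] := andP t1.
have -> : a - a * t = a * (1 - t) by rewrite mulrBr mulr1.
have gE : midpoint_gap p a (a * t) = a `^ p * midpoint_gap p 1 t.
  by rewrite -[in LHS](mulr1 a) -mulrA mul1r midpoint_gapM ?mulr1// ltW.
rewrite normrM (gtr0_norm a0) (ger0_norm (_ : 0 <= 1 - t)); last by lra.
have at0 := powR_ge0 `|a * t| p; have a0' := powR_ge0 a p.
have [te|te] := leP t (1 - e'); last first.
  have : e' <= e / 2 by rewrite ge_min lexx.
  have := norm_le_powR a (ltW p1); rewrite (gtr0_norm a0) => ap ee.
  have : 0 <= C * midpoint_gap p a (a * t) by rewrite mulr_ge0// midpoint_gap_ge0.
  have : a * (1 - t) <= (1 + a `^ p) * (e / 2).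
    by apply: ler_pM; lra.
  have : 0 <= e * `|a * t| `^ p by rewrite mulr_ge0// (ltW e0).
  have : 0 <= e * a `^ p by rewrite mulr_ge0// (ltW e0).
  lra.
have G : d <= midpoint_gap p 1 t by apply: hd; rewrite t1l te.
have a2 : a * (1 - t) <= 2 * a by nra.
have [ae|ea] := leP a (e / 2).
  have : 0 <= C * midpoint_gap p a (a * t) by rewrite mulr_ge0// midpoint_gap_ge0.
  have : 0 <= e * `|a * t| `^ p by rewrite mulr_ge0// (ltW e0).
  have : 0 <= e * a `^ p by rewrite mulr_ge0// (ltW e0).
  lra.
have H : 2 * a <= C * midpoint_gap p a (a * t).
  have : a / (e / 2) <= (a / (e / 2)) `^ p.
    by apply: le1r_powR; [rewrite ler_pdivlMr// mul1r ltW|exact: ltW].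
  have -> : (a / (e / 2)) `^ p = a `^ p / (e / 2) `^ p.
    have e2n : e / 2 != 0 by rewrite gt_eqF.
    have q0 : 0 <= a / (e / 2) by rewrite divr_ge0 ?(ltW a0) ?(ltW e2).
    have -> : a `^ p = (a / (e / 2)) `^ p * (e / 2) `^ p.
      by rewrite -powRM ?(ltW e2)// divfK.
    by rewrite mulfK// gt_eqF.
  rewrite ler_pdivrMr// => H.
  apply: (@le_trans _ _ (e * (a `^ p / (e / 2) `^ p))); first by lra.
  have -> : C * midpoint_gap p a (a * t) =
      e * (a `^ p / (e / 2) `^ p) * (midpoint_gap p 1 t / d).
    by rewrite gE /C; field; rewrite !gt_eqF.
  apply: ler_peMr; last by rewrite ler_pdivlMr// mul1r.
  by rewrite mulr_ge0 ?(ltW e0)// divr_ge0 ?(ltW ep0).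
have : 0 <= e * (1 + a `^ p + `|a * t| `^ p) by rewrite mulr_ge0 ?addr_ge0 ?(ltW e0).
lra.
Qed.

End exponent.
End PowerConvexity.

(** * Balls of L^p *)

Section LpBall.
Context {R : realType}.
Local Notation mu := (@lebesgue_measure R).
Local Notation mu01 := (@mu01 R).
Local Notation I01 := (`[(0 : R), (1 : R)]%classic).
Implicit Types (q : R -> R) (p c : R).

Let mI : measurable (I01 : set (measurableTypeR R)).
Proof. exact: measurable_itv. Qed.

(** The complement of the interval is null for the restricted measure. *)
Lemma integral_mu01 (f : R -> \bar R) : measurable_fun [set: R] f ->
  (forall x, 0 <= f x)%E -> (\int[mu01]_x f x = \int[mu]_(x in I01) f x)%E.
Proof.
move=> mf f0; rewrite -(setUv I01) ge0_integral_setU//; last 3 first.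
- exact: measurableC.
- by rewrite setUv.
- exact/disj_setPCl.
rewrite [X in (_ + X)%E]null_set_integral//; last 3 first.
- exact: measurableC.
- exact: measurable_funTS mf.
- by transitivity (mu (~` I01 `&` I01)); rewrite // setICl measure0.
rewrite adde0; apply: eq_measure_integral => A mA AI.
by transitivity (mu (A `&` I01)); rewrite // setIidl.
Qed.

Definition Lp_pow p q : R -> R := fun x => `|q x| `^ p.

Lemma Lp_pow_ge0 p q x : 0 <= Lp_pow p q x. Proof. exact: powR_ge0. Qed.

Lemma Lp_pow_meas p q (D : set (measurableTypeR R)) : measurable_fun D q -> measurable_fun D (Lp_pow p q).
Proof.
move=> mq; apply: (@measurableT_comp _ _ _ _ _ _ (@powR R ^~ p)) => //.
exact: measurableT_comp.
Qed.

Lemma Lp01_norm_pow p q : measurable_fun [set: R] q ->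
  Lp01_norm p q = ((\int[mu]_(x in I01) (Lp_pow p q x)%:E) `^ p^-1)%E.
Proof.
move=> mq; rewrite /Lp01_norm unlock; congr poweR.
rewrite -integral_mu01; last 2 first.
- by apply/measurable_EFinP; apply: Lp_pow_meas.
- by move=> x; rewrite lee_fin Lp_pow_ge0.
by apply: eq_integral => x _.
Qed.

Lemma Lp01P p q : 0 < p ->
  Lp01 p q <-> measurable_fun [set: R] q /\ integrable01 (Lp_pow p q).
Proof.
move=> p0; have pV0 : p^-1 != 0 by rewrite invr_eq0 gt_eqF.
rewrite /Lp01/=; split.
  rewrite inE => /andP[]; rewrite inE => mq; rewrite inE/= /finite_norm => Nq.
  have {}mq : measurable_fun [set: R] q by exact: mq.
  split=> //; apply/integrableP; split.
    by apply/measurable_EFinP; exact: Lp_pow_meas (measurable_funTS mq).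
  have := Nq; rewrite -[X in (X < _)%E]/(Lp01_norm p q) Lp01_norm_pow//.
  move=> /(lty_poweRy pV0); congr (_ < _)%E; apply: eq_integral => x _.
  by rewrite /= ger0_norm// Lp_pow_ge0.
move=> [mq qp]; rewrite inE; apply/andP; split; first by rewrite inE.
rewrite inE/= /finite_norm -[X in (X < _)%E]/(Lp01_norm p q) Lp01_norm_pow//.
by rewrite poweR_lty// EFin_int01// ltry.
Qed.

Lemma Lp01_normE p q : measurable_fun [set: R] q -> integrable01 (Lp_pow p q) ->
  Lp01_norm p q = (int01 (Lp_pow p q) `^ p^-1)%:E.
Proof. by move=> mq qp; rewrite Lp01_norm_pow// EFin_int01// poweR_EFin. Qed.

Section ball.
Variables p r : R.
Hypotheses (p1 : 1 < p) (r0 : 0 < r).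

Let p0 : 0 < p. Proof. exact: lt_trans p1. Qed.

Lemma Lp01_norm_leP q c : 0 <= c -> measurable_fun [set: R] q -> integrable01 (Lp_pow p q) ->
  (Lp01_norm p q <= c%:E)%E = (int01 (Lp_pow p q) <= c `^ p).
Proof.
move=> c0 mq qp; rewrite Lp01_normE// lee_fin.
have I0 : 0 <= int01 (Lp_pow p q) by apply: int01_ge0 => x _; exact: Lp_pow_ge0.
apply/idP/idP => [|h].
  move=> /(ge0_ler_powR (ltW p0)); rewrite !nnegrE powR_ge0 c0 => /(_ isT isT).
  by rewrite -powRrM mulVf ?gt_eqF// powRr1.
have := @ge0_ler_powR R p^-1; rewrite invr_ge0 (ltW p0) => /(_ isT _ _ _ _ h).
by rewrite !nnegrE I0 powR_ge0 -powRrM mulfV ?gt_eqF// powRr1// => /(_ isT isT).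
Qed.

Lemma Lp01_ballP q : Lp01_ball p r q <->
  [/\ measurable_fun [set: R] q, integrable01 (Lp_pow p q) & int01 (Lp_pow p q) <= r `^ p].
Proof.
split.
  by move=> [/(Lp01P _ p0)[mq qp]]; rewrite Lp01_norm_leP// ltW.
move=> [mq qp qr]; split; first by apply/(Lp01P _ p0).
by rewrite Lp01_norm_leP// ltW.
Qed.

Lemma Lp01_integrable q : measurable_fun I01 q -> integrable01 (Lp_pow p q) ->
  integrable01 q /\ int01 (fun x => `|q x|) <= 1 + int01 (Lp_pow p q).
Proof.
move=> mq qp; have bi := integrable01D (integrable01_cst 1) qp.
have qi : integrable01 q.
  by apply: (integrable01_le mq _ bi) => x _; apply: norm_le_powR; exact: ltW.
split=> //; rewrite -[X in X + _]int01_cst -int01D//; last exact: integrable01_cst.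
apply: int01_le => //; first exact: integrable01_norm.
by move=> x _; apply: norm_le_powR; exact: ltW.
Qed.

Lemma ball_integrable q : Lp01_ball p r q ->
  integrable01 q /\ int01 (fun x => `|q x|) <= 1 + r `^ p.
Proof.
move=> /Lp01_ballP[mq qp qr].
have [qi qn] := Lp01_integrable (measurable_funTS mq) qp.
by split=> //; apply: le_trans qn _; rewrite lerD2l.
Qed.

(** Minkowski's inequality; a constant [c] has norm [|c|], the interval having
    measure 1. *)
Lemma ball_translate q c (s : R) : 0 <= s -> s + `|c| <= r -> measurable_fun [set: R] q ->
  integrable01 (Lp_pow p q) -> int01 (Lp_pow p q) <= s `^ p ->
  Lp01_ball p r (fun x => q x + c).
Proof.
move=> s0 scr mq qp qs.
have mc : measurable_fun [set: R] (fun=> c : R) by exact: measurable_cst.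
have mqc : measurable_fun [set: R] (fun x => q x + c) by exact: measurable_funD.
have cp : integrable01 (Lp_pow p (fun=> c)) by exact: integrable01_cst.
have : (Lp01_norm p (fun x => (q x + c)%R) <= r%:E)%E.
  apply: le_trans (minkowski_EFin mu01 mq mc (ltW p1)) _.
  apply: (@le_trans _ _ (s%:E + `|c|%:E)%E); last by rewrite -EFinD lee_fin.
  apply: leeD; first by rewrite -/(Lp01_norm p q) Lp01_norm_leP.
  rewrite -/(Lp01_norm p (fun=> c)) Lp01_norm_leP//.
  by rewrite [int01 _]int01_cst.
move=> Nr; split=> //.
rewrite /Lp01/= inE; apply/andP; split; first by rewrite inE.
rewrite inE/= /finite_norm -[X in (X < _)%E]/(Lp01_norm p _).
exact: le_lt_trans Nr (ltry _).
Qed.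

Lemma powR_pV x : 0 <= x -> (x `^ p) `^ p^-1 = x.
Proof. by move=> x0; rewrite -powRrM mulfV ?gt_eqF// powRr1. Qed.

Lemma ball0 : Lp01_ball p r (fun=> 0).
Proof.
have cp : integrable01 (Lp_pow p (fun=> 0)) by exact: integrable01_cst.
apply/Lp01_ballP; split => //; rewrite [int01 _]int01_cst normr0 powR0 ?gt_eqF//.
exact: powR_ge0.
Qed.

End ball.
End LpBall.

(** * The eigenvalue sum as a minimum of affine functions of the potential *)

Section EigenvalueSum.
Context {R : realType}.
Local Notation E := (R -> R^o).
Local Notation H10 := (@H10 R).
Local Notation inner01 := (@inner01 R).
Local Notation energy01 := (@energy01 R).
Local Notation I01 := (`[(0 : R), (1 : R)]%classic).
Implicit Types (q : R -> R) (f e : nat -> E) (c N : R).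

Section frames.
Variable m : nat.

Definition frame_energy f : R := \sum_(i < m) energy01 (f i) (f i).
Definition density f (x : R) : R := \sum_(i < m) primitive (f i) x ^+ 2.

Let frame := orthonormal H10 inner01 m.

Section frame.
Variable f : nat -> E.
Hypothesis onf : frame f.

Let Hf (i : 'I_m) : H10 (f i). Proof. exact: onf.1. Qed.

Lemma density_ge0 x : 0 <= density f x.
Proof. by apply: sumr_ge0 => i _; exact: sqr_ge0. Qed.

Lemma density_le_energy x : 0 <= x <= 1 -> density f x <= frame_energy f.
Proof.
by move=> x01; apply: ler_sum => i _; apply: primitive_sqr_le => //; exact: H10_sqr.
Qed.

Lemma density_meas : measurable_fun I01 (density f).
Proof.
apply: measurable_sum => i; apply: measurable_funX; exact: primitive_meas_H.
Qed.

Lemma density_norm x : 0 <= x <= 1 -> `|density f x| <= frame_energy f.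
Proof. by move=> x01; rewrite ger0_norm ?density_ge0// density_le_energy. Qed.

Lemma integrable01_density q : integrable01 q -> integrable01 (fun x => q x * density f x).
Proof. by move=> qi; apply: (integrable01M qi density_meas) => x; exact: density_norm. Qed.

Lemma integrable_density : integrable01 (density f).
Proof. by apply: (integrable01_bounded density_meas) => x; exact: density_norm. Qed.

Lemma frame_form q : integrable01 q ->
  \sum_(i < m) schroedinger q (f i) (f i) =
  frame_energy f + int01 (fun x => q x * density f x).
Proof.
move=> qi; rewrite big_split/=; congr (_ + _).
rewrite (@eq_int01 _ _ (fun x => \sum_(i < m) (q x * (primitive (f i) x * primitive (f i) x)))).
  by rewrite (int01_sum (F := fun i x => q x * (primitive (f i) x * primitive (f i) x)))// => i im;
    apply: integrable01_pot => //; exact: onf.1.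
by move=> x _; rewrite /density mulr_sumr; apply: eq_bigr => i _; rewrite expr2.
Qed.

Lemma density_int : int01 (density f) = m%:R.
Proof.
rewrite (int01_sum (F := fun i x => primitive (f i) x ^+ 2)); last first.
  move=> i im; have Hi : H10 (f i) by exact: onf.1.
  by apply: eq_integrable01 (integrable01_inner Hi Hi) => x _; rewrite expr2.
rewrite (eq_bigr (fun=> 1)) ?sumr_const ?card_ord// => i _.
have <- : inner01 (f i) (f i) = 1 by rewrite onf.2 ?eqxx.
by apply: eq_int01 => x _; rewrite expr2.
Qed.

Lemma frame_energy_ge0 : 0 <= frame_energy f.
Proof. by apply: sumr_ge0 => i _; exact: energy01_ge0. Qed.

Lemma eigenvalue_sum_le_frame q : integrable01 q ->
  eigenvalue_sum m q <= frame_energy f + int01 (fun x => q x * density f x).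
Proof. by move=> qi; rewrite -frame_form//; exact: eigenvalue_sum_le. Qed.

Lemma frame_energy_le q N : integrable01 q -> int01 (fun x => `|q x|) <= N ->
  frame_energy f <=
  2 * (frame_energy f + int01 (fun x => q x * density f x)) + (16 * N * (N + 1)) * m%:R.
Proof.
move=> qi qN; have sb := semibounded_schroedinger qi qN.
rewrite -frame_form//.
have -> : (16 * N * (N + 1)) * m%:R = \sum_(i < m) (16 * N * (N + 1)) :> R.
  by rewrite sumr_const card_ord mulr_natr.
rewrite mulr_sumr -big_split/=; apply: ler_sum => i _.
have := energy_le_semi sb (Hf i); rewrite onf.2// eqxx mulr1; exact.
Qed.

End frame.

Lemma exists_frame : exists f, frame f.
Proof.
have [h /(_ m)[Hh h1 h0]] := @H10_infinite R; exists (h m); split=> // i j im jm.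
by case: eqVneq => [<-|/h0//]; rewrite h1// ltnW.
Qed.

Lemma eigenvalue_sum_frame q : integrable01 q -> exists2 e, frame e &
  eigenvalue_sum m q = frame_energy e + int01 (fun x => q x * density e x).
Proof.
by move=> qi; have [e one qe] := eigenvalue_sum_attained qi m; exists e => //;
  rewrite qe frame_form.
Qed.

(** A frame optimal at the midpoint bounds the sums at both ends by affine functions
    whose mean is the sum at the midpoint. *)
Lemma eigenvalue_sum_concave q1 q2 : integrable01 q1 -> integrable01 q2 ->
  (eigenvalue_sum m q1 + eigenvalue_sum m q2) / 2 <=
  eigenvalue_sum m (fun x => 2^-1 * (q1 x + q2 x)).
Proof.
move=> i1 i2; have i12 := integrable01Z 2^-1 (integrable01D i1 i2).
have [e one ->] := eigenvalue_sum_frame i12.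
have h1 := eigenvalue_sum_le_frame one i1; have h2 := eigenvalue_sum_le_frame one i2.
rewrite (@eq_int01 _ _ (fun x => 2^-1 * (q1 x * density e x + q2 x * density e x))).
  have d1 := integrable01_density one i1; have d2 := integrable01_density one i2.
  by rewrite int01Z ?int01D//; [lra|exact: integrable01D].
by move=> x _; rewrite -mulrDl mulrA.
Qed.

Lemma eigenvalue_sum_translate_le q c : integrable01 q ->
  eigenvalue_sum m (fun x => q x + c) <= eigenvalue_sum m q + c * m%:R.
Proof.
move=> qi; have [e one ->] := eigenvalue_sum_frame qi.
have ci : integrable01 (fun x => q x + c).
  by apply: integrable01D => //; exact: integrable01_cst.
apply: le_trans (eigenvalue_sum_le_frame one ci) _.
rewrite (@eq_int01 _ _ (fun x => q x * density e x + c * density e x)); last first.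
  by move=> x _; rewrite mulrDl.
have di := integrable_density one.
rewrite int01D//; [|exact: integrable01_density|exact: integrable01Z].
by rewrite int01Z// density_int// addrA.
Qed.

Lemma eigenvalue_sum_ext q1 q2 : integrable01 q1 -> (forall x, 0 <= x <= 1 -> q1 x = q2 x) ->
  eigenvalue_sum m q1 = eigenvalue_sum m q2.
Proof.
have half (p1 p2 : R -> R) : integrable01 p1 -> integrable01 p2 ->
    (forall x, 0 <= x <= 1 -> p1 x = p2 x) -> eigenvalue_sum m p1 <= eigenvalue_sum m p2.
  move=> i1 i2 p12; have [e one ->] := eigenvalue_sum_frame i2.
  apply: le_trans (eigenvalue_sum_le_frame one i1) _.
  by rewrite lerD2l le_eqVlt; apply/orP; left; apply/eqP/eq_int01 => x /p12 ->.
move=> i1 q12; have i2 := eq_integrable01 q12 i1.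
by apply/eqP; rewrite eq_le !half// => x /q12.
Qed.

Lemma eigenvalue_sum_translate q c : integrable01 q ->
  eigenvalue_sum m (fun x => q x + c) = eigenvalue_sum m q + c * m%:R.
Proof.
move=> qi; apply/eqP; rewrite eq_le eigenvalue_sum_translate_le//=.
have ci : integrable01 (fun x => q x + c).
  by apply: integrable01D => //; exact: integrable01_cst.
have := eigenvalue_sum_translate_le (- c) ci.
rewrite (@eigenvalue_sum_ext _ q); last 2 first.
- by apply: integrable01D => //; exact: integrable01_cst.
- by move=> x _; rewrite addrK.
by rewrite mulNr lerBrDr.
Qed.

(** Testing with a fixed frame bounds the sum above; Garding's inequality then
    bounds the energy of optimal frames, and the sum below.  The bounds depend only
    on the L^1 norm of the potential, hence are uniform on a ball of L^p. *)
Lemma eigenvalue_sum_bounds N : exists L K : R, forall q, integrable01 q ->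
  int01 (fun x => `|q x|) <= N ->
  [/\ L <= eigenvalue_sum m q, eigenvalue_sum m q <= K & forall e, frame e ->
      eigenvalue_sum m q = frame_energy e + int01 (fun x => q x * density e x) ->
      frame_energy e <= 2 * K + (16 * N * (N + 1)) * m%:R].
Proof.
have [h onh] := exists_frame; have h0 := frame_energy_ge0 h.
exists (- (16 * N * (N + 1)) * m%:R / 2), (frame_energy h + N * frame_energy h) => q qi qN.
have [e one qe] := eigenvalue_sum_frame qi.
have := frame_energy_le one qi qN; rewrite -qe.
have := frame_energy_ge0 e => e0 H.
have qK : eigenvalue_sum m q <= frame_energy h + N * frame_energy h.
  apply: le_trans (eigenvalue_sum_le_frame onh qi) _; rewrite lerD2l.
  apply: (@le_trans _ _ (frame_energy h * int01 (fun x => `|q x|))); last first.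
    by rewrite mulrC ler_wpM2r.
  rewrite -int01Z; last exact: integrable01_norm.
  apply: int01_le; first exact: integrable01_density.
    by apply: integrable01Z; exact: integrable01_norm.
  move=> x x01; apply: le_trans (ler_norm _) _; rewrite normrM mulrC ler_wpM2r//.
  exact: density_norm.
split=> // [|g ong gE]; first by move: H; lra.
have := frame_energy_le ong qi qN; rewrite -gE; lra.
Qed.

End frames.
End EigenvalueSum.

(** * The minimum over a ball *)

Section Minimum.
Context {R : realType}.
Local Notation E := (R -> R^o).
Local Notation H10 := (@H10 R).
Local Notation inner01 := (@inner01 R).
Local Notation I01 := (`[(0 : R), (1 : R)]%classic).
Local Notation mu := (@lebesgue_measure R).
Implicit Types (q : R -> R) (e : nat -> E).
Variables p r : R.
Hypotheses (p1 : 1 < p) (r0 : 0 < r).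

Let p0 : 0 < p. Proof. exact: lt_trans p1. Qed.

Let mI : measurable (I01 : set (measurableTypeR R)).
Proof. exact: measurable_itv. Qed.

(** The equality case of Hoelder's inequality.  Let [- Q] be the multiple of
    [rho ^ (1 / (p - 1))] of norm [r], so that [Q ^ (p - 1) = k * rho].  Young's
    inequality for [|q'|] and [Q ^ (p - 1)] integrates to
    [- k * int01 (q' * rho) <= r ^ p], with equality at [q' = - Q]. *)
Lemma linear_minimizer (rho : R -> R) (M : R) : measurable_fun I01 rho ->
  (forall x, 0 <= x <= 1 -> 0 <= rho x <= M) -> 0 < int01 rho ->
  exists q, [/\ measurable_fun [set: R] q, integrable01 (Lp_pow p q),
    int01 (Lp_pow p q) = r `^ p &
    forall q', Lp01_ball p r q' ->
      int01 (fun x => q x * rho x) <= int01 (fun x => q' x * rho x)].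
Proof.
move: p1 p0 r0 => p1' p0' r0' mrho rhoM Irho.
have rn x : 0 <= x <= 1 -> `|rho x| <= M.
  by move=> x01; have /andP[h0 hM] := rhoM x x01; rewrite ger0_norm.
have pp : 0 < p - 1 by lra.
pose s := (p - 1)^-1; have s0 : 0 < s by rewrite invr_gt0.
pose Q0 x := rho x `^ s.
have Q00 x : 0 <= Q0 x by exact: powR_ge0.
have mQ0 : measurable_fun I01 Q0 by exact: (@measurableT_comp _ _ _ _ _ _ (@powR R ^~ s)).
have Q0M x : 0 <= x <= 1 -> `|Q0 x| <= M `^ s.
  move=> x01; have /andP[h0 hM] := rhoM x x01; rewrite ger0_norm//.
  by apply: ge0_ler_powR; rewrite ?nnegrE ?(ltW s0)// (le_trans h0).
have Q0p : integrable01 (fun x => Q0 x `^ p).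
  apply: (@integrable01_bounded _ _ ((M `^ s) `^ p)).
    exact: (@measurableT_comp _ _ _ _ _ _ (@powR R ^~ p)).
  move=> x x01; rewrite ger0_norm ?powR_ge0//.
  by apply: ge0_ler_powR; rewrite ?nnegrE ?powR_ge0 ?(ltW p0)//; have := Q0M x x01; rewrite ger0_norm.
have rhoi : integrable01 rho by exact: integrable01_bounded mrho rn.
pose Z := int01 (fun x => Q0 x `^ p).
have Z0 : 0 < Z.
  rewrite lt_neqAle int01_ge0 ?andbT; last by move=> x _; exact: powR_ge0.
  apply/eqP => Z0; have := int01_eq0_ae Q0p (fun x _ => powR_ge0 _ _) (esym Z0).
  move=> /ae_mono H; suff rho0 : int01 rho = int01 (fun=> 0).
    by move: Irho; rewrite rho0 int01_cst ltxx.
  apply: eq_int01_ae => //; first exact: integrable01_cst.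
  by apply: H => x Qx x01; apply: powR_eq0_eq0 (powR_eq0_eq0 (Qx x01)).
pose c := r / Z `^ p^-1.
have Zp0 : 0 < Z `^ p^-1 by exact: powR_gt0.
have c0 : 0 < c by exact: divr_gt0.
have cZ : c `^ p * Z = r `^ p.
  have -> : r = c * Z `^ p^-1 by rewrite divfK// gt_eqF.
  by rewrite powRM ?(ltW c0) ?(ltW Zp0)// -powRrM mulVf ?gt_eqF// powRr1// ltW.
pose Q x := c * Q0 x.
have Qge0 x : 0 <= Q x by rewrite mulr_ge0// ltW.
have QpE x : Q x `^ p = c `^ p * Q0 x `^ p by rewrite powRM// ltW.
have Qpi : integrable01 (fun x => Q x `^ p).
  by apply: eq_integrable01 (integrable01Z (c `^ p) Q0p) => x _; rewrite QpE.
have IQ : int01 (fun x => Q x `^ p) = r `^ p.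
  by rewrite -cZ -int01Z//; apply: eq_int01 => x _; rewrite QpE.
pose k := c `^ (p - 1); have k0 : 0 < k by exact: powR_gt0.
have Qp1 x : 0 <= x <= 1 -> Q x `^ (p - 1) = k * rho x.
  move=> x01; have /andP[h0 _] := rhoM x x01.
  by rewrite powRM ?(ltW c0)// -powRrM mulVf ?gt_eqF// powRr1.
pose q := (fun x => - Q x) \_ I01.
have qE x : 0 <= x <= 1 -> q x = - Q x.
  by move=> x01; rewrite /q patchE mem_set// mem01.
have mq : measurable_fun [set: R] q.
  apply/(measurable_restrictT _ mI); apply: measurableT_comp => //.
  exact: measurable_funM.
have qpE x : 0 <= x <= 1 -> Lp_pow p q x = Q x `^ p.
  by move=> x01; rewrite /Lp_pow qE// normrN ger0_norm.
exists q; split=> //.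
- by apply: eq_integrable01 Qpi => x x01; rewrite qpE.
- by rewrite -IQ; exact: eq_int01.
move=> q' /[dup] bq' /(Lp01_ballP p1 r0)[mq' qp' qr'].
have [qi' _] := ball_integrable p1 r0 bq'.
have qrho : integrable01 (fun x => q' x * rho x) by exact: integrable01M rn.
have Qi : integrable01 Q.
  apply: integrable01Z; exact: integrable01_bounded Q0M.
have Qrho : integrable01 (fun x => Q x * rho x) by exact: integrable01M rn.
have -> : int01 (fun x => q x * rho x) = - int01 (fun x => Q x * rho x).
  rewrite -mulN1r -int01Z//; apply: eq_int01 => x x01.
  by rewrite qE// mulN1r mulNr.
have kQ : k * int01 (fun x => Q x * rho x) = r `^ p.
  rewrite -int01Z// -IQ; apply: eq_int01 => x x01.
  by rewrite mulrCA -Qp1// mulr_powRB1.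
have pV : p^-1 + (p / (p - 1))^-1 = 1 by field; rewrite !gt_eqF.
have ip1 : integrable01 (fun x => p^-1 * Lp_pow p q' x) by exact: integrable01Z.
have ip2 : integrable01 (fun x => (p / (p - 1))^-1 * Q x `^ p) by exact: integrable01Z.
have : - k * int01 (fun x => q' x * rho x) <= r `^ p.
  apply: (@le_trans _ _ (int01 (fun x => p^-1 * Lp_pow p q' x + (p / (p - 1))^-1 * Q x `^ p))).
    rewrite -int01Z//; apply: int01_le; [exact: integrable01Z|exact: integrable01D|].
    move=> x x01; have -> : - k * (q' x * rho x) = - q' x * (Q x `^ (p - 1)).
      by rewrite Qp1//; ring.
    apply: (@le_trans _ _ (`|q' x| * Q x `^ (p - 1))).
      by rewrite ler_wpM2r ?powR_ge0// -normrN ler_norm.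
    have q0 : 0 < p / (p - 1) by exact: divr_gt0.
    have := conjugate_powR (normr_ge0 (q' x)) (powR_ge0 (Q x) (p - 1)) p0 q0 pV.
    rewrite -[X in _ <= _ + X / _]powRrM [(p - 1) * _]mulrC divfK ?gt_eqF//.
    by rewrite [_ / p]mulrC [_ / (p / _)]mulrC.
  rewrite int01D// !int01Z// IQ.
  have pi0 : 0 < p^-1 by rewrite invr_gt0.
  have : p^-1 * int01 (Lp_pow p q') <= p^-1 * r `^ p by rewrite ler_pM2l.
  have -> : (p / (p - 1))^-1 = 1 - p^-1 by lra.
  lra.
rewrite mulNr -kQ; nra.
Qed.

Section frames.
Variable m : nat.
Hypothesis m0 : (0 < m)%N.
Let frame := orthonormal H10 inner01 m.

(** [|u ^ 2 - v ^ 2| = |u - v| * |u + v|], and the energy bounds both factors. *)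
Lemma density_modulus e (M : R) x y : frame e -> frame_energy m e <= M ->
  0 <= x <= 1 -> 0 <= y <= 1 ->
  `|density m e x - density m e y| <= Num.sqrt (`|x - y| * (2 * M) ^+ 2).
Proof.
move=> one eM x01 y01; have e0 := frame_energy_ge0 m e.
have M0 : 0 <= 2 * M by apply: mulr_ge0 => //; exact: le_trans eM.
rewrite sqrtrM// sqrtr_sqr (ger0_norm M0).
rewrite /density -sumrB; apply: le_trans (ler_norm_sum _ _ _) _.
apply: (@le_trans _ _ (Num.sqrt `|x - y| * (2 * frame_energy m e))); last first.
  by rewrite ler_wpM2l ?sqrtr_ge0// ler_pM2l.
rewrite !mulr_sumr; apply: ler_sum => i _.
have es : square_integrable01 (e i) by apply: H10_sqr; exact: one.1.
have D0 := energy01_ge0 (e i).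
have h1 := primitive_modulus es x01 y01.
have hx := primitive_sqr_le es x01; have hy := primitive_sqr_le es y01.
have -> : Num.sqrt `|x - y| * (2 * energy01 (e i) (e i)) =
    Num.sqrt (`|x - y| * (2 * energy01 (e i) (e i)) ^+ 2).
  by rewrite sqrtrM// sqrtr_sqr (ger0_norm (mulr_ge0 _ D0)).
rewrite -sqrtr_sqr ler_wsqrtr//.
move: (primitive (e i) x) (primitive (e i) y) (energy01 _ _) `|x - y| D0 h1 hx hy => a b D t D0 h1 hx hy.
have -> : (a ^+ 2 - b ^+ 2) ^+ 2 = (a - b) ^+ 2 * (a + b) ^+ 2 by ring.
have -> : t * (2 * D) ^+ 2 = (t * D) * (4 * D) by ring.
apply: ler_pM; rewrite ?sqr_ge0//.
have := sqr_ge0 (a - b); nra.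
Qed.

(** Along a minimizing sequence with optimal frames, the densities converge uniformly
    to some [rho] of integral [m].  The potential [qm] of the ball that minimizes
    [int01 (q * rho)], tested with the frame of the [k]-th potential, has an
    eigenvalue sum that exceeds the [k]-th one at most by the cost of replacing the
    density by [rho] twice, which tends to 0.  No limit of potentials is taken. *)
Lemma exists_minimizer : exists q, [/\ measurable_fun [set: R] q, integrable01 (Lp_pow p q),
    int01 (Lp_pow p q) = r `^ p &
    forall q', Lp01_ball p r q' -> eigenvalue_sum m q <= eigenvalue_sum m q'].
Proof.
pose N := 1 + r `^ p.
have N0 : 0 <= N by rewrite addr_ge0// powR_ge0.
have [L [K LK]] := @eigenvalue_sum_bounds R m N.
have bK q : Lp01_ball p r q -> [/\ integrable01 q, int01 (fun x => `|q x|) <= N,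
    L <= eigenvalue_sum m q & exists2 e, frame e &
      eigenvalue_sum m q = frame_energy m e + int01 (fun x => q x * density m e x) /\
      frame_energy m e <= 2 * K + (16 * N * (N + 1)) * m%:R].
  move=> /(ball_integrable p1 r0)[qi qN]; have [qL qK qe] := LK q qi qN.
  by split=> //; have [e one eE] := eigenvalue_sum_frame m qi; exists e => //; split=> //; exact: qe.
pose M := 2 * K + (16 * N * (N + 1)) * m%:R.
pose A := [set eigenvalue_sum m q | q in Lp01_ball p r].
have Ai : has_inf A.
  split; first by exists (eigenvalue_sum m (fun=> 0)); exists (fun=> 0) => //; exact: ball0.
  by exists L => _ [q bq <-]; case: (bK q bq).
pose l := inf A.
have step n : exists q, Lp01_ball p r q /\ eigenvalue_sum m q <= l + harmonic n.
  have [_ [q bq <-] ql] := inf_adherent (harmonic_gt0 n : 0 < harmonic n :> R) Ai.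
  by exists q; split=> //; exact: ltW.
have [q hq] := choice step.
have bq n : Lp01_ball p r (q n) by case: (hq n).
have qi n : integrable01 (q n) by case: (bK _ (bq n)).
have qN n : int01 (fun x => `|q n x|) <= N by case: (bK _ (bq n)).
have ex n : exists en : nat -> E, frame en /\
    (eigenvalue_sum m (q n) = frame_energy m en + int01 (fun x => q n x * density m en x) /\
    frame_energy m en <= M).
  by have [_ _ _ [en one eM]] := bK _ (bq n); exists en.
have [e he] := choice ex.
have one n : frame (e n) by case: (he n).
have eM n : frame_energy m (e n) <= M by case: (he n) => _ [].
have [| | |rho [kappa [kge krho _]]] := @arzela_ascoli R (fun n => density m (e n)) M
    (fun t => Num.sqrt (t * (2 * M) ^+ 2)).
- by move=> n x x01; apply: le_trans (density_norm (one n) x01) (eM n).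
- by move=> n x y x01 y01; exact: density_modulus.
- by move=> d d0; apply: sqrt_modulus => //; exact: sqr_ge0.
pose rk n := density m (e (kappa n)).
have rkcvg x : 0 <= x <= 1 -> rk n x @[n --> \oo] --> rho x.
  move=> x01; apply/cvgrPdist_le => eps eps0.
  near=> n; rewrite distrC; apply: le_trans (krho n x x01) _.
  near: n; have /cvgrPdist_le/(_ _ eps0) := @cvg_harmonic R.
  by apply: filterS => n; rewrite sub0r normrN ger0_norm// harmonic_ge0.
have mrho : measurable_fun I01 rho.
  apply: (@measurable_fun_cvg _ _ _ _ rk) => [n|x]; first exact: density_meas (one _).
  by rewrite mem01; exact: rkcvg.
have le_lim (a : R) : (forall n, a <= harmonic n) -> a <= 0.
  by move=> h; apply: (@le0_of_le_inv _ _ 1) => n; rewrite mul1r.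
have rho_bnd x : 0 <= x <= 1 -> 0 <= rho x <= M.
  move=> x01; apply/andP; split; [rewrite -oppr_le0|rewrite -subr_le0];
    apply: le_lim => n; have := krho n x x01; rewrite ler_norml => /andP[].
    by have := density_ge0 m (e (kappa n)) x; lra.
  by have := density_le_energy (one (kappa n)) x01; have := eM (kappa n); lra.
have rhoi : integrable01 rho.
  apply: (integrable01_bounded mrho (c := M)) => x /rho_bnd /andP[h0 hM].
  by rewrite ger0_norm.
have Irho : int01 rho = m%:R.
  have rki n : integrable01 (rk n) by exact: integrable_density (one _).
  have close n : `|int01 rho - m%:R| <= harmonic n.
    rewrite -(density_int (one (kappa n))) -(int01B rhoi (rki n)) -[leRHS]int01_cst.
    have di := integrable01B rhoi (rki n).
    apply: le_trans (int01_norm di) _; apply: int01_le => //.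
    - exact: integrable01_norm.
    - exact: integrable01_cst.
    - by move=> x x01; rewrite distrC; exact: krho.
  by apply/eqP; rewrite -subr_eq0 -normr_le0; exact: le_lim.
have [|qm [mqm qmp qmr qmin]] := linear_minimizer mrho rho_bnd.
  by rewrite Irho ltr0n.
exists qm; split=> // q' bq'.
have bqm : Lp01_ball p r qm by apply/(Lp01_ballP p1 r0); split=> //; rewrite qmr.
have [qmi qmN _ _] := bK _ bqm.
suff qml : eigenvalue_sum m qm <= l.
  by apply: le_trans qml _; apply: ge_inf; [case: Ai|exists q'].
rewrite -subr_le0; apply: (@le0_of_le_inv _ _ (1 + 2 * N)) => n.
pose k := kappa n.
have onk := one k; have [_ [Ek _]] := he k; have [_ Ekl] := hq k.
have hk : harmonic k <= harmonic n :> R.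
  by rewrite /harmonic lef_pV2 ?posrE// ler_nat ltnS; exact: kge.
have := eigenvalue_sum_le_frame onk qmi.
have := qmin _ (bq k).
(* replacing the density of the frame by its limit costs at most N / (n + 1) *)
have close qq : integrable01 qq -> int01 (fun x => `|qq x|) <= N ->
    `|int01 (fun x => qq x * density m (e k) x) - int01 (fun x => qq x * rho x)| <=
    N * harmonic n.
  move=> qqi qqN; have i1 := integrable01_density onk qqi.
  have i2 : integrable01 (fun x => qq x * rho x).
    by apply: (integrable01M qqi mrho (c := M)) => x /rho_bnd /andP[h0 hM]; rewrite ger0_norm.
  rewrite -int01B//; apply: le_trans (int01_norm (integrable01B i1 i2)) _.
  apply: (@le_trans _ _ (int01 (fun x => harmonic n * `|qq x|))).
    have qqn := integrable01_norm qqi.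
    apply: int01_le; [exact: integrable01_norm (integrable01B i1 i2)|exact: integrable01Z|].
    move=> x x01; rewrite -mulrBr normrM mulrC ler_wpM2r//; exact: krho.
  rewrite int01Z; last exact: integrable01_norm.
  by rewrite mulrC ler_wpM2r// harmonic_ge0.
have := close _ qmi qmN; have := close _ (qi k) (qN k).
move: Ekl; rewrite Ek !ler_norml => h1 /andP[h2 h3] /andP[h4 h5] h6 h7.
have : (1 + 2 * N) * harmonic n = harmonic n + 2 * (N * harmonic n) by ring.
lra.
Unshelve. all: by end_near. Qed.

End frames.
End Minimum.

(** * The maximum over a ball *)

Lemma half_sum_le {R : realFieldType} (a b c : R) : a <= c -> b <= c -> (a + b) / 2 <= c.
Proof. lra. Qed.

Lemma near_half_sum {R : realFieldType} (S d a b x y : R) :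
  S - a <= x -> S - b <= y -> a <= d -> b <= d -> S - d <= (x + y) / 2.
Proof. lra. Qed.

(** How the error [e] is shared between the two terms of [dist_le_midpoint_gap]: half
    for each, [s] being the [p]-th power of the radius. *)
Lemma cauchy_budget {R : realFieldType} (e s C a b c : R) :
  0 < e -> 0 <= s -> 0 <= C -> a <= s -> b <= s -> s - e / (2 * (C + 1)) <= c ->
  e / (2 * (1 + 2 * s)) * (1 + a + b) + C * ((a + b) / 2 - c) <= e.
Proof.
move=> e0 s0 C0 as_ bs cs.
have E1 : e / (2 * (1 + 2 * s)) * (1 + 2 * s) = e / 2 by field; rewrite gt_eqF//; lra.
have E2 : (C + 1) * (e / (2 * (C + 1))) = e / 2 by field; rewrite gt_eqF//; lra.
have eta0 : 0 < e / (2 * (C + 1)) by rewrite divr_gt0//; lra.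
have eps0 : 0 < e / (2 * (1 + 2 * s)) by rewrite divr_gt0//; lra.
have : e / (2 * (1 + 2 * s)) * (1 + a + b) <= e / (2 * (1 + 2 * s)) * (1 + 2 * s).
  by rewrite ler_pM2l//; lra.
have : C * ((a + b) / 2 - c) <= C * (e / (2 * (C + 1))) by rewrite ler_wpM2l//; lra.
have : C * (e / (2 * (C + 1))) <= (C + 1) * (e / (2 * (C + 1))) by rewrite ler_pM2r//; lra.
lra.
Qed.


Section Maximum.
Context {R : realType}.
Local Notation I01 := (`[(0 : R), (1 : R)]%classic).
Local Notation mu := (@lebesgue_measure R).
Implicit Types (q : R -> R).
Variables p r : R.
Hypotheses (p1 : 1 < p) (r0 : 0 < r).

Let p0 : 0 < p. Proof. exact: lt_trans p1. Qed.

Let mI : measurable (I01 : set (measurableTypeR R)).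
Proof. exact: measurable_itv. Qed.

Lemma cvg_powR (u : nat -> R) (a : R) : (forall n, 0 <= u n) -> u @ \oo --> a ->
  u n `^ p @[n --> \oo] --> a `^ p.
Proof.
move=> u0 ua.
have : 0 <= a.
  by rewrite -(cvg_lim _ ua)//; apply: limr_ge; [apply/cvg_ex; exists a|apply: nearW].
rewrite le_eqVlt => /predU1P[a0|a0].
  rewrite -a0 powR0 ?gt_eqF//; rewrite -a0 in ua.
  apply/cvgrPdist_le => e e0.
  have m0 : 0 < Num.min e 1 by rewrite lt_min e0 ltr01.
  move/cvgrPdist_le : ua => /(_ _ m0); apply: filterS => n.
  rewrite !sub0r !normrN !ger0_norm ?powR_ge0// le_min => /andP[une un1].
  apply: le_trans une; have := u0 n; rewrite le_eqVlt => /predU1P[<-|un0].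
    by rewrite powR0 ?gt_eqF.
  by apply: ge1r_powR; [rewrite un0|exact: ltW].
apply: (cvg_comp u (fun x => x `^ p) ua).
have /derivable1_diffP/differentiable_continuous : derivable (fun x => x `^ p) a 1.
  by have [] := @is_derive1_powR R p _ a0.
exact.
Qed.

Section eigenvalues.
Variable m : nat.
Hypothesis m0 : (0 < m)%N.

(** Translating upwards by a constant raises the eigenvalue sum and keeps a potential
    of norm well below [r] in the ball: near-maximizers lie near the sphere. *)
Lemma near_maximizer_norm (S : R) :
  (forall q, Lp01_ball p r q -> eigenvalue_sum m q <= S) ->
  forall eta, 0 < eta -> exists2 d, 0 < d & forall q, Lp01_ball p r q ->
    S - d <= eigenvalue_sum m q -> r `^ p - eta <= int01 (Lp_pow p q).
Proof.
move: p0 r0 => p0' r0' SE eta eta0.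
have [h|h] := leP (r `^ p) eta.
  exists 1 => // q _ _; apply: (@le_trans _ _ 0); first by lra.
  by apply: int01_ge0 => x _; exact: Lp_pow_ge0.
pose s := (r `^ p - eta) `^ p^-1.
have sp : s `^ p = r `^ p - eta.
  by rewrite /s -powRrM mulVf ?gt_eqF// powRr1//; lra.
have s0 : 0 <= s by exact: powR_ge0.
have sr : s < r.
  rewrite -[ltRHS](powR_pV p1 (ltW r0)) /s.
  apply: gt0_ltr_powR; rewrite ?invr_gt0// ?nnegrE ?powR_ge0//; lra.
have m0' : 0 < m%:R :> R by rewrite ltr0n.
have rm : 0 < (r - s) * m%:R by rewrite mulr_gt0 ?subr_gt0.
exists ((r - s) * m%:R / 2); first by rewrite divr_gt0.
move=> q bq Eq; rewrite leNgt; apply/negP => Iq.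
have [mq qp _] := (Lp01_ballP p1 r0 q).1 bq.
have [qi _] := ball_integrable p1 r0 bq.
have : Lp01_ball p r (fun x => q x + (r - s)).
  apply: (ball_translate p1 (s := s)) => //.
    by rewrite ger0_norm ?subr_ge0 ?(ltW sr)// addrC subrK.
  by rewrite sp ltW.
by move=> /SE; rewrite eigenvalue_sum_translate//; lra.
Qed.

Lemma ball_midpoint q1 q2 : Lp01_ball p r q1 -> Lp01_ball p r q2 ->
  Lp01_ball p r (fun x => 2^-1 * (q1 x + q2 x)) /\
  int01 (fun x => midpoint_gap p (q1 x) (q2 x)) =
    (int01 (Lp_pow p q1) + int01 (Lp_pow p q2)) / 2 -
    int01 (Lp_pow p (fun x => 2^-1 * (q1 x + q2 x))).
Proof.
move=> /(Lp01_ballP p1 r0)[mq1 q1p q1r] /(Lp01_ballP p1 r0)[mq2 q2p q2r].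
pose q x := 2^-1 * (q1 x + q2 x).
have mq : measurable_fun [set: R] q.
  by apply: measurable_funM => //; exact: measurable_funD.
have si := integrable01Z 2^-1 (integrable01D q1p q2p).
have gapE x : midpoint_gap p (q1 x) (q2 x) =
    2^-1 * (Lp_pow p q1 x + Lp_pow p q2 x) - Lp_pow p q x.
  by rewrite /midpoint_gap /Lp_pow /q [_ / 2]mulrC [(_ + _) / 2]mulrC.
have le x : Lp_pow p q x <= 2^-1 * (Lp_pow p q1 x + Lp_pow p q2 x).
  by rewrite -subr_ge0 -gapE; exact: midpoint_gap_ge0.
have qp : integrable01 (Lp_pow p q).
  apply: (integrable01_le _ _ si) => [|x _].
    exact: Lp_pow_meas (measurable_funTS mq).
  by rewrite ger0_norm ?Lp_pow_ge0.
have sE : int01 (fun x => 2^-1 * (Lp_pow p q1 x + Lp_pow p q2 x)) =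
    (int01 (Lp_pow p q1) + int01 (Lp_pow p q2)) / 2.
  by rewrite int01Z ?int01D ?[_ / 2]mulrC//; exact: integrable01D.
split.
  apply/(Lp01_ballP p1 r0); split; [exact: mq|exact: qp|].
  have : int01 (Lp_pow p q) <= int01 (fun x => 2^-1 * (Lp_pow p q1 x + Lp_pow p q2 x)).
    by apply: (int01_le qp si) => x _; exact: le.
  by move=> /le_trans; apply; rewrite sE; exact: half_sum_le.
by rewrite -sE -(int01B si qp); apply: eq_int01 => x _; exact: gapE.
Qed.

(** By concavity the midpoint of two near-maximizers is a near-maximizer, so that its
    norm is close to [r] and the mean midpoint gap of the two is small. *)
Lemma maximizing_cauchy (S : R) (q : nat -> R -> R) :
  (forall q, Lp01_ball p r q -> eigenvalue_sum m q <= S) ->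
  (forall n, Lp01_ball p r (q n)) ->
  (forall n, S - harmonic n <= eigenvalue_sum m (q n)) ->
  forall e, 0 < e -> exists N, forall j k, (N <= j)%N -> (N <= k)%N ->
    int01 (fun x => `|q j x - q k x|) <= e.
Proof.
move=> SE bq Sq e e0; have rp0 : 0 <= r `^ p by exact: powR_ge0.
pose eps := e / (2 * (1 + 2 * r `^ p)).
have eps0 : 0 < eps by rewrite divr_gt0//; lra.
have [C C0 hC] := dist_le_midpoint_gap p1 eps0.
pose eta := e / (2 * (C + 1)).
have eta0 : 0 < eta by rewrite divr_gt0//; lra.
have [d d0 hd] := near_maximizer_norm SE eta0.
have [N _ hN] : \forall n \near \oo, harmonic n <= d.
  have /cvgrPdist_le/(_ _ d0) := @cvg_harmonic R.
  by apply: filterS => n; rewrite sub0r normrN ger0_norm// harmonic_ge0.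
exists N => j k Nj Nk.
have [qji _] := ball_integrable p1 r0 (bq j).
have [qki _] := ball_integrable p1 r0 (bq k).
have [_ qjp qjr] := (Lp01_ballP p1 r0 (q j)).1 (bq j).
have [_ qkp qkr] := (Lp01_ballP p1 r0 (q k)).1 (bq k).
have [bmid gapE] := ball_midpoint (bq j) (bq k).
have [_ midp _] := (Lp01_ballP p1 r0 _).1 bmid.
have midr := hd _ bmid _.
have {}midr : r `^ p - eta <= int01 (Lp_pow p (fun x => 2^-1 * (q j x + q k x))).
  apply: midr; apply: le_trans (eigenvalue_sum_concave m qji qki).
  exact: near_half_sum (Sq j) (Sq k) (hN j Nj) (hN k Nk).
have i1 : integrable01 (fun x => eps * (1 + Lp_pow p (q j) x + Lp_pow p (q k) x)).
  apply: integrable01Z; apply: integrable01D => //; apply: integrable01D => //.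
  exact: integrable01_cst.
have gi : integrable01 (fun x => midpoint_gap p (q j x) (q k x)).
  have := integrable01B (integrable01Z 2^-1 (integrable01D qjp qkp)) midp.
  apply: eq_integrable01 => x _.
  by rewrite /midpoint_gap /Lp_pow [_ / 2]mulrC [(_ + _) / 2]mulrC.
have i2 := integrable01Z C gi.
apply: (@le_trans _ _ (int01 (fun x => eps * (1 + Lp_pow p (q j) x + Lp_pow p (q k) x) +
    C * midpoint_gap p (q j x) (q k x)))).
  apply: int01_le => [||x _]; last exact: hC.
    by apply: integrable01_norm; exact: integrable01B.
  exact: integrable01D.
have i3 : integrable01 (fun x => 1 + Lp_pow p (q j) x).
  by apply: integrable01D => //; exact: integrable01_cst.
have i4 := integrable01D i3 qkp.
rewrite (int01D i1 i2) (int01Z eps i4) (int01Z C gi) (int01D i3 qkp).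
rewrite (int01D (integrable01_cst 1) qjp) int01_cst gapE.
exact: cauchy_budget.
Qed.

(** The L^1 limit of a maximizing sequence lies in the ball by Fatou's lemma.  Its
    own optimal frame, whose density is bounded, bounds the sums along the sequence
    by the sum at the limit plus a multiple of the L^1 distance. *)
Lemma exists_maximizer : exists q, [/\ measurable_fun [set: R] q, integrable01 (Lp_pow p q),
    int01 (Lp_pow p q) = r `^ p &
    forall q', Lp01_ball p r q' -> eigenvalue_sum m q' <= eigenvalue_sum m q].
Proof.
pose N := 1 + r `^ p.
have [L [K LK]] := @eigenvalue_sum_bounds R m N.
pose A := [set eigenvalue_sum m q | q in Lp01_ball p r].
have As : has_sup A.
  split; first by exists (eigenvalue_sum m (fun=> 0)); exists (fun=> 0) => //; exact: ball0.
  by exists K => _ [q /(ball_integrable p1 r0)[qi qN] <-]; case: (LK q qi qN).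
pose S := sup A.
have SE q : Lp01_ball p r q -> eigenvalue_sum m q <= S.
  by move=> bq; apply: sup_upper_bound => //; exists q.
have step n : exists q, Lp01_ball p r q /\ S - harmonic n <= eigenvalue_sum m q.
  have [_ [q bq <-] ql] := sup_adherent (harmonic_gt0 n : 0 < harmonic n :> R) As.
  by exists q; split=> //; exact: ltW.
have [q hq] := choice step.
have bq n : Lp01_ball p r (q n) by case: (hq n).
have Sq n : S - harmonic n <= eigenvalue_sum m (q n) by case: (hq n).
have qi n : integrable01 (q n) by case: (ball_integrable p1 r0 (bq n)).
have cq := maximizing_cauchy SE bq Sq.
have mq n : measurable_fun I01 (q n) by exact: integrable01_meas.
have dqi j k : integrable01 (fun x => `|q j x - q k x|).
  by apply: integrable01_norm; exact: integrable01B.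
have [e e0|g [kappa [mg kge kg]]] := @cauchy_ae_cvg _ _ R mu _ mI q mq.
  have [M hM] := cq e e0; exists M => j k Mj Mk.
  by rewrite EFin_int01// lee_fin hM.
have gp : integrable01 (Lp_pow p g) /\ int01 (Lp_pow p g) <= r `^ p.
  apply: integrable01_ge0_lty => [|x _|]; [exact: Lp_pow_meas|exact: Lp_pow_ge0|].
  apply: (@fatou_ae _ _ _ mu _ mI (fun n => Lp_pow p (q (kappa n))) _ (fun=> r `^ p)).
  - by move=> n; apply: Lp_pow_meas; exact: mq.
  - exact: Lp_pow_meas.
  - by move=> n x _; exact: Lp_pow_ge0.
  - by move=> x _; exact: Lp_pow_ge0.
  - apply: ae_mono kg _ => x kgx Ix; apply: cvg_powR => //.
    by apply: cvg_norm; exact: kgx.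
  - move=> n; have [_ qp qr] := (Lp01_ballP p1 r0 _).1 (bq (kappa n)).
    by rewrite EFin_int01// lee_fin.
  - exact: cvg_cst.
have [gpi gpr] := gp.
have [gi _] := Lp01_integrable p1 mg gpi.
have close e : 0 < e -> exists M, forall n, (M <= n)%N -> int01 (fun x => `|q n x - g x|) <= e.
  move=> e0; have [M hM] := cq e e0; exists M => n Mn.
  suff [] : integrable01 (fun x => `|q n x - g x|) /\ int01 (fun x => `|q n x - g x|) <= e by [].
  have mqg : measurable_fun I01 (fun x => `|q n x - g x|).
    by apply: measurableT_comp => //; exact: (measurable_funB (mq n) mg).
  apply: integrable01_ge0_lty => //.
  apply: (@fatou_ae _ _ _ mu _ mI (fun j x => `|q n x - q (kappa (j + M)%N) x|) _ (fun=> e)) => //.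
  - by move=> j; exact: integrable01_meas.
  - apply: ae_mono kg _ => x kgx Ix; apply: cvg_norm; apply: cvgB; first exact: cvg_cst.
    by have := kgx Ix; rewrite -(cvg_shiftn M).
  - move=> j; rewrite EFin_int01// lee_fin hM//.
    by apply: leq_trans (kge _); exact: leq_addl.
  - exact: cvg_cst.
pose qp := g \_ I01.
have qpE x : 0 <= x <= 1 -> qp x = g x by move=> x01; rewrite /qp patchE mem_set// mem01.
have mqp : measurable_fun [set: R] qp by apply/(measurable_restrictT _ mI).
have Lqp x : 0 <= x <= 1 -> Lp_pow p g x = Lp_pow p qp x by move=> x01; rewrite /Lp_pow qpE.
have qpp : integrable01 (Lp_pow p qp) by exact: eq_integrable01 gpi.
have bqp : Lp01_ball p r qp.
  by apply/(Lp01_ballP p1 r0); split=> //; rewrite -(eq_int01 Lqp).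
have [qpi _] := ball_integrable p1 r0 bqp.
have SqP : S <= eigenvalue_sum m qp.
  have [f onf fE] := eigenvalue_sum_frame m qpi.
  have D0 := frame_energy_ge0 m f; set D := frame_energy m f in D0 fE.
  apply/ler_addgt0Pr => e e0.
  pose e' := e / (2 * (D + 1)).
  have e'0 : 0 < e' by rewrite divr_gt0//; lra.
  have [M hM] := close e' e'0.
  have e20 : 0 < e / 2 by rewrite divr_gt0.
  have [M' _ hM'] : \forall n \near \oo, harmonic n <= e / 2.
    have /cvgrPdist_le/(_ _ e20) := @cvg_harmonic R.
    by apply: filterS => n; rewrite sub0r normrN ger0_norm// harmonic_ge0.
  pose n := maxn M M'.
  have := hM n (leq_maxl _ _); have := hM' n (leq_maxr _ _).
  have := Sq n; have := eigenvalue_sum_le_frame onf (qi n); rewrite fE -/D.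
  have i1 := integrable01_density onf (qi n); have i2 := integrable01_density onf qpi.
  have : int01 (fun x => q n x * density m f x) - int01 (fun x => qp x * density m f x) <=
      D * int01 (fun x => `|q n x - g x|).
    have ni : integrable01 (fun x => `|q n x - g x|).
      by apply: integrable01_norm; exact: integrable01B.
    rewrite -int01B// -int01Z//; apply: int01_le; [exact: integrable01B|exact: integrable01Z|].
    move=> x x01; rewrite -mulrBl qpE//; apply: le_trans (ler_norm _) _.
    by rewrite normrM mulrC ler_wpM2r//; exact: density_norm.
  have e'E : (D + 1) * e' = e / 2 by rewrite /e'; field; rewrite gt_eqF//; lra.
  move: (int01 (fun x => `|q n x - g x|)) (harmonic n) => I h h1 h2 h3 h4 h5.
  have : D * I <= D * e' by rewrite ler_wpM2l.
  move: e'0 e'E h1 h2 h3 h4; rewrite mulrDl mul1r; move: (int01 _) (int01 _) => A1 A2; lra.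
exists qp; split=> // [|q' /SE/le_trans]; last exact.
apply/eqP; rewrite eq_le; have [_ _ ->] := (Lp01_ballP p1 r0 _).1 bqp => /=.
rewrite -subr_le0 leNgt; apply/negP => gap0.
have eta0 : 0 < (r `^ p - int01 (Lp_pow p qp)) / 2 by rewrite divr_gt0.
have [d d0 hd] := near_maximizer_norm SE eta0.
have : S - d <= eigenvalue_sum m qp by lra.
by move=> /(hd _ bqp); lra.
Qed.

End eigenvalues.
End Maximum.

Unset Implicit Arguments.

Theorem theorem3p3 (R : realType) (p r : R) (m : nat)
    (hp : 1 < p) (hr : 0 < r) (hm : (2 <= m)%N) :
  exists qminus qplus : R -> R,
    [/\ Lp01 p qminus /\ Lp01 p qplus,
        Lp01_norm p qminus = r%:E /\ Lp01_norm p qplus = r%:E,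
        eigenvalue_sum_inf m p r = (eigenvalue_sum m qminus)%:E &
        eigenvalue_sum_sup m p r = (eigenvalue_sum m qplus)%:E].
Proof.
have p0 : 0 < p by exact: lt_trans hp.
have m0 : (0 < m)%N by exact: ltnW.
have [q1 [mq1 q1p q1r q1min]] := exists_minimizer hp hr m0.
have [q2 [mq2 q2p q2r q2max]] := exists_maximizer hp hr m0.
have norm_r q : measurable_fun [set: R] q -> integrable01 (Lp_pow p q) ->
    int01 (Lp_pow p q) = r `^ p -> Lp01_norm p q = r%:E.
  by move=> mq qp qr; rewrite Lp01_normE// qr (powR_pV hp (ltW hr)).
have ball q : measurable_fun [set: R] q -> integrable01 (Lp_pow p q) ->
    int01 (Lp_pow p q) = r `^ p -> Lp01_ball p r q.
  by move=> mq qp qr; apply/(Lp01_ballP hp hr); split=> //; rewrite qr.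
exists q1, q2; split.
- by split; apply/(Lp01P _ p0).
- by split; exact: norm_r.
- apply/eqP; rewrite eq_le; apply/andP; split.
    by apply: ereal_inf_lbound; exists q1 => //; exact: ball.
  by apply: le_ereal_inf_tmp => _ [q bq <-]; rewrite lee_fin; exact: q1min.
- apply/eqP; rewrite eq_le; apply/andP; split; last first.
    by apply: ereal_sup_ubound; exists q2 => //; exact: ball.
  by apply: ge_ereal_sup => _ [q bq <-]; rewrite lee_fin; exact: q2max.
Qed.
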